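(* Let $\Lambda=\begin{pmatrix} A & N \\ M & B \end{pmatrix}$ be a null-square projective algebra, with $\mathbb A=A\times B$ and $\mathbb M=M\oplus N$. For $m>0$ let $$\nabla'_{2m}:\mathsf{Hom}_{\mathbb A-\mathbb A}\left(\mathbb M^{\otimes_{\mathbb A}2m},\mathbb A\right)\to\mathsf{Hom}_{\mathbb A-\mathbb A}\left(\mathbb M^{\otimes_{\mathbb A}2m+1},\mathbb M\right)$$ be the map described in the context. For $m>0$, the following holds: - $\mathsf{HH}^{2m}(\Lambda)=\mathsf{HH}^{2m}(\mathbb A)\oplus\mathsf{Ker}\,\nabla'_{2m}$. - There is a short exact sequence $$0\to\mathsf{Coker}\,\nabla'_{2m}\to\mathsf{HH}^{2m+1}(\Lambda)\to\mathsf{HH}^{2m+1}(\mathbb A)\to0.$$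
   Context: $k$ is a field; algebras are nonzero associative unital $k$-algebras, not necessarily finite dimensional. $\mathsf{HH}^n(\Lambda)=\mathsf{Ext}^n_{\Lambda\otimes_k\Lambda^{op}}(\Lambda,\Lambda)$; $\mathsf{Hom}_{\mathbb A-\mathbb A}$ denotes morphisms of $\mathbb A$-bimodules. Equality of cohomology spaces means isomorphism of vector spaces. **Null-square projective algebras.** Let $A,B$ be algebras, $M$ a nonzero $B$-$A$-bimodule and $N$ a nonzero $A$-$B$-bimodule. The null-square algebra $\Lambda=\begin{pmatrix} A & N \\ M & B \end{pmatrix}$ has matrix multiplication given by the bimodule structures, with all products $mn$ and $nm$ ($m\in M$, $n\in N$) equal to zero. It is called null-square projective if $M$ and $N$ are projective bimodules, equivalently if $\mathbb M=M\oplus N$ is a projective bimodule over $\mathbb A=A\times B$ (actions extended by zero). Thus $\Lambda=\mathbb A\oplus\mathbb M$ with $\mathbb M^2=0$. **The map $\nabla'_{2m}$.** Let $D=k\times k\subset\mathbb A$ and let $\mathsf J^\bullet$ be the complex $\mathsf J^0=\Lambda^D$, $\mathsf J^n=\mathsf{Hom}_{D-D}(\Lambda^{\otimes_Dn},\Lambda)$ with the Hochschild coboundary; its cohomology is $\mathsf{HH}^\bullet(\Lambda)$. Let $\mathsf D^\bullet\subset\mathsf J^\bullet$ be the subcomplex of cochains that vanish on all tensors $x_1\otimes\cdots\otimes x_n$ (each $x_i$ in $\mathbb A$ or $\mathbb M$) having an even number of factors in $\mathbb M$ (in degree $0$, $\mathsf D^0=0$). For $m>0$, with $\mathbb M$ projective,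 $\mathsf H^{2m}((\mathsf J/\mathsf D)^\bullet)=\mathsf{HH}^{2m}(\mathbb A)\oplus\mathsf{Hom}_{\mathbb A-\mathbb A}(\mathbb M^{\otimes_{\mathbb A}2m},\mathbb A)$ and $\mathsf H^{2m+1}(\mathsf D^\bullet)=\mathsf{Hom}_{\mathbb A-\mathbb A}(\mathbb M^{\otimes_{\mathbb A}2m+1},\mathbb M)$, a bimodule map on $\mathbb M^{\otimes_{\mathbb A}n}$ being viewed as the cochain supported on $\mathbb M^{\otimes_Dn}$ through the projection $\mathbb M^{\otimes_Dn}\to\mathbb M^{\otimes_{\mathbb A}n}$. $\nabla_{2m}$ is the connecting homomorphism of $0\to\mathsf D^\bullet\to\mathsf J^\bullet\to(\mathsf J/\mathsf D)^\bullet\to0$, and $\nabla'_{2m}$ is its restriction to the summand $\mathsf{Hom}_{\mathbb A-\mathbb A}(\mathbb M^{\otimes_{\mathbb A}2m},\mathbb A)$. Explicitly, $\nabla'_{2m}(\varphi)=1_{\mathbb M}\otimes\varphi-\varphi\otimes1_{\mathbb M}$, i.e. $\nabla'_{2m}(\varphi)(x_1\otimes\cdots\otimes x_{2m+1})=x_1\varphi(x_2\otimes\cdots\otimes x_{2m+1})-\varphi(x_1\otimes\cdots\otimes x_{2m})x_{2m+1}$. *)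

(* Defs.v *)
From HB Require Import structures.
From mathcomp Require Import freeg.
From mathcomp Require Import all_boot all_order all_algebra.
From mathcomp Require Import ring_quotient generic_quotient.
From mathcomp Require Import boolp classical_sets functions.

Set Implicit Arguments.
Unset Strict Implicit.
Unset Printing Implicit Defensive.

Import GRing.Theory.
Local Open Scope ring_scope.
Local Open Scope quotient_scope.

Record subspace (k : fieldType) (V : lmodType k) (S : submodClosed V) :=
  Subspace { subspace_val :> V; subspace_valP : subspace_val \in S }.

Section Subspace.
Variables (k : fieldType) (V : lmodType k) (S : submodClosed V).
HB.instance Definition _ := [isSub for @subspace_val k V S].
HB.instance Definition _ := [Choice of subspace S by <:].
HB.instance Definition _ := [SubChoice_isSubLmodule of subspace S by <:].
End Subspace.

(* [Quotient.quot] wants a [zmodClosed], which [submodClosed] does not imply by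
   inheritance since it is also meant for semimodules. *)
Definition zmod_pred (k : fieldType) (V : lmodType k) (S : submodClosed V) :
  {pred V} := fun x => x \in S.
HB.instance Definition _ (k : fieldType) (V : lmodType k) (S : submodClosed V) :=
  GRing.isZmodClosed.Build V (zmod_pred S)
    (GRing.submod_closedB (submodClosedP S)).
Definition zmod_of (k : fieldType) (V : lmodType k) (S : submodClosed V) :
  zmodClosed V := zmod_pred S.

Definition quotspace (k : fieldType) (V : lmodType k) (S : submodClosed V) :
  Type := Quotient.quot (zmod_of S).

Section Quotspace.
Variables (k : fieldType) (V : lmodType k) (S : submodClosed V).
Local Notation Q := (quotspace S).

HB.instance Definition _ := GRing.Zmodule.on Q.

Definition qproj (x : V) : Q := \pi_(Quotient.quot (zmod_of S)) x.
Definition qrepr (q : Q) : V := repr (q : Quotient.quot (zmod_of S)).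

Lemma qreprK : cancel qrepr qproj.
Proof. by move=> q; rewrite /qproj /qrepr reprK. Qed.

Lemma qproj_eq x y : (qproj x == qproj y) = (x - y \in S).
Proof. by rewrite (Quotient.idealrBE (zmod_of S)). Qed.

Lemma qproj_repr x : qrepr (qproj x) - x \in S.
Proof. by rewrite -qproj_eq qreprK. Qed.

Fact qproj_zmod_morphism : zmod_morphism qproj.
Proof. exact: (raddfB (\pi_(Quotient.quot (zmod_of S)))). Qed.

HB.instance Definition _ := GRing.isZmodMorphism.Build V Q qproj
  qproj_zmod_morphism.

Definition qscale (c : k) (q : Q) : Q := qproj (c *: qrepr q).

Lemma qscaleE c x : qscale c (qproj x) = qproj (c *: x).
Proof.
by apply/eqP; rewrite qproj_eq -scalerBr rpredZ // qproj_repr.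
Qed.

Fact qscaleA a b q : qscale a (qscale b q) = qscale (a * b) q.
Proof. by rewrite -[q]qreprK !qscaleE scalerA. Qed.
Fact qscale1 : left_id 1 qscale.
Proof. by move=> q; rewrite -[q]qreprK qscaleE scale1r. Qed.
Fact qscaleDr : right_distributive qscale +%R.
Proof.
move=> a q r; rewrite -[q]qreprK -[r]qreprK -raddfD !qscaleE -raddfD.
by rewrite scalerDr.
Qed.
Fact qscaleDl q : {morph qscale^~ q : a b / a + b}.
Proof. by move=> a b; rewrite -[q]qreprK !qscaleE -raddfD scalerDl. Qed.

HB.instance Definition _ :=
  GRing.Zmodule_isLmodule.Build k Q qscaleA qscale1 qscaleDr qscaleDl.

Fact qproj_scalable : scalable qproj.
Proof. by move=> c x; rewrite -qscaleE. Qed.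
HB.instance Definition _ := GRing.isScalable.Build k V Q *:%R qproj
  qproj_scalable.

End Quotspace.
Arguments qproj {k V} S x.

Section KernelImage.
Variables (k : fieldType) (V W : lmodType k) (f : {linear V -> W}).

Definition in_ker : {pred V} := [pred x | f x == 0].
Fact in_ker_submod : submod_closed in_ker.
Proof.
split=> [|c x y]; first by rewrite inE raddf0.
by rewrite !inE linearP => /eqP-> /eqP->; rewrite scaler0 addr0.
Qed.
HB.instance Definition _ := GRing.isSubmodClosed.Build k V in_ker in_ker_submod.

Definition in_im : {pred W} := [pred y | `[< exists x, f x = y >]].
Fact in_im_submod : submod_closed in_im.
Proof.
split=> [|c x y]; first by apply/asboolP; exists 0; rewrite raddf0.
move=> /asboolP[x' <-] /asboolP[y' <-]; apply/asboolP.
by exists (c *: x' + y'); rewrite linearP.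
Qed.
HB.instance Definition _ := GRing.isSubmodClosed.Build k W in_im in_im_submod.

Definition Ker : lmodType k := subspace in_ker.
Definition Coker : lmodType k := quotspace in_im.
End KernelImage.

Definition isomorphic (k : fieldType) (V W : lmodType k) : Prop :=
  exists f : {linear V -> W}, bijective f.

Definition short_exact (k : fieldType) (U V W : lmodType k)
    (i : {linear U -> V}) (p : {linear V -> W}) : Prop :=
  [/\ injective i, forall v, p v = 0 <-> exists u, i u = v
    & forall w, exists v, p v = w].

Record cochainComplex (k : fieldType) := CochainComplex {
  cochain :> nat -> lmodType k;
  cobound : forall n, {linear cochain n -> cochain n.+1};
  coboundK : forall n x, cobound n.+1 (cobound n x) = 0 }.

Section Cohomology.
Variables (k : fieldType) (C : cochainComplex k).

Definition cocycles (n : nat) : lmodType k := Ker (cobound C n).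

Definition is_coboundary (n : nat) : C n -> Prop :=
  if n is p.+1 then fun z => exists y, cobound C p y = z else fun z => z = 0.

Definition coboundaries (n : nat) : {pred cocycles n} :=
  [pred z | `[< is_coboundary (val z) >]].
Fact coboundaries_submod n : submod_closed (@coboundaries n).
Proof.
split=> [|c x y]; first by apply/asboolP; case: n => [|n] //=; exists 0; rewrite raddf0.
move=> /asboolP hx /asboolP hy; apply/asboolP; rewrite linearP.
case: n x y hx hy => [|n] x y /=; first by move=> -> ->; rewrite scaler0 addr0.
by move=> [x' <-] [y' <-]; exists (c *: x' + y'); rewrite linearP.
Qed.
HB.instance Definition _ n := GRing.isSubmodClosed.Build k (cocycles n)
  (@coboundaries n) (coboundaries_submod n).

Definition cohomology (n : nat) : lmodType k := quotspace (@coboundaries n).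
End Cohomology.

(* Linearity of both actions over [k] expresses that [k] acts centrally, so
   that an A-B-bimodule is the same as a module over [A] tensor [B^op]. *)
HB.mixin Record isBimodule (k : fieldType) (A B : algType k) M
    of GRing.Lmodule k M := {
  lact : A -> M -> M;
  ract : M -> B -> M;
  lact_linearr : forall a, linear (lact a);
  lact_linearl : forall x, linear (lact^~ x);
  lact1 : forall x, lact 1 x = x;
  lactM : forall a b x, lact (a * b) x = lact a (lact b x);
  ract_linearl : forall b, linear (ract^~ b);
  ract_linearr : forall x, linear (ract x);
  ract1 : forall x, ract x 1 = x;
  ractM : forall x a b, ract x (a * b) = ract (ract x a) b;
  lractA : forall a x b, ract (lact a x) b = lact a (ract x b) }.

#[short(type="bimodType")]
HB.structure Definition Bimodule (k : fieldType) (A B : algType k) :=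
  {M of GRing.Lmodule k M & isBimodule k A B M}.

Section BimoduleTheory.
Variables (k : fieldType) (A B : algType k) (X : bimodType A B).
Implicit Types (x y : X) (a : A) (b : B).
Lemma lactDr a x y : lact a (x + y) = lact a x + lact a y.
Proof. by have := lact_linearr a 1 x y; rewrite !scale1r. Qed.
Lemma lactDl a a' x : lact (a + a') x = lact a x + lact a' x.
Proof. by have := lact_linearl x 1 a a'; rewrite !scale1r. Qed.
Lemma ractDl b x y : ract (x + y) b = ract x b + ract y b.
Proof. by have := ract_linearl b 1 x y; rewrite !scale1r. Qed.
Lemma ractDr b b' x : ract x (b + b') = ract x b + ract x b'.
Proof. by have := ract_linearr x 1 b b'; rewrite !scale1r. Qed.
Lemma lactr0 a : lact a (0 : X) = 0.
Proof. by apply: (addrI (lact a 0)); rewrite -lactDr !addr0. Qed.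
Lemma lact0l x : lact 0 x = 0.
Proof. by apply: (addrI (lact 0 x)); rewrite -lactDl !addr0. Qed.
Lemma ract0l b : ract (0 : X) b = 0.
Proof. by apply: (addrI (ract 0 b)); rewrite -ractDl !addr0. Qed.
Lemma ractr0 x : ract x (0 : B) = 0.
Proof. by apply: (addrI (ract x 0)); rewrite -ractDr !addr0. Qed.
Lemma lactZr a c x : lact a (c *: x) = c *: lact a x.
Proof. by have := lact_linearr a c x 0; rewrite !addr0 lactr0 addr0. Qed.
Lemma lactZl a c x : lact (c *: a) x = c *: lact a x.
Proof. by have := lact_linearl x c a 0; rewrite !addr0 lact0l addr0. Qed.
Lemma ractZl b c x : ract (c *: x) b = c *: ract x b.
Proof. by have := ract_linearl b c x 0; rewrite !addr0 ract0l addr0. Qed.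
Lemma ractZr b c x : ract x (c *: b) = c *: ract x b.
Proof. by have := ract_linearr x c b 0; rewrite !addr0 ractr0 addr0. Qed.
End BimoduleTheory.

Section BimoduleHom.
Variables (k : fieldType) (A B : algType k) (X Y : bimodType A B).

Definition bimod_morphism (f : X -> Y) : Prop :=
  [/\ linear f, forall a x, f (lact a x) = lact a (f x)
    & forall x b, f (ract x b) = ract (f x) b].

Definition in_bihom : {pred X -> Y} := [pred f | `[< bimod_morphism f >]].
Fact in_bihom_submod : submod_closed in_bihom.
Proof.
split=> [|c f g /asboolP[fl fa fb] /asboolP[gl ga gb]]; apply/asboolP.
  by split=> [c x y|a x|x b] /=; rewrite ?scaler0 ?addr0 ?lactr0 ?ract0l.
split=> [d x y|a x|x b]; rewrite !addrfctE !scalrfctE.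
- rewrite fl gl !scalerDr !scalerA (mulrC c) -!addrA; congr (_ + _).
  by rewrite addrCA.
- by rewrite fa ga lactDr lactZr.
- by rewrite fb gb ractDl ractZl.
Qed.
HB.instance Definition _ :=
  GRing.isSubmodClosed.Build k (X -> Y) in_bihom in_bihom_submod.

Definition bihom : Type := subspace in_bihom.
HB.instance Definition _ := GRing.Lmodule.on bihom.
Definition bihom_fun (f : bihom) : X -> Y := subspace_val f.

Lemma bihomP (f : bihom) : bimod_morphism (bihom_fun f).
Proof. exact: (asboolW (subspace_valP f)). Qed.

Definition Bihom (f : X -> Y) (hf : bimod_morphism f) : bihom :=
  @Subspace k (X -> Y) in_bihom f (asboolT hf).

Lemma bihom_inj (f g : bihom) : bihom_fun f =1 bihom_fun g -> f = g.
Proof. by move=> fg; apply: val_inj; apply/funext. Qed.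

Lemma bihom_linE (c : k) (f g : bihom) x :
  bihom_fun (c *: f + g) x = c *: bihom_fun f x + bihom_fun g x.
Proof.
exact: (congr1 (fun h => h x) (linearP (val : subspace in_bihom -> X -> Y) c f g)).
Qed.

Lemma bihom0E x : bihom_fun 0 x = 0.
Proof.
exact: (congr1 (fun h => h x) (raddf0 (val : subspace in_bihom -> X -> Y))).
Qed.

Lemma bihom_at0 (f : bihom) : bihom_fun f 0 = 0.
Proof.
have [fl _ _] := bihomP f; have := fl 1 0 0; rewrite !scale1r addr0 => h.
by apply: (addrI (bihom_fun f 0)); rewrite addr0 -h.
Qed.
End BimoduleHom.
Coercion bihom_fun : bihom >-> Funclass.

Section BihomComp.
Variables (k : fieldType) (A B : algType k) (X' X Y : bimodType A B).

Fact bihom_comp_morphism (f : bihom X Y) (g : bihom X' X) :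
  bimod_morphism (f \o g).
Proof.
have [fl fa fb] := bihomP f; have [gl ga gb] := bihomP g.
by split=> [c x y|a x|x b] /=; rewrite ?gl ?fl ?ga ?fa ?gb ?fb.
Qed.
Definition bihom_comp (g : bihom X' X) (f : bihom X Y) : bihom X' Y :=
  Bihom (bihom_comp_morphism f g).

Fact bihom_comp_linear g : linear (bihom_comp g).
Proof.
move=> c f f'; apply: bihom_inj => x.
rewrite bihom_linE; exact: bihom_linE.
Qed.
HB.instance Definition _ g := GRing.isLinear.Build k (bihom X Y) (bihom X' Y)
  *:%R (bihom_comp g) (bihom_comp_linear g).
End BihomComp.

Definition regular_bimod (k : fieldType) (A : algType k) : Type := A.

Section Regular.
Variables (k : fieldType) (A : algType k).
HB.instance Definition _ := GRing.Lmodule.on (regular_bimod A).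

Fact regular_lr (a : A) : linear (fun x : regular_bimod A => a * (x : A) : regular_bimod A).
Proof. by move=> c x y; rewrite mulrDr scalerAr. Qed.
Fact regular_ll (x : regular_bimod A) :
  linear (fun a : A => a * (x : A) : regular_bimod A).
Proof. by move=> c a b; rewrite mulrDl scalerAl. Qed.
Fact regular_rl (a : A) : linear (fun x : regular_bimod A => (x : A) * a : regular_bimod A).
Proof. by move=> c x y; rewrite mulrDl scalerAl. Qed.
Fact regular_rr (x : regular_bimod A) :
  linear (fun a : A => (x : A) * a : regular_bimod A).
Proof. by move=> c a b; rewrite mulrDr scalerAr. Qed.

HB.instance Definition _ :=
  @isBimodule.Build k A A (regular_bimod A) (fun a x => a * (x : A))
    (fun x a => (x : A) * a) regular_lr regular_ll (@mul1r A)
    (fun a b x => esym (mulrA a b x)) regular_rl regular_rr (@mulr1 A)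
    (@mulrA A) (fun a x b => esym (mulrA a x b)).
End Regular.

Definition projective (k : fieldType) (A B : algType k) (P : bimodType A B) :
    Prop :=
  forall (X Y : bimodType A B) (p : bihom X Y) (f : bihom P Y),
    (forall y, exists x, p x = y) ->
  exists g : bihom P X, forall u, p (g u) = f u.

Record projResolution (k : fieldType) (A B : algType k) (X : bimodType A B) :=
  ProjResolution {
    res :> nat -> bimodType A B;
    res_diff : forall n, bihom (res n.+1) (res n);
    res_aug : bihom (res 0) X;
    res_projective : forall n, projective (res n);
    res_aug_surj : forall x, exists u, res_aug u = x;
    res_exact0 : forall u, res_aug u = 0 <-> exists v, res_diff 0 v = u;
    res_exactS : forall n u,
      res_diff n u = 0 <-> exists v, res_diff n.+1 v = u }.

Section Ext.
Variables (k : fieldType) (A B : algType k) (X Y : bimodType A B).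
Variable P : projResolution X.

Fact Hom_complex_subproof n (f : bihom (P n) Y) :
  bihom_comp (res_diff P n.+1) (bihom_comp (res_diff P n) f) = 0.
Proof.
apply: bihom_inj => u; rewrite bihom0E -[LHS]/(f _).
have -> : res_diff P n (res_diff P n.+1 u) = 0 by apply/res_exactS; exists u.
exact: bihom_at0.
Qed.

Definition Hom_complex : cochainComplex k :=
  CochainComplex (cochain := fun n => bihom (P n) Y : lmodType k)
    (cobound := fun n => bihom_comp (res_diff P n)) Hom_complex_subproof.

(* Ext^n(X, Y) computed from the projective resolution [P] of [X]; up to
   isomorphism it does not depend on [P]. *)
Definition Ext (n : nat) : lmodType k := cohomology Hom_complex n.
End Ext.

(* HH^n(L) = Ext^n(L, L) over L-L-bimodules, computed from the resolution [P]. *)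
Definition HH (k : fieldType) (L : algType k)
    (P : projResolution (regular_bimod L)) (n : nat) : lmodType k :=
  Ext (regular_bimod L) P n.

Definition in_span (k : fieldType) (V : lmodType k) (G : V -> Prop) : {pred V} :=
  [pred v | `[< forall S : submodClosed V, (forall g, G g -> g \in S) -> v \in S >]].

Section Span.
Variables (k : fieldType) (V : lmodType k) (G : V -> Prop).
Fact in_span_submod : submod_closed (in_span G).
Proof.
split=> [|c x y /asboolP hx /asboolP hy]; apply/asboolP => S GS.
  exact: rpred0.
by rewrite rpredD ?rpredZ ?hx ?hy.
Qed.
HB.instance Definition _ :=
  GRing.isSubmodClosed.Build k V (in_span G) in_span_submod.
Lemma mem_span g : G g -> g \in in_span G.
Proof. by move=> Gg; apply/asboolP => S; apply. Qed.
End Span.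

Definition upd (I : eqType) (T : Type) (x : I -> T) (i : I) (u : T) : I -> T :=
  fun j => if j == i then u else x j.

Section Upd.
Variables (I : eqType) (T : Type).
Implicit Types (x : I -> T) (i j : I) (u v : T).
Lemma upd_eq x i u : upd x i u i = u. Proof. by rewrite /upd eqxx. Qed.
Lemma upd_neq x i j u : j != i -> upd x i u j = x j.
Proof. by rewrite /upd => /negPf->. Qed.
Lemma upd_upd x i u v : upd (upd x i u) i v = upd x i v.
Proof. by apply/funext => j; rewrite /upd; case: eqP. Qed.
Lemma updC x i j u v : i != j -> upd (upd x i u) j v = upd (upd x j v) i u.
Proof.
move=> ij; apply/funext => l; rewrite /upd.
by have [->|//] := eqVneq l j; rewrite eq_sym (negPf ij).
Qed.
Lemma upd_id x i : upd x i (x i) = x.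
Proof. by apply/funext => j; rewrite /upd; case: eqP => // ->. Qed.
Lemma upd_comp (J : eqType) (h : J -> I) x (j : J) u :
  injective h -> upd x (h j) u \o h = upd (x \o h) j u.
Proof. by move=> hI; apply/funext => l; rewrite /upd /= (inj_eq hI). Qed.
Lemma upd_comp_out (J : eqType) (h : J -> I) x (i : I) u :
  (forall j : J, h j != i) -> upd x i u \o h = x \o h.
Proof. by move=> hi; apply/funext => l; rewrite /= upd_neq. Qed.
End Upd.

Section FreeLift.
Variables (k : fieldType) (T : choiceType) (V : lmodType k) (g : T -> V).

Fact fglift_linear : linear (fglift g : {freeg T / k} -> V).
Proof.
have gD : {morph (fglift g : {freeg T / k} -> V) : x y / x + y}.
  have gB := lift_is_additive g.
  move=> x y; rewrite -{1}[y]opprK gB -[- y]add0r gB.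
  have -> : fglift g (0 : {freeg T / k}) = 0 by rewrite -(subrr 0) gB subrr.
  by rewrite sub0r opprK.
have gU c a t : fglift g (c *: << a *g t >>) = c *: fglift g << a *g t >>.
  have -> : c *: << a *g t >> = << c * a *g t >> :> {freeg T / k}.
    by apply/eqP/freeg_eqP => z; rewrite coeffZ !coeffU mulrA.
  by rewrite !liftU scalerA.
have g0 : fglift g (0 : {freeg T / k}) = 0.
  by apply: (addrI (fglift g 0)); rewrite -gD !addr0.
move=> c x y; rewrite gD; congr (_ + _).
rewrite -(freeg_sumE x); elim: (dom x) => [|t s IH].
  by rewrite big_nil scaler0 g0 scaler0.
by rewrite big_cons scalerDr !gD gU IH scalerDr.
Qed.
HB.instance Definition _ := GRing.isLinear.Build k {freeg T / k} V *:%R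
  (fglift g) fglift_linear.
End FreeLift.

Section TensorPower.
Variables (k : fieldType) (A : algType k) (X : bimodType A A) (n : nat).
Implicit Types (x : 'I_n.+1 -> X) (a b : A).

Definition formal x : {freeg ('I_n.+1 -> X) / k} := << 1 *g x >>.

Inductive tensor_rel : {freeg ('I_n.+1 -> X) / k} -> Prop :=
| tensor_rel_linear x i (c : k) u v :
    tensor_rel (formal (upd x i (c *: u + v))
                - (c *: formal (upd x i u) + formal (upd x i v)))
| tensor_rel_balanced x (i j : 'I_n.+1) a : j = i.+1 :> nat ->
    tensor_rel (formal (upd x i (ract (x i) a))
                - formal (upd x j (lact a (x j)))).

(* The (n+1)-fold tensor power of [X] over [A]: the factors are indexed by
   ['I_n.+1], so there is always at least one. *)
Definition tpow : Type := quotspace (in_span tensor_rel).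
HB.instance Definition _ := GRing.Lmodule.on tpow.

Definition pure x : tpow := qproj (in_span tensor_rel) (formal x).

Section Lift.
Variables (V : lmodType k) (g : ('I_n.+1 -> X) -> V).

Definition tlift (t : tpow) : V := fglift g (qrepr t).

Definition balanced : Prop :=
  (forall x i (c : k) u v,
     g (upd x i (c *: u + v)) = c *: g (upd x i u) + g (upd x i v)) /\
  (forall x (i j : 'I_n.+1) a, j = i.+1 :> nat ->
     g (upd x i (ract (x i) a)) = g (upd x j (lact a (x j)))).

Hypothesis gb : balanced.

Lemma tlift_proj (v : {freeg ('I_n.+1 -> X) / k}) :
  tlift (qproj (in_span tensor_rel) v) = fglift g v.
Proof.
apply/eqP; rewrite /tlift -subr_eq0 -raddfB /=.
have /asboolP/(_ (in_ker (fglift g) : submodClosed _)) :=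
  qproj_repr (in_span tensor_rel : submodClosed _) v.
apply => _ [x i c u w|x i j a ij]; rewrite !inE raddfB /= /formal !liftU !scale1r.
  by rewrite linearP /= !liftU !scale1r gb.1 subrr.
by rewrite (gb.2 _ _ _ _ ij) subrr.
Qed.

Lemma tlift_pure x : tlift (pure x) = g x.
Proof. by rewrite tlift_proj liftU scale1r. Qed.

Lemma tlift_linear : linear tlift.
Proof.
by move=> c s t; rewrite -[s]qreprK -[t]qreprK -linearP !tlift_proj linearP.
Qed.
End Lift.

Lemma tpow_ind (P : tpow -> Prop) : P 0 ->
  (forall c s t, P s -> P t -> P (c *: s + t)) -> (forall x, P (pure x)) ->
  forall t, P t.
Proof.
move=> P0 PD Pp t; rewrite -[t]qreprK -(freeg_sumE (qrepr t)).
elim: (dom _) => [|x s IH]; first by rewrite big_nil raddf0.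
have E (c : k) : << c *g x >> = c *: formal x.
  by apply/eqP/freeg_eqP => z; rewrite coeffZ !coeffU mul1r.
by rewrite big_cons E linearP; apply: PD IH; apply: Pp.
Qed.

Lemma pure_balanced : balanced pure.
Proof.
split=> [x i c u v|x i j a ij]; apply/eqP.
  by rewrite -linearP /= qproj_eq mem_span //; constructor.
by rewrite qproj_eq mem_span //; constructor.
Qed.

Definition tact_l a : tpow -> tpow :=
  tlift (fun x => pure (upd x ord0 (lact a (x ord0)))).
Definition tact_r (t : tpow) a : tpow :=
  tlift (fun x => pure (upd x ord_max (ract (x ord_max) a))) t.

Fact tact_l_balanced a :
  balanced (fun x => pure (upd x ord0 (lact a (x ord0)))).
Proof.
have [pl pb] := pure_balanced; split=> [x i c u v|x i j b ij].
  have [->|i0] := eqVneq i ord0; first by rewrite !upd_upd !upd_eq lact_linearr pl.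
  by rewrite !(upd_neq _ _ (_ : ord0 != i)) 1?eq_sym // !(updC _ _ _ i0) pl.
have j0 : j != ord0 by rewrite -val_eqE /= ij.
rewrite (upd_neq _ _ (_ : ord0 != j)) 1?eq_sym // (updC _ _ _ j0).
have [i0|i0] := eqVneq i ord0.
  rewrite i0 upd_upd upd_eq -lractA.
  have := pb (upd x ord0 (lact a (x ord0))) i j b ij.
  by rewrite i0 upd_upd upd_eq (upd_neq _ _ j0).
rewrite (upd_neq _ _ (_ : ord0 != i)) 1?eq_sym // (updC _ _ _ i0).
have := pb (upd x ord0 (lact a (x ord0))) i j b ij.
by rewrite (upd_neq _ _ j0) (upd_neq _ _ i0).
Qed.

Fact tact_r_balanced a :
  balanced (fun x => pure (upd x ord_max (ract (x ord_max) a))).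
Proof.
have [pl pb] := pure_balanced; split=> [x i c u v|x i j b ij].
  have [->|i0] := eqVneq i ord_max; first by rewrite !upd_upd !upd_eq ract_linearl pl.
  by rewrite !(upd_neq _ _ (_ : ord_max != i)) 1?eq_sym // !(updC _ _ _ i0) pl.
have i0 : i != ord_max by rewrite -val_eqE /= neq_ltn -ltnS -ij ltn_ord.
rewrite (upd_neq _ _ (_ : ord_max != i)) 1?eq_sym // (updC _ _ _ i0).
have [j0|j0] := eqVneq j ord_max.
  rewrite j0 upd_upd upd_eq lractA.
  have := pb (upd x ord_max (ract (x ord_max) a)) i j b ij.
  by rewrite j0 upd_upd upd_eq (upd_neq _ _ i0).
rewrite (upd_neq _ _ (_ : ord_max != j)) 1?eq_sym // (updC _ _ _ j0).
have := pb (upd x ord_max (ract (x ord_max) a)) i j b ij.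
by rewrite (upd_neq _ _ j0) (upd_neq _ _ i0).
Qed.

Lemma tact_l_pure a x :
  tact_l a (pure x) = pure (upd x ord0 (lact a (x ord0))).
Proof. exact/tlift_pure/tact_l_balanced. Qed.
Lemma tact_r_pure a x :
  tact_r (pure x) a = pure (upd x ord_max (ract (x ord_max) a)).
Proof. exact: (tlift_pure (tact_r_balanced a)). Qed.

Fact tact_l_linearr a : linear (tact_l a).
Proof. exact/tlift_linear/tact_l_balanced. Qed.
Fact tact_r_linearl a : linear (tact_r^~ a).
Proof. exact: (tlift_linear (tact_r_balanced a)). Qed.
HB.instance Definition _ a :=
  GRing.isLinear.Build k tpow tpow *:%R (tact_l a) (tact_l_linearr a).
Let tact_r0 a : tact_r 0 a = 0.
Proof.
have := tact_r_linearl a 1 0 0; rewrite !scale1r addr0 => h.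
by apply: (addrI (tact_r 0 a)); rewrite addr0 -h.
Qed.
Let lcAC (c d : k) (s s' t t' : tpow) :
  c *: (d *: s + t) + (d *: s' + t') = d *: (c *: s + s') + (c *: t + t').
Proof. by rewrite !scalerDr !scalerA (mulrC c) addrACA. Qed.

Fact tact_l_linearl t : linear (tact_l^~ t).
Proof.
move=> c a b; elim/tpow_ind: t => [|d s t hs ht|x].
- by rewrite !raddf0 addr0.
- by rewrite !tact_l_linearr hs ht lcAC.
- by rewrite !tact_l_pure lact_linearl (pure_balanced).1.
Qed.
Fact tact_r_linearr t : linear (tact_r t).
Proof.
move=> c a b; elim/tpow_ind: t => [|d s t hs ht|x].
- by rewrite !tact_r0 scaler0 addr0.
- by rewrite !tact_r_linearl hs ht lcAC.
- by rewrite !tact_r_pure ract_linearr (pure_balanced).1.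
Qed.
Fact tact_l1 t : tact_l 1 t = t.
Proof.
elim/tpow_ind: t => [|d s t hs ht|x]; first by rewrite raddf0.
  by rewrite tact_l_linearr hs ht.
by rewrite tact_l_pure lact1 upd_id.
Qed.
Fact tact_r1 t : tact_r t 1 = t.
Proof.
elim/tpow_ind: t => [|d s t hs ht|x]; first by rewrite tact_r0.
  by rewrite tact_r_linearl hs ht.
by rewrite tact_r_pure ract1 upd_id.
Qed.
Fact tact_lM a b t : tact_l (a * b) t = tact_l a (tact_l b t).
Proof.
elim/tpow_ind: t => [|d s t hs ht|x]; first by rewrite !raddf0.
  by rewrite !tact_l_linearr hs ht.
by rewrite !tact_l_pure lactM upd_upd upd_eq.
Qed.
Fact tact_rM t a b : tact_r t (a * b) = tact_r (tact_r t a) b.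
Proof.
elim/tpow_ind: t => [|d s t hs ht|x]; first by rewrite !tact_r0.
  by rewrite !tact_r_linearl hs ht.
by rewrite !tact_r_pure ractM upd_upd upd_eq.
Qed.
Fact tact_lr a t b : tact_r (tact_l a t) b = tact_l a (tact_r t b).
Proof.
elim/tpow_ind: t => [|d s t hs ht|x]; first by rewrite raddf0 !tact_r0 raddf0.
  by rewrite !(tact_l_linearr, tact_r_linearl) hs ht.
rewrite tact_l_pure !tact_r_pure tact_l_pure; congr pure.
have [n0|n0] := eqVneq (@ord0 n) ord_max.
  by rewrite -n0 !upd_upd !upd_eq lractA.
by rewrite updC // !upd_neq // eq_sym.
Qed.

HB.instance Definition _ := isBimodule.Build k A A tpow tact_l_linearr
  tact_l_linearl tact_l1 tact_lM tact_r_linearl tact_r_linearr tact_r1 tact_rM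
  tact_lr.

Lemma lact_pure a x : lact a (pure x) = pure (upd x ord0 (lact a (x ord0))).
Proof. exact: tact_l_pure. Qed.
Lemma ract_pure a x :
  ract (pure x) a = pure (upd x ord_max (ract (x ord_max) a)).
Proof. exact: tact_r_pure. Qed.
End TensorPower.
Arguments tpow {k A} X n.

Section Nabla.
Variables (k : fieldType) (A : algType k) (X : bimodType A A) (n : nat).
Implicit Types (phi : bihom (tpow X n) (regular_bimod A)) (x : 'I_n.+2 -> X).

(* x_1 phi(x_2 (x) ... (x) x_(n+2)) and phi(x_1 (x) ... (x) x_(n+1)) x_(n+2) *)
Definition one_tensor phi x : X := ract (x ord0) (phi (pure (x \o lift ord0))).
Definition tensor_one phi x : X :=
  lact (phi (pure (x \o lift ord_max))) (x ord_max).

Let lift0_inj : injective (lift (@ord0 n.+1)) := @lift_inj _ _.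
Let liftm_inj : injective (lift (@ord_max n.+1)) := @lift_inj _ _.
Let lift0_neq (j : 'I_n.+1) : lift ord0 j != ord0.
Proof. by rewrite eq_sym neq_lift. Qed.
Let liftm_neq (j : 'I_n.+1) : lift ord_max j != ord_max.
Proof. by rewrite eq_sym neq_lift. Qed.
Let liftm0 : lift (@ord_max n.+1) ord0 = ord0.
Proof. by apply: val_inj; exact: lift_max. Qed.
Let lift0m : lift (@ord0 n.+1) ord_max = ord_max.
Proof. by apply: val_inj; exact: lift0. Qed.
Let upd0m x u : upd x ord0 u \o lift ord_max = upd (x \o lift ord_max) ord0 u.
Proof. by rewrite -(upd_comp x ord0 u liftm_inj) liftm0. Qed.
Let updm0 x u : upd x ord_max u \o lift ord0 = upd (x \o lift ord0) ord_max u.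
Proof. by rewrite -(upd_comp x ord_max u lift0_inj) lift0m. Qed.
Let comp0m x : (x \o lift ord_max) ord0 = x ord0.
Proof. by rewrite /= liftm0. Qed.
Let compm0 x : (x \o lift ord0) ord_max = x ord_max.
Proof. by rewrite /= lift0m. Qed.

Fact one_tensor_balanced phi : balanced (one_tensor phi).
Proof.
have [fl fa _] := bihomP phi; have [pl pb] := pure_balanced X n.
rewrite /one_tensor; split=> [x i c u v|x i j a ij].
  case: (unliftP ord0 i) => [i'|] ->; last first.
    by rewrite !upd_eq !(upd_comp_out _ _ lift0_neq) ract_linearl.
  rewrite !(upd_comp _ _ _ lift0_inj) !(upd_neq _ _ (_ : ord0 != _)) ?neq_lift //.
  by rewrite pl fl ract_linearr.
have [j' jE] : exists j', j = lift ord0 j'.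
  by case: (unliftP ord0 j) => [j'|] E; [exists j' | rewrite E in ij].
subst j; rewrite (upd_comp _ _ _ lift0_inj) (upd_neq _ _ (_ : ord0 != lift _ _)) ?neq_lift //.
case: (unliftP ord0 i) => [i'|] iE; subst i.
  rewrite (upd_comp _ _ _ lift0_inj) (upd_neq _ _ (_ : ord0 != lift _ _)) ?neq_lift //.
  by rewrite -!/((x \o lift ord0) _) (pb _ i' j') //; move: ij; rewrite !lift0; case.
have -> : j' = ord0 by apply: val_inj; move: ij; rewrite lift0; case.
rewrite upd_eq (upd_comp_out _ _ lift0_neq).
by rewrite -!/((x \o lift ord0) _) -lact_pure fa ractM.
Qed.

Fact tensor_one_balanced phi : balanced (tensor_one phi).
Proof.
have [fl _ fb] := bihomP phi; have [pl pb] := pure_balanced X n.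
rewrite /tensor_one; split=> [x i c u v|x i j a ij].
  case: (unliftP ord_max i) => [i'|] ->; last first.
    by rewrite !upd_eq !(upd_comp_out _ _ liftm_neq) lact_linearr.
  rewrite !(upd_comp _ _ _ liftm_inj) !(upd_neq _ _ (_ : ord_max != _)) ?neq_lift //.
  by rewrite pl fl lact_linearl.
have [i' iE] : exists i', i = lift ord_max i'.
  case: (unliftP ord_max i) => [i'|] E; first by exists i'.
  by have := ltn_ord j; rewrite ij E ltnn.
subst i; rewrite (upd_comp _ _ _ liftm_inj) (upd_neq _ _ (_ : ord_max != lift _ _)) ?neq_lift //.
case: (unliftP ord_max j) => [j'|] jE; subst j.
  rewrite (upd_comp _ _ _ liftm_inj) (upd_neq _ _ (_ : ord_max != lift _ _)) ?neq_lift //.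
  by rewrite -!/((x \o lift ord_max) _) (pb _ i' j') //; move: ij; rewrite !lift_max.
have -> : i' = ord_max by apply: val_inj; move: ij; rewrite lift_max /= => -[].
rewrite upd_eq (upd_comp_out _ _ liftm_neq).
by rewrite -!/((x \o lift ord_max) _) -ract_pure fb -lactM.
Qed.

Definition nabla_formula phi x : X := one_tensor phi x - tensor_one phi x.

Fact nabla_balanced phi : balanced (nabla_formula phi).
Proof.
have [l1 b1] := one_tensor_balanced phi; have [l2 b2] := tensor_one_balanced phi.
rewrite /nabla_formula; split=> [x i c u v|x i j a ij].
  by rewrite l1 l2 opprD addrACA scalerBr.
by rewrite (b1 _ i j) // (b2 _ i j).
Qed.

Definition nabla_fun phi : tpow X n.+1 -> X := tlift (nabla_formula phi).

Lemma nabla_fun_pure phi x :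
  nabla_fun phi (pure x) =
    ract (x ord0) (phi (pure (x \o lift ord0)))
    - lact (phi (pure (x \o lift ord_max))) (x ord_max).
Proof. exact/tlift_pure/nabla_balanced. Qed.

Fact nabla_fun_morphism phi : bimod_morphism (nabla_fun phi).
Proof.
have [fl fa fb] := bihomP phi.
have lin : linear (nabla_fun phi) by exact/tlift_linear/nabla_balanced.
have z : nabla_fun phi 0 = 0.
  have := lin 1 0 0; rewrite !scale1r addr0 => h.
  by apply: (addrI (nabla_fun phi 0)); rewrite addr0 -h.
split=> // [a t|t a].
- elim/tpow_ind: t => [|c s t hs ht|x]; first by rewrite lactr0 z lactr0.
    by rewrite lact_linearr !lin hs ht lact_linearr.
  rewrite lact_pure !nabla_fun_pure upd_eq (upd_comp_out _ _ lift0_neq).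
  rewrite (upd_neq _ _ (_ : ord_max != ord0)) // upd0m -comp0m -lact_pure fa.
  by rewrite lactM lractA comp0m -!scaleN1r lactDr lactZr.
- elim/tpow_ind: t => [|c s t hs ht|x]; first by rewrite ract0l z ract0l.
    by rewrite ract_linearl !lin hs ht ract_linearl.
  rewrite ract_pure !nabla_fun_pure upd_eq (upd_comp_out _ _ liftm_neq).
  rewrite (upd_neq _ _ (_ : ord0 != ord_max)) // updm0 -compm0 -ract_pure fb.
  by rewrite ractM compm0 -!scaleN1r ractDl ractZl lractA.
Qed.

(* [nabla phi] sends x_1 (x) ... (x) x_(n+2) to
   x_1 phi(x_2 (x) ... (x) x_(n+2)) - phi(x_1 (x) ... (x) x_(n+1)) x_(n+2). *)
Definition nabla phi : bihom (tpow X n.+1) X := Bihom (nabla_fun_morphism phi).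

Lemma nabla_pure phi x :
  nabla phi (pure x) =
    ract (x ord0) (phi (pure (x \o lift ord0)))
    - lact (phi (pure (x \o lift ord_max))) (x ord_max).
Proof. exact: nabla_fun_pure. Qed.

Fact nabla_linear : linear nabla.
Proof.
move=> c f g; apply: bihom_inj => t; rewrite bihom_linE.
have [l1 _ _] := bihomP (nabla (c *: f + g)).
have [l2 _ _] := bihomP (nabla f); have [l3 _ _] := bihomP (nabla g).
elim/tpow_ind: t => [|d s t hs ht|x].
- by rewrite !bihom_at0 scaler0 addr0.
- by rewrite l1 hs ht l2 l3 !scalerDr !scalerA (mulrC c) addrACA.
- rewrite !nabla_pure !bihom_linE ractDr ractZr lactDl lactZl.
  by rewrite opprD addrACA scalerBr.
Qed.
HB.instance Definition _ := GRing.isLinear.Build k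
  (bihom (tpow X n) (regular_bimod A)) (bihom (tpow X n.+1) X) *:%R nabla
  nabla_linear.
End Nabla.
Arguments nabla {k A} X n phi.

(* The matrix rows are ((a, n), (m, b)). *)
Definition nullsq (k : fieldType) (A B : algType k) (M : bimodType B A)
  (N : bimodType A B) : Type := ((A * N) * (M * B))%type.

Section NullSquare.
Variables (k : fieldType) (A B : algType k).
Variables (M : bimodType B A) (N : bimodType A B).
Local Notation L := (nullsq M N).
HB.instance Definition _ := GRing.Lmodule.on L.

Definition nullsq_one : L := ((1, 0), (0, 1)).
Definition nullsq_mul (x y : L) : L :=
  let: ((a, n), (m, b)) := x in let: ((a', n'), (m', b')) := y in
  ((a * a', lact a n' + ract n b'), (ract m a' + lact b m', b * b')).

Fact nullsq_mulA : associative nullsq_mul.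
Proof.
move=> [[a n] [m b]] [[a' n'] [m' b']] [[a'' n''] [m'' b'']] /=.
rewrite !mulrA !lactDr !ractDl !lactM !ractM !lractA !addrA.
by congr ((_, _), (_, _)).
Qed.
Fact nullsq_mul1l : left_id nullsq_one nullsq_mul.
Proof.
move=> [[a n] [m b]] /=.
by rewrite !mul1r !lact1 !ract0l !(addr0, add0r).
Qed.
Fact nullsq_mul1r : right_id nullsq_one nullsq_mul.
Proof.
move=> [[a n] [m b]] /=.
by rewrite !mulr1 !ract1 !lactr0 !(addr0, add0r).
Qed.
Fact nullsq_mulDl : left_distributive nullsq_mul +%R.
Proof.
move=> [[a n] [m b]] [[a' n'] [m' b']] [[a'' n''] [m'' b'']] /=.
congr ((_, _), (_, _)); rewrite /= ?mulrDl //.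
  by rewrite lactDl ractDl addrACA.
by rewrite lactDl ractDl addrACA.
Qed.
Fact nullsq_mulDr : right_distributive nullsq_mul +%R.
Proof.
move=> [[a n] [m b]] [[a' n'] [m' b']] [[a'' n''] [m'' b'']] /=.
congr ((_, _), (_, _)); rewrite /= ?mulrDr //.
  by rewrite lactDr ractDr addrACA.
by rewrite lactDr ractDr addrACA.
Qed.
Fact nullsq_one_neq0 : nullsq_one != 0.
Proof. by apply/eqP => -[/eqP]; rewrite oner_eq0. Qed.
HB.instance Definition _ := GRing.Zmodule_isNzRing.Build L nullsq_mulA
  nullsq_mul1l nullsq_mul1r nullsq_mulDl nullsq_mulDr nullsq_one_neq0.

Fact nullsq_scaleAl (c : k) (x y : L) : c *: (x * y) = (c *: x) * y.
Proof.
case: x y => [[a n] [m b]] [[a' n'] [m' b']].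
congr ((_, _), (_, _)); rewrite /= ?scalerAl //.
  by rewrite scalerDr lactZl ractZl.
by rewrite scalerDr lactZl ractZl.
Qed.
HB.instance Definition _ := GRing.Lmodule_isLalgebra.Build k L nullsq_scaleAl.
Fact nullsq_scaleAr (c : k) (x y : L) : c *: (x * y) = x * (c *: y).
Proof.
case: x y => [[a n] [m b]] [[a' n'] [m' b']].
congr ((_, _), (_, _)); rewrite /= ?scalerAr //.
  by rewrite scalerDr lactZr ractZr.
by rewrite scalerDr lactZr ractZr.
Qed.
HB.instance Definition _ := GRing.Lalgebra_isAlgebra.Build k L nullsq_scaleAr.
End NullSquare.

Definition prod_alg (k : fieldType) (A B : algType k) : algType k := (A * B)%type.

(* M (+) N as a bimodule over A x B, the actions being extended by zero. *)
Definition offdiag (k : fieldType) (A B : algType k) (M : bimodType B A)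
  (N : bimodType A B) : Type := (M * N)%type.

Section OffDiagonal.
Variables (k : fieldType) (A B : algType k).
Variables (M : bimodType B A) (N : bimodType A B).
Local Notation MN := (offdiag M N).
HB.instance Definition _ := GRing.Lmodule.on MN.

Definition offdiag_lact (ab : prod_alg A B) (x : MN) : MN :=
  (lact ab.2 x.1, lact ab.1 x.2).
Definition offdiag_ract (x : MN) (ab : prod_alg A B) : MN :=
  (ract x.1 ab.1, ract x.2 ab.2).

Fact offdiag_lr a : linear (offdiag_lact a).
Proof. by move=> c [x y] [x' y']; congr (_, _); rewrite /= lact_linearr. Qed.
Fact offdiag_ll x : linear (offdiag_lact^~ x).
Proof. by move=> c [a b] [a' b']; congr (_, _); rewrite /= lact_linearl. Qed.
Fact offdiag_l1 x : offdiag_lact 1 x = x.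
Proof. by case: x => x y; congr (_, _); rewrite /= lact1. Qed.
Fact offdiag_lM a b x :
  offdiag_lact (a * b) x = offdiag_lact a (offdiag_lact b x).
Proof. by congr (_, _); rewrite /= lactM. Qed.
Fact offdiag_rl a : linear (offdiag_ract^~ a).
Proof. by move=> c [x y] [x' y']; congr (_, _); rewrite /= ract_linearl. Qed.
Fact offdiag_rr x : linear (offdiag_ract x).
Proof. by move=> c [a b] [a' b']; congr (_, _); rewrite /= ract_linearr. Qed.
Fact offdiag_r1 x : offdiag_ract x 1 = x.
Proof. by case: x => x y; congr (_, _); rewrite /= ract1. Qed.
Fact offdiag_rM x a b :
  offdiag_ract x (a * b) = offdiag_ract (offdiag_ract x a) b.
Proof. by congr (_, _); rewrite /= ractM. Qed.
Fact offdiag_lrA a x b :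
  offdiag_ract (offdiag_lact a x) b = offdiag_lact a (offdiag_ract x b).
Proof. by congr (_, _); rewrite /= lractA. Qed.

HB.instance Definition _ := @isBimodule.Build k (prod_alg A B) (prod_alg A B) MN
  offdiag_lact offdiag_ract offdiag_lr offdiag_ll offdiag_l1 offdiag_lM
  offdiag_rl offdiag_rr offdiag_r1 offdiag_rM offdiag_lrA.
End OffDiagonal.

(* [nabla] is indexed so that [tpow X n] is the (n+1)-fold power; the map
   here goes from maps on the 2m-fold power to maps on the (2m+1)-fold one. *)
Definition nabla_even (k : fieldType) (A B : algType k) (M : bimodType B A)
    (N : bimodType A B) (m : nat) :
    {linear bihom (tpow (offdiag M N) (2 * m)%N.-1) (regular_bimod (prod_alg A B))
            -> bihom (tpow (offdiag M N) (2 * m)%N.-1.+1) (offdiag M N)} :=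
  nabla (offdiag M N) (2 * m)%N.-1.

(* Main.v *)
(* Write AA = A x B and MM for the off-diagonal bimodule, so that Lambda is the
   trivial extension of AA by MM, and let P be the given resolution of Lambda.
   An AA-bimodule Y is viewed as a Lambda-bimodule on which MM acts by zero.
   The one-sided bar complex Lambda (x) MM^n receives a chain map theta from P,
   so every bimodule map MM^n -> Y gives a cocycle P_n -> Y. Conversely one
   chooses elements u_x of P_n lifting the bar chains 1 (x) x (x) 1 for x a pure
   tensor of elements of MM: coboundaries vanish on them and theta maps u_x to x.
   Every cocycle P_(n+1) -> Y that becomes a coboundary in P / P.MM, which is a
   resolution of AA, is cohomologous to one coming from MM^(n+1): this is proved
   by induction on n, replacing Y by the bimodule of left AA-linear maps from MM
   to Y; projectivity of MM makes the higher cohomology with these coefficients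
   vanish. Thus the cohomology with coefficients in Y is an extension of
   Ext(AA, Y) by Hom(MM^n, Y). The idempotent (1, 0) of AA kills Ext(AA, MM), the
   maps MM^n -> MM for n even and the maps MM^n -> AA for n odd. It remains to
   pass from AA and MM to Lambda: the obstruction to lifting a cocycle with
   values in AA to one with values in Lambda is read off on the u_x, where it is
   zero for inflated cocycles and nabla phi for the cocycle of phi. *)
From HB Require Import structures.
Require Import Defs.
From mathcomp Require Import all_boot all_order all_algebra.
From mathcomp Require Import boolp classical_sets functions.

Set Implicit Arguments.
Unset Strict Implicit.
Unset Printing Implicit Defensive.

Import GRing.Theory.
Local Open Scope ring_scope.

(** * Choice and linear algebra *)

(** The obstacle is that [P] and [Q] are arbitrary resolutions: a cochain on [P n] has no tensor
    arguments whose factors in MM could be counted, so cochains cannot be split by the parity of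
    that number. The central idempotent e = (1, 0) of AA takes over this role. On MM one has e x + x
    e = x, so moving e past a factor exchanges e and 1 - e, and the commutator with e is an
    involution of MM. Projectivity of MM serves twice: to choose primitives of cocycles with values
    in Hom_AA(MM, Y) bilinearly, and to make Lambda projective as a left AA-module, so that P / P.MM
    consists of projectives. Between P and P / P.MM stand the cochains that are left linear over AA
    only and right linear over Lambda. They kill P.MM, hence descend to the resolution of AA, but
    still see MM.P. A cocycle coming from MM^(n+1) is the coboundary of such a cochain: this is why
    it dies in Ext(AA, Y), although over Lambda it is a coboundary only when it comes from the zero
    map. *)

Lemma dependent_choice_nat (F : nat -> Type) (G : forall n, F n -> Prop)
    (R : forall n, F n -> F n.+1 -> Prop) (f0 : F 0%N) :
  G 0%N f0 -> (forall n f, G n f -> exists2 f', G n.+1 f' & R n f f') ->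
  exists f : forall n, F n, f 0%N = f0 /\ forall n, R n (f n) (f n.+1).
Proof.
move=> G0 step.
have stepS n (f : {f : F n | G n f}) :
    {f' : {f' : F n.+1 | G n.+1 f'} | R n (sval f) (sval f')}.
  by case: f => f Gf; have [f' Gf' Rff'] := cid2 (step n f Gf); exists (exist _ f' Gf').
pose g := nat_rect (fun n => {f : F n | G n f}) (exist _ f0 G0)
  (fun n f => sval (stepS n f)).
exists (fun n => sval (g n)); split=> // n.
exact: svalP (stepS n (g n)).
Qed.

Section LinearAlgebra.
Variable k : fieldType.

Lemma linear_at0 (V W : lmodType k) (f : V -> W) : linear f -> f 0 = 0.
Proof. by move=> fl; have := fl (-1) 0 0; rewrite scaler0 addr0 scaleN1r addNr. Qed.

(* A subspace maximal among those meeting the kernel trivially is mapped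
   isomorphically onto the target. *)
Lemma linear_section (V W : lmodType k) (p : {linear V -> W}) :
  (forall w, exists v, p v = w) -> exists s : {linear W -> V}, cancel s p.
Proof.
move=> p_surj.
pose ok (S : set V) := (forall c x y, S x -> S y -> S (c *: x + y)) /\
  (forall x, S x -> p x = 0 -> x = 0).
have [F Fok Ftot|S [[Slin Sker] Smax]] := @Zorn_bigcup V ok.
  split=> [c x y [X FX Xx] [Y FY Yy]|x [X FX Xx]]; last exact: (Fok _ FX).2.
  case: (Ftot _ _ FX FY) => [XY|YX].
    by exists Y => //; apply: (Fok _ FY).1 => //; apply: XY.
  by exists X => //; apply: (Fok _ FX).1 => //; apply: YX.
(* [ok] must hold of the union of the empty chain, so it allows the empty set; maximality against
   the zero subspace excludes it. *)
have S0 : S 0.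
  apply: contrapT => nS0.
  have Se x : ~ S x.
    by move=> Sx; apply: nS0; have := Slin (-1) _ _ Sx Sx; rewrite scaleN1r addNr.
  apply: (Smax (fun x => x = 0)); first by split=> [x /Se//|/(_ 0 erefl)].
  by split=> [c x y -> ->|x -> //] /=; rewrite scaler0 addr0.
have SZ c x : S x -> S (c *: x) by move=> Sx; rewrite -[_ *: _]addr0; apply: Slin.
have SD x y : S x -> S y -> S (x + y).
  by move=> Sx Sy; rewrite -[x]scale1r; apply: Slin.
have onto w : exists2 v, S v & p v = w.
  apply: contrapT => nw; have [v pv] := p_surj w.
  apply: (Smax (fun x => exists c y, S y /\ x = c *: v + y)).
    split=> [x Sx|sub]; first by exists 0, x; rewrite scale0r add0r.
    apply: nw; exists v => //; apply: sub; exists 1, 0.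
    by rewrite scale1r addr0.
  split=> [c _ _ [a [y [Sy ->]]] [b [z [Sz ->]]]|_ [c [y [Sy ->]]]].
    exists (c * a + b), (c *: y + z); split; first exact: Slin.
    by rewrite scalerDl scalerDr scalerA addrACA.
  rewrite linearP pv => cw; have [c0|c0] := eqVneq c 0.
    by move: cw; rewrite c0 !scale0r !add0r; apply: Sker.
  (* Here p y = - c w with c nonzero, so w would already be attained on S. *)
  case: nw; exists (- c^-1 *: y); first exact: SZ.
  apply: (scalerI c0); rewrite linearZ scalerA mulrN mulfV // scaleN1r.
  by apply/esym/eqP; rewrite -addr_eq0 cw.
pose s w := s2val (cid2 (onto w)).
have Ss w : S (s w) by rewrite /s; case: cid2.
have sK : cancel s p by move=> w; rewrite /s; case: cid2.
have s_lin : linear s.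
  move=> c x y; apply/eqP; rewrite -subr_eq0; apply/eqP/Sker.
    by rewrite -scaleN1r; apply: (SD) => //; apply: (SZ); apply: (Slin).
  by rewrite raddfB /= linearP !sK subrr.
pose sL := GRing.isLinear.Build k W V *:%R s s_lin.
by exists (HB.pack_for {linear W -> V} s sL).
Qed.

(** Cohomology maps are described below on representatives that are not chosen linearly; working
    with a relation avoids a linear choice. *)
Lemma linear_of_relation (V W : lmodType k) (r : V -> W -> Prop) :
  (forall v, exists w, r v w) ->
  (forall v w w', r v w -> r v w' -> w = w') ->
  (forall c v w v' w', r v w -> r v' w' -> r (c *: v + v') (c *: w + w')) ->
  exists f : {linear V -> W}, forall v, r v (f v).
Proof.
move=> tot fct rlin; have [f rf] := choice tot.
have f_lin : linear f.
  by move=> c x y; apply: (fct (c *: x + y)) => //; apply: rlin.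
pose fL := GRing.isLinear.Build k V W *:%R f f_lin.
by exists (HB.pack_for {linear V -> W} f fL).
Qed.

Lemma bijective_of_inj_surj (V W : lmodType k) (f : {linear V -> W}) :
  (forall v, f v = 0 -> v = 0) -> (forall w, exists v, f v = w) -> bijective f.
Proof.
move=> f_inj /choice[g fg]; exists g => // v.
by apply/eqP; rewrite -subr_eq0; apply/eqP/f_inj; rewrite raddfB /= fg subrr.
Qed.

Lemma in_span_map (V W : lmodType k) (G : V -> Prop) (S : submodClosed W)
    (f : V -> W) : linear f -> (forall g, G g -> f g \in S) ->
  forall v, v \in in_span G -> f v \in S.
Proof.
move=> fl fG v /asboolP vG.
have f0 := linear_at0 fl.
pose T : {pred V} := [pred v | f v \in S].
have T_closed : submod_closed T.
  split=> [|c x y]; rewrite !inE ?f0 ?rpred0 // => Sx Sy.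
  by rewrite fl rpredD ?rpredZ.
pose TC := GRing.isSubmodClosed.Build k V T T_closed.
pose TS := HB.pack_for (submodClosed V) T TC.
by have := vG TS fG; rewrite inE.
Qed.

Lemma in_span_kill (V W : lmodType k) (G : V -> Prop) (f : V -> W) :
  linear f -> (forall g, G g -> f g = 0) -> forall v, v \in in_span G -> f v = 0.
Proof.
move=> fl fG v vG; pose fL := GRing.isLinear.Build k V W *:%R f fl.
pose fS := HB.pack_for {linear V -> W} f fL.
have vK := in_span_map (S := in_ker fS : submodClosed V) (f := id)
  (fun c x y => erefl) (fun g Gg => introT eqP (fG g Gg)) vG.
by apply/eqP.
Qed.

End LinearAlgebra.

(** * Bimodules *)

Section BihomTheory.
Variables (k : fieldType) (A B : algType k) (X Y : bimodType A B).
Implicit Types f : bihom X Y.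
Lemma bihom_lin f : linear f. Proof. by case: (bihomP f). Qed.
Lemma bihom_lact f a x : f (lact a x) = lact a (f x).
Proof. by case: (bihomP f). Qed.
Lemma bihom_ract f x b : f (ract x b) = ract (f x) b.
Proof. by case: (bihomP f). Qed.
Lemma bihomD f x y : f (x + y) = f x + f y.
Proof. by have := bihom_lin f 1 x y; rewrite !scale1r. Qed.
Lemma bihomZ f c x : f (c *: x) = c *: f x.
Proof. by have := bihom_lin f c x 0; rewrite bihom_at0 !addr0. Qed.
Lemma bihomN f x : f (- x) = - f x.
Proof. by rewrite -!scaleN1r bihomZ. Qed.
Lemma bihomB f x y : f (x - y) = f x - f y.
Proof. by rewrite bihomD bihomN. Qed.

Lemma lactN a x : lact a (- x : X) = - lact a x.
Proof. by rewrite -!scaleN1r lactZr. Qed.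
Lemma ractN b x : ract (- x : X) b = - ract x b.
Proof. by rewrite -!scaleN1r ractZl. Qed.
Lemma lactB a x y : lact a (x - y : X) = lact a x - lact a y.
Proof. by rewrite lactDr lactN. Qed.
Lemma ractB b x y : ract (x - y : X) b = ract x b - ract y b.
Proof. by rewrite ractDl ractN. Qed.

Lemma bihom_fun_sub (f g : bihom X Y) x : bihom_fun (f - g) x = f x - g x.
Proof. by rewrite addrC -scaleN1r bihom_linE scaleN1r addrC. Qed.
Lemma bihom_fun_opp (f : bihom X Y) x : bihom_fun (- f) x = - f x.
Proof. by rewrite -[- f]sub0r bihom_fun_sub bihom0E sub0r. Qed.
End BihomTheory.

Definition bihom_id (k : fieldType) (A B : algType k) (X : bimodType A B) :
  bihom X X.
Proof. by apply: (@Bihom _ _ _ _ _ id); split. Defined.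

Section ImageBimodule.
Variables (k : fieldType) (A B : algType k) (X Y : bimodType A B).
Variable p : bihom X Y.

Definition in_bihom_im : {pred Y} := [pred y | `[< exists x, p x = y >]].
Fact in_bihom_im_submod : submod_closed in_bihom_im.
Proof.
split=> [|c y z]; first by apply/asboolP; exists 0; rewrite bihom_at0.
move=> /asboolP[x <-] /asboolP[x' <-]; apply/asboolP.
by exists (c *: x + x'); rewrite bihom_lin.
Qed.
HB.instance Definition _ :=
  GRing.isSubmodClosed.Build k Y in_bihom_im in_bihom_im_submod.
Definition bihom_im : Type := subspace in_bihom_im.
HB.instance Definition _ := GRing.Lmodule.on bihom_im.
Definition im_val (u : bihom_im) : Y := subspace_val u.
Lemma im_val_lin : linear im_val.
Proof. by move=> c u v; exact: (linearP (val : subspace in_bihom_im -> Y)). Qed.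
Lemma im_val_inj : injective im_val. Proof. exact: val_inj. Qed.
Lemma im_valP u : exists x, p x = im_val u.
Proof. exact: (asboolW (subspace_valP u)). Qed.
Definition im_mk y (py : exists x, p x = y) : bihom_im :=
  @Subspace k Y in_bihom_im y (asboolT py).

Fact im_lact_proof a (u : bihom_im) : exists x, p x = lact a (im_val u).
Proof. by have [x <-] := im_valP u; exists (lact a x); rewrite bihom_lact. Qed.
Fact im_ract_proof a (u : bihom_im) : exists x, p x = ract (im_val u) a.
Proof. by have [x <-] := im_valP u; exists (ract x a); rewrite bihom_ract. Qed.
Definition im_lact a u : bihom_im := im_mk (im_lact_proof a u).
Definition im_ract u a : bihom_im := im_mk (im_ract_proof a u).

Fact im_lact_lr a : linear (im_lact a).
Proof.
by move=> c u v; apply: im_val_inj; rewrite im_val_lin /= -lact_linearr -im_val_lin.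
Qed.
Fact im_lact_ll u : linear (im_lact^~ u).
Proof.
by move=> c a b; apply: im_val_inj; rewrite im_val_lin /= -lact_linearl.
Qed.
Fact im_ract_rl a : linear (im_ract^~ a).
Proof.
by move=> c u v; apply: im_val_inj; rewrite im_val_lin /= -ract_linearl -im_val_lin.
Qed.
Fact im_ract_rr u : linear (im_ract u).
Proof.
by move=> c a b; apply: im_val_inj; rewrite im_val_lin /= -ract_linearr.
Qed.
Fact im_lact1 u : im_lact 1 u = u.
Proof. by apply: im_val_inj; exact: lact1. Qed.
Fact im_lactM a b u : im_lact (a * b) u = im_lact a (im_lact b u).
Proof. by apply: im_val_inj; exact: lactM. Qed.
Fact im_ract1 u : im_ract u 1 = u.
Proof. by apply: im_val_inj; exact: ract1. Qed.
Fact im_ractM u a b : im_ract u (a * b) = im_ract (im_ract u a) b.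
Proof. by apply: im_val_inj; exact: ractM. Qed.
Fact im_lractA a u b : im_ract (im_lact a u) b = im_lact a (im_ract u b).
Proof. by apply: im_val_inj; exact: lractA. Qed.
HB.instance Definition _ := isBimodule.Build k A B bihom_im im_lact_lr im_lact_ll
  im_lact1 im_lactM im_ract_rl im_ract_rr im_ract1 im_ractM im_lractA.
End ImageBimodule.

(** Corestricting [p] to its image makes it onto, so only the values of [f] need preimages. In most
    uses [p] is a differential and the values are cycles. *)
Lemma projective_lift (k : fieldType) (A B : algType k)
    (U X Y : bimodType A B) (p : bihom X Y) (f : U -> Y) :
  projective U -> bimod_morphism f -> (forall u, exists x, p x = f u) ->
  exists g : bihom U X, forall u, p (g u) = f u.
Proof.
move=> U_proj [fl fa fb] f_im.
have q_mor : bimod_morphism (fun x => im_mk (ex_intro (fun x' => p x' = p x) x erefl)).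
  by split=> [c x y|a x|x b]; apply: im_val_inj;
    rewrite ?im_val_lin /= ?bihom_lin ?bihom_lact ?bihom_ract.
have g_mor : bimod_morphism (fun u => im_mk (f_im u)).
  by split=> [c x y|a x|x b]; apply: im_val_inj;
    rewrite ?im_val_lin /= ?fl ?fa ?fb.
have [y|g gE] := U_proj _ _ (Bihom q_mor) (Bihom g_mor).
  by have [x xE] := im_valP y; exists x; apply: im_val_inj.
by exists g => u; have := congr1 (@im_val _ _ _ _ _ _) (gE u).
Qed.

Definition restr (k : fieldType) (A B A' B' : algType k)
  (f : {lrmorphism A' -> A}) (g : {lrmorphism B' -> B}) (X : bimodType A B) :
  Type := X.

Section Restriction.
Variables (k : fieldType) (A B A' B' : algType k).
Variables (f : {lrmorphism A' -> A}) (g : {lrmorphism B' -> B}).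
Variable X : bimodType A B.
Local Notation RX := (restr f g X).
HB.instance Definition _ := GRing.Lmodule.on RX.
Definition restr_lact (a : A') (x : RX) : RX := lact (f a) (x : X).
Definition restr_ract (x : RX) (b : B') : RX := ract (x : X) (g b).
Fact restr_lr a : linear (restr_lact a).
Proof. by move=> c x y; exact: lact_linearr. Qed.
Fact restr_ll x : linear (restr_lact^~ x).
Proof. by move=> c a b; rewrite /restr_lact linearP; exact: lact_linearl. Qed.
Fact restr_l1 x : restr_lact 1 x = x.
Proof. by rewrite /restr_lact rmorph1; exact: lact1. Qed.
Fact restr_lM a b x : restr_lact (a * b) x = restr_lact a (restr_lact b x).
Proof. by rewrite /restr_lact rmorphM; exact: lactM. Qed.
Fact restr_rl a : linear (restr_ract^~ a).
Proof. by move=> c x y; exact: ract_linearl. Qed.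
Fact restr_rr x : linear (restr_ract x).
Proof. by move=> c a b; rewrite /restr_ract linearP; exact: ract_linearr. Qed.
Fact restr_r1 x : restr_ract x 1 = x.
Proof. by rewrite /restr_ract rmorph1; exact: ract1. Qed.
Fact restr_rM x a b : restr_ract x (a * b) = restr_ract (restr_ract x a) b.
Proof. by rewrite /restr_ract rmorphM; exact: ractM. Qed.
Fact restr_lrA a x b :
  restr_ract (restr_lact a x) b = restr_lact a (restr_ract x b).
Proof. exact: lractA. Qed.
HB.instance Definition _ := isBimodule.Build k A' B' RX restr_lr restr_ll
  restr_l1 restr_lM restr_rl restr_rr restr_r1 restr_rM restr_lrA.

Lemma restr_lactE a (x : RX) : lact a x = lact (f a) (x : X) :> X.
Proof. by []. Qed.
Lemma restr_ractE (x : RX) b : ract x b = ract (x : X) (g b) :> X.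
Proof. by []. Qed.
End Restriction.
Arguments restr {k A B A' B'} f g X.

Section LeftHom.
Variables (k : fieldType) (S L R : algType k).
Variables (U : bimodType S L) (X : bimodType S R).

Definition left_linear (f : U -> X) : Prop :=
  linear f /\ forall s u, f (lact s u) = lact s (f u).
Definition in_lhom : {pred U -> X} := [pred f | `[< left_linear f >]].
Fact in_lhom_submod : submod_closed in_lhom.
Proof.
split=> [|c f g /asboolP[fl fa] /asboolP[gl ga]]; apply/asboolP.
  by split=> [c x y|a x] /=; rewrite ?scaler0 ?addr0 ?lactr0.
split=> [d x y|a x]; rewrite !addrfctE !scalrfctE.
- rewrite fl gl !scalerDr !scalerA (mulrC c) -!addrA; congr (_ + _).
  by rewrite addrCA.
- by rewrite fa ga lactDr lactZr.
Qed.
HB.instance Definition _ :=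
  GRing.isSubmodClosed.Build k (U -> X) in_lhom in_lhom_submod.
(** Hom_S(U, X), with L acting through U and R through X: the right adjoint of tensoring with U on
    the left. *)
Definition lhom : Type := subspace in_lhom.
HB.instance Definition _ := GRing.Lmodule.on lhom.
Definition lhom_fun (f : lhom) : U -> X := subspace_val f.
Definition Lhom (f : U -> X) (hf : left_linear f) : lhom :=
  @Subspace k (U -> X) in_lhom f (asboolT hf).
Lemma LhomE f (hf : left_linear f) u : lhom_fun (Lhom hf) u = f u.
Proof. by []. Qed.
Lemma lhomP (f : lhom) : left_linear (lhom_fun f).
Proof. exact: (asboolW (subspace_valP f)). Qed.
Lemma lhom_inj (f g : lhom) : lhom_fun f =1 lhom_fun g -> f = g.
Proof. by move=> fg; apply: val_inj; apply/funext. Qed.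
Lemma lhom_linE (c : k) (f g : lhom) u :
  lhom_fun (c *: f + g) u = c *: lhom_fun f u + lhom_fun g u.
Proof.
exact: (congr1 (fun h => h u) (linearP (val : subspace in_lhom -> U -> X) c f g)).
Qed.

Fact lhom_lact_proof l f : left_linear (fun u => lhom_fun f (ract u l)).
Proof.
by case: (lhomP f) => fl fs; split=> [c x y|s u]; rewrite ?ract_linearl ?lractA ?fl ?fs.
Qed.
Fact lhom_ract_proof f r : left_linear (fun u => ract (lhom_fun f u) r).
Proof.
case: (lhomP f) => fl fs; split=> [c x y|s u]; first by rewrite fl ract_linearl.
by rewrite fs lractA.
Qed.
Definition lhom_lact l f : lhom := Lhom (lhom_lact_proof l f).
Definition lhom_ract f r : lhom := Lhom (lhom_ract_proof f r).
Fact lhom_lact_fun l f u : lhom_fun (lhom_lact l f) u = lhom_fun f (ract u l).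
Proof. by []. Qed.
Fact lhom_ract_fun f r u : lhom_fun (lhom_ract f r) u = ract (lhom_fun f u) r.
Proof. by []. Qed.
Let lhomE := (lhom_linE, lhom_lact_fun, lhom_ract_fun).

Fact lhom_lr a : linear (lhom_lact a).
Proof. by move=> c x y; apply: lhom_inj => u; rewrite !lhomE. Qed.
Fact lhom_ll x : linear (lhom_lact^~ x).
Proof.
move=> c a b; apply: lhom_inj => u; rewrite !lhomE ract_linearr.
by case: (lhomP x) => xl _; rewrite xl.
Qed.
Fact lhom_l1 x : lhom_lact 1 x = x.
Proof. by apply: lhom_inj => u; rewrite !lhomE ract1. Qed.
Fact lhom_lM a b x : lhom_lact (a * b) x = lhom_lact a (lhom_lact b x).
Proof. by apply: lhom_inj => u; rewrite !lhomE ractM. Qed.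
Fact lhom_rl a : linear (lhom_ract^~ a).
Proof.
by move=> c x y; apply: lhom_inj => u; rewrite !lhomE -ract_linearl.
Qed.
Fact lhom_rr x : linear (lhom_ract x).
Proof.
by move=> c a b; apply: lhom_inj => u; rewrite !lhomE ract_linearr.
Qed.
Fact lhom_r1 x : lhom_ract x 1 = x.
Proof. by apply: lhom_inj => u; rewrite !lhomE ract1. Qed.
Fact lhom_rM x a b : lhom_ract x (a * b) = lhom_ract (lhom_ract x a) b.
Proof. by apply: lhom_inj => u; rewrite !lhomE ractM. Qed.
Fact lhom_lrA a x b : lhom_ract (lhom_lact a x) b = lhom_lact a (lhom_ract x b).
Proof. by apply: lhom_inj. Qed.
HB.instance Definition _ := isBimodule.Build k L R lhom lhom_lr lhom_ll
  lhom_l1 lhom_lM lhom_rl lhom_rr lhom_r1 lhom_rM lhom_lrA.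
Lemma lhom_lactE l (f : lhom) u : lhom_fun (lact l f) u = lhom_fun f (ract u l).
Proof. by []. Qed.
Lemma lhom_ractE (f : lhom) r u : lhom_fun (ract f r) u = ract (lhom_fun f u) r.
Proof. by []. Qed.
End LeftHom.
Arguments lhom {k S L R} U X.

Section RightHom.
Variables (k : fieldType) (S L R : algType k).
Variables (U : bimodType R S) (X : bimodType L S).

Definition right_linear (f : U -> X) : Prop :=
  linear f /\ forall u s, f (ract u s) = ract (f u) s.
Definition in_rhom : {pred U -> X} := [pred f | `[< right_linear f >]].
Fact in_rhom_submod : submod_closed in_rhom.
Proof.
split=> [|c f g /asboolP[fl fa] /asboolP[gl ga]]; apply/asboolP.
  by split=> [c x y|a x] /=; rewrite ?scaler0 ?addr0 ?ract0l.
split=> [d x y|a x]; rewrite !addrfctE !scalrfctE.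
- rewrite fl gl !scalerDr !scalerA (mulrC c) -!addrA; congr (_ + _).
  by rewrite addrCA.
- by rewrite fa ga ractDl ractZl.
Qed.
HB.instance Definition _ :=
  GRing.isSubmodClosed.Build k (U -> X) in_rhom in_rhom_submod.
Definition rhom : Type := subspace in_rhom.
HB.instance Definition _ := GRing.Lmodule.on rhom.
Definition rhom_fun (f : rhom) : U -> X := subspace_val f.
Definition Rhom (f : U -> X) (hf : right_linear f) : rhom :=
  @Subspace k (U -> X) in_rhom f (asboolT hf).
Lemma RhomE f (hf : right_linear f) u : rhom_fun (Rhom hf) u = f u.
Proof. by []. Qed.
Lemma rhomP (f : rhom) : right_linear (rhom_fun f).
Proof. exact: (asboolW (subspace_valP f)). Qed.
Lemma rhom_inj (f g : rhom) : rhom_fun f =1 rhom_fun g -> f = g.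
Proof. by move=> fg; apply: val_inj; apply/funext. Qed.
Lemma rhom_linE (c : k) (f g : rhom) u :
  rhom_fun (c *: f + g) u = c *: rhom_fun f u + rhom_fun g u.
Proof.
exact: (congr1 (fun h => h u) (linearP (val : subspace in_rhom -> U -> X) c f g)).
Qed.

Fact rhom_lact_proof l f : right_linear (fun u => lact l (rhom_fun f u)).
Proof.
case: (rhomP f) => fl fs; split=> [c x y|u s]; first by rewrite fl lact_linearr.
by rewrite fs lractA.
Qed.
Fact rhom_ract_proof f r : right_linear (fun u => rhom_fun f (lact r u)).
Proof.
by case: (rhomP f) => fl fs; split=> [c x y|u s]; rewrite ?lact_linearr -?lractA ?fl ?fs.
Qed.
Definition rhom_lact l f : rhom := Rhom (rhom_lact_proof l f).
Definition rhom_ract f r : rhom := Rhom (rhom_ract_proof f r).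
Fact rhom_lact_fun l f u : rhom_fun (rhom_lact l f) u = lact l (rhom_fun f u).
Proof. by []. Qed.
Fact rhom_ract_fun f r u : rhom_fun (rhom_ract f r) u = rhom_fun f (lact r u).
Proof. by []. Qed.
Let rhomE := (rhom_linE, rhom_lact_fun, rhom_ract_fun).

Fact rhom_lr a : linear (rhom_lact a).
Proof.
by move=> c x y; apply: rhom_inj => u; rewrite !rhomE -lact_linearr.
Qed.
Fact rhom_ll x : linear (rhom_lact^~ x).
Proof.
by move=> c a b; apply: rhom_inj => u; rewrite !rhomE lact_linearl.
Qed.
Fact rhom_l1 x : rhom_lact 1 x = x.
Proof. by apply: rhom_inj => u; rewrite !rhomE lact1. Qed.
Fact rhom_lM a b x : rhom_lact (a * b) x = rhom_lact a (rhom_lact b x).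
Proof. by apply: rhom_inj => u; rewrite !rhomE lactM. Qed.
Fact rhom_rl a : linear (rhom_ract^~ a).
Proof. by move=> c x y; apply: rhom_inj => u; rewrite !rhomE. Qed.
Fact rhom_rr x : linear (rhom_ract x).
Proof.
move=> c a b; apply: rhom_inj => u; rewrite !rhomE lact_linearl.
by case: (rhomP x) => xl _; rewrite xl.
Qed.
Fact rhom_r1 x : rhom_ract x 1 = x.
Proof. by apply: rhom_inj => u; rewrite !rhomE lact1. Qed.
Fact rhom_rM x a b : rhom_ract x (a * b) = rhom_ract (rhom_ract x a) b.
Proof. by apply: rhom_inj => u; rewrite !rhomE lactM. Qed.
Fact rhom_lrA a x b : rhom_ract (rhom_lact a x) b = rhom_lact a (rhom_ract x b).
Proof. by apply: rhom_inj. Qed.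
HB.instance Definition _ := isBimodule.Build k L R rhom rhom_lr rhom_ll
  rhom_l1 rhom_lM rhom_rl rhom_rr rhom_r1 rhom_rM rhom_lrA.
Lemma rhom_lactE l (f : rhom) u : rhom_fun (lact l f) u = lact l (rhom_fun f u).
Proof. by []. Qed.
Lemma rhom_ractE (f : rhom) r u : rhom_fun (ract f r) u = rhom_fun f (lact r u).
Proof. by []. Qed.
End RightHom.
Arguments rhom {k S L R} U X.

Section QuotientBimodule.
Variables (k : fieldType) (A B : algType k) (X : bimodType A B).
Variable S : submodClosed X.
Hypothesis SL : forall a x, x \in S -> lact a x \in S.
Hypothesis SR : forall x b, x \in S -> ract x b \in S.

(** The stability proofs are arguments of the type so that the bimodule structure can be inferred
    from the type alone. *)
Definition quotbimod of (forall a x, x \in S -> lact a x \in S)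
  & (forall x b, x \in S -> ract x b \in S) : Type := quotspace S.
Local Notation Q := (quotbimod SL SR).
HB.instance Definition _ := GRing.Lmodule.on Q.
Definition qbproj (x : X) : Q := qproj S x.
Lemma qbproj_lin : linear qbproj.
Proof. by move=> c x y; exact: (linearP (qproj S)). Qed.
Lemma qbproj_eq x y : qbproj x = qbproj y <-> x - y \in S.
Proof. by rewrite -qproj_eq; split => [/eqP|/eqP]. Qed.
Lemma qbproj_surj (q : Q) : exists x, q = qbproj x.
Proof. by exists (qrepr q); rewrite /qbproj qreprK. Qed.
Definition qb_lact a (q : Q) : Q := qbproj (lact a (qrepr q)).
Definition qb_ract (q : Q) b : Q := qbproj (ract (qrepr q) b).
Lemma qb_lactE a x : qb_lact a (qbproj x) = qbproj (lact a x).
Proof. by apply/qbproj_eq; rewrite -lactB SL ?qproj_repr. Qed.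
Lemma qb_ractE x b : qb_ract (qbproj x) b = qbproj (ract x b).
Proof. by apply/qbproj_eq; rewrite -ractB SR ?qproj_repr. Qed.
Fact qb_lr a : linear (qb_lact a).
Proof.
move=> c q r; have [x ->] := qbproj_surj q; have [y ->] := qbproj_surj r.
by rewrite -qbproj_lin !qb_lactE -qbproj_lin lact_linearr.
Qed.
Fact qb_ll q : linear (qb_lact^~ q).
Proof.
move=> c a b; have [x ->] := qbproj_surj q.
by rewrite !qb_lactE -qbproj_lin lact_linearl.
Qed.
Fact qb_l1 q : qb_lact 1 q = q.
Proof. by have [x ->] := qbproj_surj q; rewrite qb_lactE lact1. Qed.
Fact qb_lM a b q : qb_lact (a * b) q = qb_lact a (qb_lact b q).
Proof. by have [x ->] := qbproj_surj q; rewrite !qb_lactE lactM. Qed.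
Fact qb_rl a : linear (qb_ract^~ a).
Proof.
move=> c q r; have [x ->] := qbproj_surj q; have [y ->] := qbproj_surj r.
by rewrite -qbproj_lin !qb_ractE -qbproj_lin ract_linearl.
Qed.
Fact qb_rr q : linear (qb_ract q).
Proof.
move=> c a b; have [x ->] := qbproj_surj q.
by rewrite !qb_ractE -qbproj_lin ract_linearr.
Qed.
Fact qb_r1 q : qb_ract q 1 = q.
Proof. by have [x ->] := qbproj_surj q; rewrite qb_ractE ract1. Qed.
Fact qb_rM q a b : qb_ract q (a * b) = qb_ract (qb_ract q a) b.
Proof. by have [x ->] := qbproj_surj q; rewrite !qb_ractE ractM. Qed.
Fact qb_lrA a q b : qb_ract (qb_lact a q) b = qb_lact a (qb_ract q b).
Proof.
by have [x ->] := qbproj_surj q; rewrite !(qb_lactE, qb_ractE) lractA.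
Qed.
HB.instance Definition _ := isBimodule.Build k A B Q qb_lr qb_ll qb_l1 qb_lM
  qb_rl qb_rr qb_r1 qb_rM qb_lrA.
Lemma qbproj_mor : bimod_morphism qbproj.
Proof.
split=> [|a x|x b]; first exact: qbproj_lin.
  exact: (esym (qb_lactE a x)).
exact: (esym (qb_ractE x b)).
Qed.

Lemma quotbimod_factor (Y : bimodType A B) (f : X -> Y) :
  bimod_morphism f -> (forall x, x \in S -> f x = 0) ->
  exists g : bihom (Q : bimodType A B) Y, forall x, g (qbproj x) = f x.
Proof.
move=> [fl fa fb] fS.
have fE x y : qbproj x = qbproj y -> f x = f y.
  move=> /qbproj_eq/fS; rewrite addrC -scaleN1r fl scaleN1r addrC => /eqP.
  by rewrite subr_eq0 => /eqP.
have gE x : f (qrepr (qbproj x)) = f x by apply: fE; rewrite /qbproj qreprK.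
suff g_mor : bimod_morphism (fun q : Q => f (qrepr q)) by exists (Bihom g_mor).
split=> [c q r|a q|q b].
- have [x ->] := qbproj_surj q; have [y ->] := qbproj_surj r.
  by rewrite -qbproj_lin !gE fl.
- by have [x ->] := qbproj_surj q; case: qbproj_mor => _ <- _; rewrite !gE fa.
- by have [x ->] := qbproj_surj q; case: qbproj_mor => _ _ <-; rewrite !gE fb.
Qed.
End QuotientBimodule.

(** * Comparison of resolutions and one-sided projectivity *)

Section Cycles.
Variables (k : fieldType) (A B : algType k) (X : bimodType A B).
Variable P : projResolution X.

Definition is_cycle (n : nat) : P n -> Prop :=
  if n is m.+1 then fun u => res_diff P m u = 0 else fun u => res_aug P u = 0.

Lemma is_cycleP n (u : P n) : is_cycle u <-> exists v, res_diff P n v = u.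
Proof. by case: n u => [|n] u; [exact: res_exact0 | exact: res_exactS]. Qed.
Lemma is_cycle_diff n v : is_cycle (res_diff P n v).
Proof. by apply/is_cycleP; exists v. Qed.
Lemma res_diffK n v : res_diff P n (res_diff P n.+1 v) = 0.
Proof. exact: (@is_cycle_diff n.+1). Qed.
Lemma res_aug_diff v : res_aug P (res_diff P 0 v) = 0.
Proof. exact: (@is_cycle_diff 0). Qed.
End Cycles.

(** Comparison theorem with a bare exact complex as target: an inflated resolution of [A] stays
    exact over [L] but need not stay projective. *)
Lemma chain_map_lift (k : fieldType) (A B : algType k) (X Y : bimodType A B)
    (P : projResolution X) (Q : nat -> bimodType A B)
    (d : forall n, bihom (Q n.+1) (Q n)) (a : bihom (Q 0%N) Y) (f : bihom X Y) :
  (forall y, exists q, a q = y) ->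
  (forall q, a q = 0 <-> exists q', d 0%N q' = q) ->
  (forall n q, d n q = 0 <-> exists q', d n.+1 q' = q) ->
  exists2 F : forall n, bihom (P n) (Q n),
    forall n p, d n (F n.+1 p) = F n (res_diff P n p)
    & forall p, a (F 0%N p) = f (res_aug P p).
Proof.
move=> a_surj exact0 exactS.
have [F0 F0E] : exists F0 : bihom (P 0%N) (Q 0%N),
    forall p, a (F0 p) = f (res_aug P p).
  apply: (projective_lift (f := fun p => f (res_aug P p)) (@res_projective _ _ _ _ P 0)).
    exact: (bihomP (bihom_comp (res_aug P) f)).
  by move=> p; exact: a_surj.
have [||F [FE0 FE]] := @dependent_choice_nat (fun n => bihom (P n) (Q n))
  (fun n F => forall p, exists q, d n q = F (res_diff P n p))
  (fun n F F' => forall p, d n (F' p) = F (res_diff P n p)) F0.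
- by move=> p; apply/exact0; rewrite F0E res_aug_diff bihom_at0.
- move=> n F Fcyc.
  have [||F' F'E] := projective_lift (U := P n.+1) (p := d n)
    (f := fun p => F (res_diff P n p)) (@res_projective _ _ _ _ P n.+1).
  + exact: (bihomP (bihom_comp (res_diff P n) F)).
  + exact: Fcyc.
  by exists F' => // p; apply/exactS; rewrite F'E res_diffK bihom_at0.
by exists F => [n p|p]; rewrite ?FE // FE0.
Qed.

Section Comparison.
Variables (k : fieldType) (A B : algType k) (X Y : bimodType A B).
Variables (P : projResolution X) (Q : projResolution Y).

Definition is_chain_map (F : forall n, bihom (P n) (Q n)) : Prop :=
  forall n p, res_diff Q n (F n.+1 p) = F n (res_diff P n p).

(** Of the null-homotopy only [h] in degree n is kept: the other term is a boundary, which every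
    cocycle kills. *)
Lemma chain_map_null (F : forall n, bihom (P n) (Q n)) :
  is_chain_map F -> (forall p, res_aug Q (F 0%N p) = 0) ->
  forall n, exists h : bihom (P n) (Q n.+1),
  forall p, exists q, F n.+1 p = res_diff Q n.+1 q + h (res_diff P n p).
Proof.
move=> Fch F0.
have [h0 h0E] : exists h : bihom (P 0%N) (Q 1%N),
    forall p, res_diff Q 0 (h p) = F 0%N p.
  apply: (projective_lift (f := F 0%N) (@res_projective _ _ _ _ P 0)); first exact: bihomP.
  by move=> p; apply/is_cycleP.
have [||h [_ hE]] := @dependent_choice_nat (fun n => bihom (P n) (Q n.+1))
  (fun n h => forall p, is_cycle (F n.+1 p - h (res_diff P n p)))
  (fun n h h' => forall p,
     res_diff Q n.+1 (h' p) = F n.+1 p - h (res_diff P n p)) h0.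
- by move=> p; rewrite /= bihomB Fch h0E subrr.
- move=> n h hcyc.
  have [||h' h'E] := projective_lift (U := P n.+1) (p := res_diff Q n.+1)
    (f := fun p => F n.+1 p - h (res_diff P n p)) (@res_projective _ _ _ _ P n.+1).
  + exact: (bihomP (F n.+1 - bihom_comp (res_diff P n) h)).
  + by move=> p; apply/is_cycleP.
  exists h' => // p; rewrite /= bihomB Fch h'E res_diffK bihom_at0 subr0.
  by rewrite subrr.
by move=> n; exists (h n) => p; exists (h n.+1 p); rewrite hE subrK.
Qed.
End Comparison.

Section ScalarMorphism.
Variables (k : fieldType) (A : algType k).
(** The structure map of [A]. Its source is [k^o] so that right modules become [k^o]-bimodules on
    the left and one-sided projectivity is an instance of [projective]. *)
Definition scalar_alg (c : k^o) : A := (c : k)%:A.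
Fact scalar_alg_zmod : zmod_morphism scalar_alg.
Proof. by move=> c d; rewrite /scalar_alg scalerBl. Qed.
HB.instance Definition _ := GRing.isZmodMorphism.Build k^o A scalar_alg
  scalar_alg_zmod.
Fact scalar_alg_monoid : monoid_morphism scalar_alg.
Proof.
split=> [|c d]; first exact: scale1r.
by rewrite /scalar_alg -scalerAl mul1r scalerA.
Qed.
HB.instance Definition _ := GRing.isMonoidMorphism.Build k^o A scalar_alg
  scalar_alg_monoid.
Fact scalar_alg_scalable : scalable scalar_alg.
Proof. by move=> c d; rewrite /scalar_alg scalerA. Qed.
HB.instance Definition _ := GRing.isScalable.Build k k^o A *:%R scalar_alg
  scalar_alg_scalable.
End ScalarMorphism.
Arguments scalar_alg {k} A c.

Section OneSided.
Variable k : fieldType.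

Lemma bihom_section (A B : algType k) (X Y : bimodType A B) (p : bihom X Y) :
  (forall y, exists x, p x = y) -> exists2 s : Y -> X, linear s & cancel s p.
Proof.
move=> p_surj; pose pL := GRing.isLinear.Build k X Y *:%R p (bihom_lin p).
have [s sK] := @linear_section k X Y
  (HB.pack_for {linear X -> Y} (bihom_fun p) pL) p_surj.
by exists s => //; exact: linearP.
Qed.

Lemma lact_scalar (B : algType k) (X : bimodType k^o B) (c : k^o) (x : X) :
  lact c x = (c : k) *: x.
Proof.
by have := lactZl (1 : k^o) (c : k) x; rewrite lact1 => <-; rewrite [_ *: _]mulr1.
Qed.
Lemma ract_scalar (B : algType k) (X : bimodType B k^o) (c : k^o) (x : X) :
  ract x c = (c : k) *: x.
Proof.
by have := ractZr (1 : k^o) (c : k) x; rewrite ract1 => <-; rewrite [_ *: _]mulr1.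
Qed.

(** Restriction along [f] has the right adjoint Hom_S(A, -). The hypothesis says that this
    coinduction preserves surjections, so restriction preserves projectives. *)
Lemma projective_restr (S A B : algType k) (f : {lrmorphism S -> A})
    (P : bimodType A B) :
  (forall (X Y : bimodType S B) (p : bihom X Y),
     (forall y, exists x, p x = y) ->
   forall g : lhom (restr f (@idfun A) (regular_bimod A)) Y,
     exists g' : lhom (restr f (@idfun A) (regular_bimod A)) X,
     forall a, p (lhom_fun g' a) = lhom_fun g a) ->
  projective P -> projective (restr f (@idfun B) P).
Proof.
set AS := restr f _ _ => lift P_proj X Y p g p_surj.
have G_lin (u : P) : left_linear (fun a : AS => g (lact (a : A) u)).
  split=> [c a b|s a]; first by rewrite lact_linearl bihom_lin.
  rewrite -[lact s a]/(f s * (a : A)) lactM.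
  exact: (bihom_lact g s).
have G_mor : bimod_morphism (fun u : P => Lhom (G_lin u)).
  split=> [c u v|a u|u b]; apply: lhom_inj => x.
  - by rewrite lhom_linE !LhomE lact_linearr bihom_lin.
  - by rewrite lhom_lactE !LhomE -lactM.
  - by rewrite lhom_ractE !LhomE -lractA; exact: (bihom_ract g).
have p_lin (h : lhom AS X) : left_linear (fun a => p (lhom_fun h a)).
  case: (lhomP h) => hl hs.
  by split=> [c a b|s a]; rewrite ?hl ?hs ?bihom_lin ?bihom_lact.
have p_mor : bimod_morphism (fun h : lhom AS X => Lhom (p_lin h)).
  split=> [c u v|a u|u b]; apply: lhom_inj => x.
  - by rewrite lhom_linE !LhomE lhom_linE bihom_lin.
  - by rewrite lhom_lactE !LhomE ?lhom_lactE.
  - by rewrite lhom_ractE !LhomE ?lhom_ractE bihom_ract.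
have [h|G' G'E] := P_proj _ _ (Bihom p_mor) (Bihom G_mor).
  by have [h' h'E] := lift X Y p p_surj h; exists h'; apply: lhom_inj => a; exact: h'E.
have g_mor : bimod_morphism
    (fun u : restr f (@idfun B) P => lhom_fun (G' (u : P)) (1 : A)).
  split=> [c u v|s u|u b].
  - by rewrite -lhom_linE -bihom_lin.
  - rewrite restr_lactE bihom_lact lhom_lactE.
    case: (lhomP (G' u)) => _ <-; congr (lhom_fun _ _).
    exact: (etrans (mul1r (f s)) (esym (mulr1 (f s)))).
  - by rewrite restr_ractE bihom_ract.
exists (Bihom g_mor) => u /=.
by have := congr1 (fun h : lhom AS Y => lhom_fun h (1 : A)) (G'E u) => /= ->; rewrite lact1.
Qed.

(** Over a field Hom_k(A, -) preserves surjections, by composing with a linear section. *)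
Lemma projective_right (A B : algType k) (P : bimodType A B) :
  projective P -> projective (restr (scalar_alg A) (@idfun B) P).
Proof.
apply: projective_restr => X Y p /bihom_section[s sl sK] g.
case: (lhomP g) => gl _.
suff h_lin : left_linear (fun a => s (lhom_fun g a)).
  by exists (Lhom h_lin) => a /=.
have hl : linear (fun a => s (lhom_fun g a)) by move=> c a b; rewrite gl sl.
split=> // c a; have := hl c a 0; rewrite !lact_scalar.
by rewrite (linear_at0 hl) !addr0.
Qed.

(** Forgetting the right action of [A'] has the right adjoint Hom_k(A', -), here [rhom U (R Z)],
    which preserves surjections because [k] is a field. The lift is asked to be linear on the left
    only. *)
Lemma projective_left (A A' B : algType k) (P : bimodType A A') :
  projective P -> forall (X Y : bimodType A B) (p : bihom X Y),
  (forall y, exists x, p x = y) -> forall g : lhom P Y,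
  exists g' : lhom P X, forall u, p (lhom_fun g' u) = lhom_fun g u.
Proof.
move=> P_proj X Y p /bihom_section[s sl sK] g.
pose U : bimodType A' k^o := restr (@idfun A') (scalar_alg A') (regular_bimod A').
pose R (Z : bimodType A B) : bimodType A k^o := restr (@idfun A) (scalar_alg B) Z.
have right_lin (Z : bimodType A B) (h : U -> R Z) : linear h -> right_linear h.
  move=> hl; split=> // a c; rewrite !ract_scalar; have := hl c a 0.
  by rewrite (linear_at0 hl) !addr0.
case: (lhomP g) => gl ga.
have G_lin u : linear (fun a : U => lhom_fun g (ract u (a : A')) : R Y).
  by move=> c a b; rewrite ract_linearr; exact: gl.
have G_mor : bimod_morphism (fun u : P => Rhom (right_lin _ _ (G_lin u))).
  split=> [c u v|a u|u b]; apply: rhom_inj => x.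
  - by rewrite rhom_linE !RhomE ract_linearl; exact: gl.
  - by rewrite rhom_lactE !RhomE lractA; exact: ga.
  - by rewrite rhom_ractE !RhomE -ractM.
have p_lin (h : rhom U (R X)) : linear (fun a => p (rhom_fun h a) : R Y).
  by case: (rhomP h) => hl _ c a b; rewrite hl; exact: (bihom_lin p).
have p_mor : bimod_morphism
    (fun h : rhom U (R X) => Rhom (right_lin _ _ (p_lin h)) : rhom U (R Y)).
  split=> [c u v|a u|u b]; apply: rhom_inj => x.
  - by rewrite rhom_linE !RhomE rhom_linE; exact: (bihom_lin p).
  - by rewrite rhom_lactE !RhomE ?rhom_lactE; exact: (bihom_lact p).
  - by rewrite rhom_ractE !RhomE ?rhom_ractE.
have [h|G' G'E] := P_proj _ _ (Bihom p_mor) (Bihom G_mor).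
  case: (rhomP h) => hl _.
  have h'_lin : linear (fun a => s (rhom_fun h a) : R X).
    by move=> c a b; rewrite hl; exact: sl.
  exists (Rhom (right_lin _ _ h'_lin)); apply: rhom_inj => a /=.
  exact: sK.
have g_lin : left_linear (fun u => rhom_fun (G' u) (1 : A') : X).
  split=> [c u v|a u]; first by rewrite bihom_lin rhom_linE.
  by rewrite bihom_lact rhom_lactE.
exists (Lhom g_lin) => u /=.
by have := congr1 (fun h : rhom U (R Y) => rhom_fun h (1 : A')) (G'E u) => /= ->; rewrite ract1.
Qed.
End OneSided.

(* The augmented resolution is contractible as a complex of right modules. *)
Lemma right_contraction (k : fieldType) (L : algType k)
    (P : projResolution (regular_bimod L)) n :
  exists s : P n -> P n.+1,
  [/\ linear s, forall u l, s (ract u l) = ract (s u) l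
    & forall u, is_cycle u -> res_diff P n (s u) = u].
Proof.
have restr_bihom (X Y : bimodType L L) (f : bihom X Y) :
    bimod_morphism (f : restr (scalar_alg L) (@idfun L) X -> restr (scalar_alg L) (@idfun L) Y).
  by case: (bihomP f) => fl fa fb; split=> // a x; exact: fa.
(* A right linear retraction [t] of [P m] onto its cycles lifts through the differential, as [P m]
   is projective on the right, and the lift contracts. In degree 0, t = 1 - u0 aug with aug u0 = 1;
   afterwards t = 1 - s d. *)
have step m (t : P m -> P m) : linear t ->
    (forall u l, t (ract u l) = ract (t u) l) ->
    (forall u, is_cycle u -> t u = u) -> (forall u, is_cycle (t u)) ->
  exists s : P m -> P m.+1, [/\ linear s, forall u l, s (ract u l) = ract (s u) l
    & forall u, is_cycle u -> res_diff P m (s u) = u].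
  move=> tl tr tK tcyc.
  have t_mor : bimod_morphism
      (t : restr (scalar_alg L) (@idfun L) (P m) -> restr (scalar_alg L) (@idfun L) (P m)).
    split=> [|c u|u l]; [exact: tl| |exact: tr].
    rewrite !lact_scalar; have := tl c u 0.
    by rewrite (linear_at0 tl) !addr0.
  have [|s sE] := projective_lift (p := Bihom (restr_bihom _ _ (res_diff P m)))
    (projective_right (@res_projective _ _ _ _ P m)) t_mor.
    by move=> u; apply/is_cycleP.
  exists s; split=> [|u l|u uc]; [exact: (bihom_lin s)|exact: (bihom_ract s)|].
  by rewrite -[RHS]tK //; exact: sE.
elim: n => [|n [s [sl sr sK]]].
  have [u0 u0E] := res_aug_surj P (1 : L).
  apply: (step 0%N (fun u => u - ract u0 (res_aug P u : L))).
  - move=> c u v; rewrite bihom_lin ract_linearr opprD addrACA.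
    by rewrite scalerBr.
  - by move=> u l; rewrite bihom_ract ractM -ractB.
  - by move=> u /= ->; rewrite ractr0 subr0.
  - move=> u /=; rewrite bihomB bihom_ract u0E.
    by rewrite -[ract _ _]/(1 * (res_aug P u : L)) mul1r subrr.
apply: (step n.+1 (fun u => u - s (res_diff P n u))).
- by move=> c u v; rewrite bihom_lin sl opprD addrACA scalerBr.
- by move=> u l; rewrite bihom_ract sr -ractB.
- by move=> u /= ->; rewrite (linear_at0 sl) subr0.
- by move=> u /=; rewrite bihomB sK ?subrr //; exact: is_cycle_diff.
Qed.

(** * Tensor powers *)

Section TensorCons.
Variables (k : fieldType) (A : algType k) (X : bimodType A A).

Definition fcons n (m : X) (x : 'I_n -> X) : 'I_n.+1 -> X :=
  fun i => oapp x m (unlift ord0 i).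

Lemma fcons0 n m (x : 'I_n -> X) : fcons m x ord0 = m.
Proof. by rewrite /fcons unlift_none. Qed.
Lemma fconsS n m (x : 'I_n -> X) i : fcons m x (lift ord0 i) = x i.
Proof. by rewrite /fcons liftK. Qed.
Lemma fcons_eta n (x : 'I_n.+1 -> X) : fcons (x ord0) (x \o lift ord0) = x.
Proof.
by apply/funext => i; case: (unliftP ord0 i) => [j|] ->; rewrite ?fconsS ?fcons0.
Qed.
Lemma fcons_upd n m (x : 'I_n -> X) i u :
  fcons m (upd x i u) = upd (fcons m x) (lift ord0 i) u.
Proof.
apply/funext => j; case: (unliftP ord0 j) => [j'|] ->; rewrite ?fconsS ?fcons0.
  by rewrite /upd (inj_eq lift_inj) fconsS.
by rewrite upd_neq ?fcons0 // neq_lift.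
Qed.
Lemma fcons_upd0 n m (x : 'I_n -> X) u : upd (fcons m x) ord0 u = fcons u x.
Proof.
apply/funext => j; case: (unliftP ord0 j) => [j'|] ->; rewrite ?fconsS ?fcons0.
  by rewrite upd_neq ?fconsS // eq_sym neq_lift.
by rewrite upd_eq.
Qed.

Lemma pure_fcons_balanced n m :
  balanced (fun x : 'I_n.+1 -> X => pure (fcons m x)).
Proof.
have [pl pb] := pure_balanced X n.+1.
split=> [x i c u v|x i j a ij]; first by rewrite !fcons_upd pl.
rewrite !fcons_upd -(fconsS m x i) -(fconsS m x j).
by rewrite (pb _ (lift ord0 i) (lift ord0 j)) // !lift0 ij.
Qed.

Definition tcons_pos n (m : X) : tpow X n -> tpow X n.+1 :=
  tlift (fun x => pure (fcons m x)).
Lemma tcons_pos_pure n m (x : 'I_n.+1 -> X) :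
  tcons_pos m (pure x) = pure (fcons m x).
Proof. exact: (tlift_pure (pure_fcons_balanced n m)). Qed.
Lemma tcons_pos_linr n m : linear (@tcons_pos n m).
Proof. exact: (tlift_linear (pure_fcons_balanced n m)). Qed.

Lemma tpow_ext n (V : lmodType k) (f g : tpow X n -> V) :
  linear f -> linear g -> (forall x, f (pure x) = g (pure x)) -> f =1 g.
Proof.
move=> fl gl fg; elim/tpow_ind => [|c s t fs ft|//]; first by rewrite !linear_at0.
by rewrite fl gl fs ft.
Qed.

(** Balance at the first joint is the third hypothesis; at each later joint it is inherited from
    [pure] in the tail. *)
Lemma pairing_balanced n (V : lmodType k) (b : X -> tpow X n -> V) :
  (forall t, linear (b^~ t)) -> (forall m, linear (b m)) ->
  (forall m a t, b (ract m a) t = b m (lact a t)) ->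
  balanced (fun x : 'I_n.+2 -> X => b (x ord0) (pure (x \o lift ord0))).
Proof.
move=> bl br bb; have [pl pb] := pure_balanced X n.
have lI : injective (lift (@ord0 n.+1)) by exact: lift_inj.
have l0 (j : 'I_n.+1) : lift ord0 j != ord0 by rewrite eq_sym neq_lift.
split=> [x i c u v|x i j a ij].
  case: (unliftP ord0 i) => [i'|] ->; last by rewrite !upd_eq !(upd_comp_out _ _ l0) bl.
  by rewrite !(upd_comp _ _ _ lI) !(upd_neq _ _ (_ : ord0 != _)) ?neq_lift // pl br.
have [j' jE] : exists j', j = lift ord0 j'.
  by case: (unliftP ord0 j) => [j'|] E; [exists j' | rewrite E in ij].
subst j; rewrite (upd_comp _ _ _ lI) (upd_neq _ _ (_ : ord0 != lift _ _)) ?neq_lift //.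
case: (unliftP ord0 i) => [i'|] iE; subst i.
  rewrite (upd_comp _ _ _ lI) (upd_neq _ _ (_ : ord0 != lift _ _)) ?neq_lift //.
  by rewrite -!/((x \o lift ord0) _) (pb _ i' j') //; move: ij; rewrite !lift0; case.
have -> : j' = ord0 by apply: val_inj; move: ij; rewrite lift0; case.
rewrite upd_eq (upd_comp_out _ _ l0) bb.
by rewrite -!/((x \o lift ord0) _) -lact_pure.
Qed.

(* The n-fold tensor power; beware that [tpow X m] has m + 1 factors. *)
Definition tens n : bimodType A A :=
  if n is m.+1 then tpow X m else regular_bimod A.

Definition tens_pure n : ('I_n -> X) -> tens n :=
  if n is m.+1 then fun x => pure x else fun => (1 : A).

(** The product X (x) X^n -> X^(n+1); for n = 0 it is the identification of X (x) A with X. *)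
Definition tcons n (m : X) : tens n -> tens n.+1 :=
  if n is p.+1 then @tcons_pos p m else fun a => pure (fun _ : 'I_1 => ract m a).

Lemma const_upd (m m' : X) (i : 'I_1) : (fun _ => m) = upd (fun _ => m') i m.
Proof. by apply/funext => j; rewrite !ord1 upd_eq. Qed.

Lemma pure1_lin : linear (fun m : X => pure (fun _ : 'I_1 => m)).
Proof.
have [pl _] := pure_balanced X 0; move=> c u v.
by rewrite (const_upd (_ + v) 0 ord0) (const_upd u 0 ord0) (const_upd v 0 ord0) pl.
Qed.

Lemma tcons_linr n m : linear (@tcons n m).
Proof.
case: n => [|n] c s t; last exact: tcons_pos_linr.
by rewrite /= ract_linearr pure1_lin.
Qed.

Lemma tcons_linl n t : linear ((@tcons n)^~ t).
Proof.
case: n t => [|n] t c m m' /=; first by rewrite ract_linearl pure1_lin.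
have [pl _] := pure_balanced X n.+1.
move: t; apply: tpow_ext => [|d s t|x]; first exact: tcons_pos_linr.
  rewrite !(tcons_pos_linr _ d s t) !scalerDr !scalerA (mulrC c).
  by rewrite addrACA.
rewrite !tcons_pos_pure -(fcons_upd0 0 x (_ + _)) pl.
by rewrite !fcons_upd0.
Qed.

Lemma linear_sub (V W : lmodType k) (f : V -> W) v w :
  linear f -> f (v - w) = f v - f w.
Proof. by move=> fl; rewrite addrC -scaleN1r fl scaleN1r addrC. Qed.
Lemma tconsBl n m m' t : @tcons n (m - m') t = tcons m t - tcons m' t.
Proof. exact: (linear_sub m m' (tcons_linl t)). Qed.
Lemma tconsBr n m t t' : @tcons n m (t - t') = tcons m t - tcons m t'.
Proof. exact: (linear_sub t t' (tcons_linr m)). Qed.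

Lemma tcons_lact n a m t : lact a (@tcons n m t) = tcons (lact a m) t.
Proof.
case: n t => [|n] t /=.
  by rewrite lact_pure -const_upd lractA.
move: t; apply: tpow_ext => [c s t|c s t|x].
- by rewrite tcons_pos_linr lact_linearr.
- by rewrite tcons_pos_linr.
- by rewrite !tcons_pos_pure lact_pure fcons0 fcons_upd0.
Qed.

Lemma tcons_ract n a m t : ract (@tcons n m t) a = tcons m (ract t a).
Proof.
case: n t => [|n] t /=.
  by rewrite ract_pure -const_upd -ractM.
move: t; apply: tpow_ext => [c s t|c s t|x].
- by rewrite tcons_pos_linr ract_linearl.
- by rewrite ract_linearl tcons_pos_linr.
have l0m : lift (@ord0 n.+1) ord_max = ord_max by apply: val_inj; exact: lift0.
by rewrite ract_pure !tcons_pos_pure ract_pure fcons_upd l0m -l0m fconsS.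
Qed.

Lemma tcons_balanced n a m t : @tcons n (ract m a) t = tcons m (lact a t).
Proof.
case: n t => [|n] t /=; first by rewrite -ractM.
have [_ pb] := pure_balanced X n.+1.
move: t; apply: tpow_ext => [c s t|c s t|x].
- by rewrite tcons_pos_linr.
- by rewrite lact_linearr tcons_pos_linr.
rewrite lact_pure !tcons_pos_pure fcons_upd.
rewrite -(fcons_upd0 m) -(fconsS m x) -(pb _ ord0) ?fcons0 //.
Qed.

Lemma tcons_pure n (x : 'I_n.+1 -> X) :
  tcons (x ord0) (tens_pure (x \o lift ord0)) = tens_pure x.
Proof.
case: n x => [|n] x /=; last by rewrite tcons_pos_pure fcons_eta.
by rewrite ract1; congr pure; apply/funext => i; rewrite (ord1 i).
Qed.

Lemma tens_ext n (V : lmodType k) (f g : tens n.+1 -> V) :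
  linear f -> linear g -> (forall x, f (tens_pure x) = g (tens_pure x)) -> f =1 g.
Proof. exact: tpow_ext. Qed.

(** Adjunction between X (x) - and [lhom X]: it reassembles a map on X^(n+1) after its first factor
    has been moved into the coefficients. *)
Lemma tens_uncurry n (Y : bimodType A A) (f : bihom (tens n) (lhom X Y)) :
  exists g : bihom (tens n.+1) Y, forall m t, g (tcons m t) = lhom_fun (f t) m.
Proof.
pose b m t := lhom_fun (f t) m.
have bl t : linear (b^~ t) by case: (lhomP (f t)).
have br m : linear (b m) by move=> c s t; rewrite /b bihom_lin lhom_linE.
have bb m a t : b (ract m a) t = b m (lact a t) by rewrite /b bihom_lact.
have ba m a t : b (lact a m) t = lact a (b m t) by case: (lhomP (f t)) => _; exact.
have bra m t a : b m (ract t a) = ract (b m t) a by rewrite /b bihom_ract.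
suff [g [gl gE]] : exists g : tens n.+1 -> Y,
    linear g /\ forall m t, g (tcons m t) = b m t.
  have g_mor : bimod_morphism g.
    split=> // [a t|t a]; move: t.
      apply: tens_ext => [c s t|c s t|x]; first by rewrite lact_linearr gl.
        by rewrite gl lact_linearr.
      by rewrite -tcons_pure tcons_lact !gE ba.
    apply: tens_ext => [c s t|c s t|x]; first by rewrite ract_linearl gl.
      by rewrite gl ract_linearl.
    by rewrite -tcons_pure tcons_ract !gE bra.
  by exists (Bihom g_mor).
case: n f @b bl br bb {ba bra} => [|n] f b bl br bb.
  have h_bal : balanced (fun x : 'I_1 -> X => b (x ord0) 1).
    split=> [x i c u v|x i j a]; first by rewrite !ord1 !upd_eq bl.
    by rewrite !ord1.
  exists (tlift (fun x => b (x ord0) 1)); split; first exact: tlift_linear.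
  move=> m a; rewrite (tlift_pure h_bal) bb; congr b; exact: mulr1.
have h_bal := pairing_balanced bl br bb.
have hl := tlift_linear h_bal.
exists (tlift (fun x => b (x ord0) (pure (x \o lift ord0)))); split=> // m.
apply: tpow_ext => [c s t||x]; [by rewrite (@tcons_linr n.+1 m c s t) hl|exact: br|].
rewrite /= tcons_pos_pure (tlift_pure h_bal) fcons0; congr (b m (pure _)).
by apply/funext => i /=; rewrite fconsS.
Qed.
End TensorCons.

(** * Trivial extensions *)

(** Isolates what the cohomological argument uses of the null-square algebra; matrices come back
    only when the record is instantiated. *)
Record trivialExtension (k : fieldType) (A L : algType k) (X : bimodType A A) :=
  TrivialExtension {
    te_in : {lrmorphism A -> L};
    te_pr : {lrmorphism L -> A};
    te_j : X -> L;
    te_r : L -> X;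
    te_prK : cancel te_in te_pr;
    te_j_lin : linear te_j;
    te_r_lin : linear te_r;
    te_jK : cancel te_j te_r;
    te_pr_j : forall x, te_pr (te_j x) = 0;
    te_decomp : forall l, l = te_in (te_pr l) + te_j (te_r l);
    te_j_lact : forall a x, te_j (lact a x) = te_in a * te_j x;
    te_j_ract : forall x a, te_j (ract x a) = te_j x * te_in a;
    te_jj : forall x y, te_j x * te_j y = 0 }.

Section TrivialExtensionTheory.
Variables (k : fieldType) (A L : algType k) (X : bimodType A A).
Variable E : trivialExtension L X.
Local Notation io := (te_in E).
Local Notation pr := (te_pr E).
Local Notation j := (te_j E).
Local Notation r := (te_r E).

Lemma te_j0 : j 0 = 0. Proof. exact: linear_at0 (te_j_lin E). Qed.
Lemma te_r0 : r 0 = 0. Proof. exact: linear_at0 (te_r_lin E). Qed.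
Lemma te_jD x y : j (x + y) = j x + j y.
Proof. by have := te_j_lin E 1 x y; rewrite !scale1r. Qed.
Lemma te_j_inj : injective j. Proof. exact: can_inj (te_jK E). Qed.
Lemma te_r_io a : r (io a) = 0.
Proof.
apply: te_j_inj; apply: (addrI (io a)); rewrite te_j0 addr0.
by have := te_decomp E (io a); rewrite te_prK.
Qed.
(** [te_r] is a derivation over [te_pr]; its two terms become the two terms of nabla. *)
Lemma te_rM l l' : r (l * l') = lact (pr l) (r l') + ract (r l) (pr l').
Proof.
apply: te_j_inj; rewrite te_jD te_j_lact te_j_ract.
apply: (addrI (io (pr (l * l')))); rewrite -te_decomp rmorphM rmorphM /=.
rewrite {1}(te_decomp E l) {1}(te_decomp E l') mulrDl !mulrDr te_jj addr0.
by rewrite addrA.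
Qed.
Lemma te_r1 : r 1 = 0.
Proof. by rewrite -(rmorph1 io) te_r_io. Qed.
Lemma te_pr_in a : pr (io a) = a. Proof. exact: te_prK. Qed.
Lemma te_rj x : r (j x) = x. Proof. exact: te_jK. Qed.

Definition inflate (Y : bimodType A A) : bimodType L L := restr pr pr Y.
Definition inflate_right (Y : bimodType A A) : bimodType A L := restr idfun pr Y.
(** A map from [half U] to an [inflate_right] kills U.X but may be nonzero on X.U. *)
Definition half (U : bimodType L L) : bimodType A L := restr io idfun U.

Lemma inflate_lact (U : bimodType L L) (Y : bimodType A A)
  (f : bihom U (inflate Y)) l u : (f (lact l u) : Y) = lact (pr l) (f u : Y).
Proof. exact: (bihom_lact f). Qed.
Lemma inflate_ract (U : bimodType L L) (Y : bimodType A A)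
  (f : bihom U (inflate Y)) l u : (f (ract u l) : Y) = ract (f u : Y) (pr l).
Proof. exact: (bihom_ract f). Qed.
Lemma inflate_killl (U : bimodType L L) (Y : bimodType A A)
  (f : bihom U (inflate Y)) x u : f (lact (j x) u) = 0.
Proof. by rewrite inflate_lact te_pr_j lact0l. Qed.
Lemma inflate_killr (U : bimodType L L) (Y : bimodType A A)
  (f : bihom U (inflate Y)) x u : f (ract u (j x)) = 0.
Proof. by rewrite inflate_ract te_pr_j ractr0. Qed.
Lemma half_lact (U : bimodType L L) (Y : bimodType A A)
  (f : bihom (half U) (inflate_right Y)) a u :
  (f (lact (io a) (u : U)) : Y) = lact a (f u : Y).
Proof. exact: (bihom_lact f). Qed.
Lemma half_ract (U : bimodType L L) (Y : bimodType A A)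
  (f : bihom (half U) (inflate_right Y)) l u :
  (f (ract (u : U) l) : Y) = ract (f u : Y) (pr l).
Proof. exact: (bihom_ract f). Qed.
Lemma half_killr (U : bimodType L L) (Y : bimodType A A)
  (f : bihom (half U) (inflate_right Y)) x u : f (ract (u : U) (j x)) = 0.
Proof. by rewrite half_ract te_pr_j ractr0. Qed.

(* The one-sided relative bar resolution of [A] over [L]: in degree n it is
   [L] tensored over [A] with the n-th tensor power of [X], with [X] acting by
   zero on the right; its differential maps (x, y) to (0, x). *)
Definition barmod of trivialExtension L X := fun n => (tens X n * tens X n.+1)%type.
Section Barmod.
Variable n : nat.
Local Notation S := (barmod E n).
HB.instance Definition _ := GRing.Lmodule.on S.
Definition bar_lact (l : L) (s : S) : S :=
  (lact (pr l) s.1, lact (pr l) s.2 + tcons (r l) s.1).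
Definition bar_ract (s : S) (l : L) : S := (ract s.1 (pr l), ract s.2 (pr l)).
Let lcAC (V : lmodType k) (c : k) (s s' t t' : V) :
  (c *: s + t) + (c *: s' + t') = c *: (s + s') + (t + t').
Proof. by rewrite !scalerDr addrACA. Qed.
Fact bar_lr l : linear (bar_lact l).
Proof.
move=> c [x y] [x' y']; congr (_, _); rewrite /= lact_linearr //.
by rewrite (tcons_linr _ c x x') lcAC.
Qed.
Fact bar_ll s : linear (bar_lact^~ s).
Proof.
move=> c l l'; rewrite /bar_lact te_r_lin linearP !lact_linearl.
by rewrite tcons_linl lcAC.
Qed.
Fact bar_l1 s : bar_lact 1 s = s.
Proof.
case: s => x y; rewrite /bar_lact rmorph1 te_r1 !lact1.
by rewrite (linear_at0 (@tcons_linl _ _ X n x)) addr0.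
Qed.
Fact bar_lM l l' s : bar_lact (l * l') s = bar_lact l (bar_lact l' s).
Proof.
case: s => x y; rewrite /bar_lact rmorphM te_rM !lactM /= lactDr -addrA.
congr (_, _ + _); rewrite tcons_lact -tcons_balanced.
by have := @tcons_linl _ _ X n x 1; rewrite /= => h;
  have := h (lact (pr l) (r l')) (ract (r l) (pr l')); rewrite !scale1r.
Qed.
Fact bar_rl l : linear (bar_ract^~ l).
Proof. by move=> c [x y] [x' y']; congr (_, _); rewrite /= ract_linearl. Qed.
Fact bar_rr s : linear (bar_ract s).
Proof. by move=> c l l'; rewrite /bar_ract linearP !ract_linearr. Qed.
Fact bar_r1 s : bar_ract s 1 = s.
Proof. by case: s => x y; rewrite /bar_ract rmorph1 !ract1. Qed.
Fact bar_rM s l l' : bar_ract s (l * l') = bar_ract (bar_ract s l) l'.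
Proof. by rewrite /bar_ract rmorphM !ractM. Qed.
Fact bar_lrA l s l' : bar_ract (bar_lact l s) l' = bar_lact l (bar_ract s l').
Proof.
case: s => x y; rewrite /bar_ract /bar_lact /= !lractA ractDl lractA.
by rewrite tcons_ract.
Qed.
HB.instance Definition _ := isBimodule.Build k L L S bar_lr bar_ll bar_l1 bar_lM
  bar_rl bar_rr bar_r1 bar_rM bar_lrA.
Lemma bar_lactE l (s : S) :
  lact l s = (lact (pr l) s.1, lact (pr l) s.2 + tcons (r l) s.1) :> S.
Proof. by []. Qed.
Lemma barmod_fst_morphism :
  bimod_morphism (fun s : S => s.1 : inflate (tens X n)).
Proof. by split. Qed.
End Barmod.
End TrivialExtensionTheory.

(** * Comparison of a resolution of L with the one-sided bar complex *)

Section TrivialExtensionResolution.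
Variables (k : fieldType) (A L : algType k) (X : bimodType A A).
Variable E : trivialExtension L X.
Variable P : projResolution (regular_bimod L).
Local Notation io := (te_in E).
Local Notation pr := (te_pr E).
Local Notation j := (te_j E).
Local Notation r := (te_r E).

(** Compatibility with the bar differential, read on second components; on first components it is
    [theta_diff], which follows. *)
Definition is_theta (th : forall n, bihom (P n) (barmod E n)) : Prop :=
  (forall p, (th 0%N p).1 = pr (res_aug P p : L)) /\
  (forall n p, (th n.+1 p).1 = (th n (res_diff P n p)).2).

Lemma theta_exists : exists th, is_theta th.
Proof.
have lift n (f : P n -> tens X n) :
    bimod_morphism (f : P n -> inflate E (tens X n)) ->
    exists g : bihom (P n) (barmod E n), forall p, (g p).1 = f p.
  move=> f_mor.
  exact: (projective_lift (p := Bihom (barmod_fst_morphism E n))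
    (@res_projective _ _ _ _ P n) f_mor (fun u => ex_intro _ (f u, 0) erefl)).
have [|th0 th0E] := lift 0%N (fun p => pr (res_aug P p : L)).
  split=> [c p q|l p|p l]; first by rewrite bihom_lin linearP.
    by rewrite bihom_lact -[lact _ _]/(l * (res_aug P p : L)) rmorphM.
  by rewrite bihom_ract -[ract _ _]/((res_aug P p : L) * l) rmorphM.
have [||th [thE0 thE]] := @dependent_choice_nat
  (fun n => bihom (P n) (barmod E n))
  (fun n g => forall p, (g (res_diff P n p)).1 = 0)
  (fun n g g' => forall p, (g' p).1 = (g (res_diff P n p)).2) th0.
- by move=> p; rewrite th0E res_aug_diff raddf0.
(* Only the first component is prescribed, the second is left to projectivity. The prescription is
   bilinear for the inflated actions since X acts through the first component of [g], which vanishes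
   on boundaries. *)
- move=> n g g0; have [|g' g'E] := lift n.+1 (fun p => (g (res_diff P n p)).2).
    split=> [c p q|l p|p l]; rewrite ?bihom_lin ?bihom_lact ?bihom_ract //.
    by rewrite bar_lactE /= g0 (linear_at0 (tcons_linr _)) addr0.
  by exists g' => // p; rewrite g'E res_diffK bihom_at0.
by exists th; split=> // p; rewrite thE0.
Qed.

(* The differential of 1 (x) x_1 (x) ... (x) x_(n+1) (x) 1 in the bar complex:
   the inner terms vanish because [X] has square zero. *)
Definition bar_boundary n (u : ('I_n -> X) -> P n) (x : 'I_n.+1 -> X) : P n :=
  lact (j (x ord0)) (u (x \o lift ord0))
  + (-1) ^+ n.+1 *: ract (u (x \o lift ord_max)) (j (x ord_max)).

(** The elements are chosen tuple by tuple, with no linearity in x: they serve only as points at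
    which bimodule maps are evaluated. *)
Definition is_bar_section (u : forall n, ('I_n -> X) -> P n) : Prop :=
  (forall x, res_aug P (u 0%N x) = (1 : L)) /\
  (forall n x, res_diff P n (u n.+1 x) = bar_boundary (@u n) x).

Lemma bar_section_exists : exists u, is_bar_section u.
Proof.
have [u0 u0E] := res_aug_surj P (1 : L).
have [||u [uE0 uE]] := @dependent_choice_nat (fun n => ('I_n -> X) -> P n)
  (fun n u => forall x, is_cycle (bar_boundary u x))
  (fun n u u' => forall x, res_diff P n (u' x) = bar_boundary u x) (fun=> u0).
- move=> x; rewrite /bar_boundary /= bihomD bihomZ bihom_lact bihom_ract u0E.
  rewrite -[lact _ _]/(j (x ord0) * 1) -[ract _ _]/(1 * j (x ord_max)).
  by rewrite mulr1 mul1r (ord1 ord_max) expr1 scaleN1r subrr.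
- move=> n u u_cyc; have /choice[u' u'E] x : exists v,
      res_diff P n v = bar_boundary u x by apply/is_cycleP.
  exists u' => // x; rewrite /= {1}/bar_boundary bihomD bihomZ bihom_lact bihom_ract.
  (* Products of two elements of X vanish; what remains is x_first u x_last twice, with opposite
     signs. *)
  rewrite !u'E /bar_boundary lactDr ractDl -lactM ractZl -ractM !te_jj lact0l.
  rewrite ractr0 scaler0 addr0 add0r lactZr -lractA.
  have -> : (x \o lift ord0) ord_max = x ord_max.
    by congr x; apply: val_inj; exact: lift0.
  have -> : (x \o lift ord_max) ord0 = x ord0.
    by congr x; apply: val_inj; exact: lift_max.
  have -> : (x \o lift ord_max) \o lift ord0 = (x \o lift ord0) \o lift ord_max.
    apply/funext => i; congr x; apply: ord_inj.
    by rewrite lift_max !lift0 lift_max.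
  by rewrite [_ ^+ n.+2]exprS mulN1r scaleNr subrr.
by exists u; split=> // x; rewrite uE0.
Qed.

Variable th : forall n, bihom (P n) (barmod E n).
Hypothesis thP : is_theta th.
Variable u : forall n, ('I_n -> X) -> P n.
Hypothesis uP : is_bar_section u.

Lemma theta_aug p : (th 0%N p).1 = pr (res_aug P p : L). Proof. exact: thP.1. Qed.
Lemma thetaS n p : (th n.+1 p).1 = (th n (res_diff P n p)).2.
Proof. exact: thP.2. Qed.

Lemma theta1_lact n l p : (th n (lact l p)).1 = lact (pr l) (th n p).1.
Proof. by rewrite bihom_lact. Qed.
Lemma theta1_ract n l p : (th n (ract p l)).1 = ract (th n p).1 (pr l).
Proof. by rewrite bihom_ract. Qed.
Lemma theta1_lin n : linear (fun p => (th n p).1).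
Proof. by move=> c p q; rewrite bihom_lin. Qed.
Lemma theta2_lin n : linear (fun p => (th n p).2).
Proof. by move=> c p q; rewrite bihom_lin. Qed.
Lemma theta2_in n a p : (th n (lact (io a) p)).2 = lact a (th n p).2.
Proof.
rewrite bihom_lact bar_lactE /= te_pr_in te_r_io.
by rewrite (linear_at0 (@tcons_linl _ _ X n _)) addr0.
Qed.
Lemma theta2_j n x p : (th n (lact (j x) p)).2 = tcons x (th n p).1.
Proof. by rewrite bihom_lact bar_lactE /= te_pr_j te_rj lact0l add0r. Qed.
Lemma theta2_ract n l p : (th n (ract p l)).2 = ract (th n p).2 (pr l).
Proof. by rewrite bihom_ract. Qed.

Lemma theta_diff n p : (th n (res_diff P n p)).1 = 0.
Proof.
case: n p => [|n] p; first by rewrite theta_aug res_aug_diff raddf0.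
by rewrite thetaS res_diffK bihom_at0.
Qed.

(** Of the two terms of [bar_boundary], the right one is killed because X acts by zero on the right
    of the bar module, and the left one prepends a factor. *)
Lemma theta_bar n x : (th n (u x)).1 = tens_pure x.
Proof.
elim: n x => [|n IH] x; first by rewrite theta_aug uP.1 rmorph1.
rewrite thetaS uP.2 /bar_boundary addrC theta2_lin theta2_ract te_pr_j ractr0.
by rewrite scaler0 add0r theta2_j IH tcons_pure.
Qed.

(** The boundary of [u x] lies in X.P + P.X. *)
Lemma inflate_bar n (Y : bimodType A A) (f : bihom (P n) (inflate E Y)) x :
  f (res_diff P n (u x)) = 0.
Proof.
rewrite uP.2 /bar_boundary bihomD bihomZ inflate_killl inflate_killr.
by rewrite scaler0 addr0.
Qed.

Lemma theta_cocycle_morphism n (Y : bimodType A A) (f : bihom (tens X n) Y) :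
  bimod_morphism (fun p => f (th n p).1 : inflate E Y).
Proof.
split=> [c p q|l p|p l]; rewrite ?theta1_lact ?theta1_ract ?bihom_lact ?bihom_ract //.
by rewrite theta1_lin bihom_lin.
Qed.

(** Evaluation at [u x] removes the coboundary and leaves [f] on a pure tensor. So Hom(X^(n+1), Y)
    embeds in the cohomology with coefficients in Y. *)
Lemma theta_coboundary_inj n (Y : bimodType A A) (f : bihom (tens X n.+1) Y)
    (z : bihom (P n) (inflate E Y)) :
  (forall p, f (th n.+1 p).1 = z (res_diff P n p)) -> forall t, f t = 0.
Proof.
move=> fz; apply: tens_ext => [|c s t|x]; first exact: bihom_lin.
  by rewrite scaler0 addr0.
by rewrite -theta_bar fz inflate_bar.
Qed.

Hypothesis X_proj : projective X.

(* A cocycle with values in [lhom X Y] is a bimodule map from [X] to cocycles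
   of right-linear maps, and the latter are coboundaries by contractibility. *)
Lemma lhom_cocycle n (Y : bimodType A A)
    (f : bihom (P n.+1) (inflate E (lhom X Y))) :
  (forall p, f (res_diff P n.+1 p) = 0) ->
  exists g : bihom (half E (P n)) (inflate_right E (lhom X Y)),
    forall p, f p = g (res_diff P n p).
Proof.
move=> fd.
(* Right linear maps from [P m] to Y: A acts on the left on values, and on the right through left
   multiplication on [P m]. Exchanging arguments turns [f] into a map from X to these, to be lifted
   by projectivity of X. *)
pose R m := rhom (half E (P m)) (inflate_right E Y).
have R_lact m a (h : R m) p : rhom_fun (lact a h) p = lact a (rhom_fun h p : Y).
  by [].
have R_ract m a (h : R m) p :
  rhom_fun (ract h a) p = rhom_fun h (lact (io a) (p : P m)) by [].
have D_lin (h : R n) :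
    right_linear (fun p : half E (P n.+1) => rhom_fun h (res_diff P n p)).
  case: (rhomP h) => hl hr; split=> [c p q|p l]; first by rewrite bihom_lin hl.
  by rewrite restr_ractE bihom_ract; exact: hr.
have D_mor : bimod_morphism (fun h : R n => Rhom (D_lin h) : R n.+1).
  split=> [c h h'|a h|h a]; apply: rhom_inj => p.
  - by rewrite rhom_linE !RhomE rhom_linE.
  - by rewrite R_lact.
  - by rewrite R_ract !RhomE bihom_lact ?R_ract.
have F_lin x : right_linear
    (fun p : half E (P n.+1) => lhom_fun (f p : lhom X Y) x : inflate_right E Y).
  split=> [c p q|p l]; first by rewrite bihom_lin lhom_linE.
  rewrite restr_ractE inflate_ract lhom_ractE; exact: erefl.
have F_mor : bimod_morphism (fun x => Rhom (F_lin x) : R n.+1).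
  split=> [c x y|a x|x a]; apply: rhom_inj => p.
  - by rewrite rhom_linE !RhomE; case: (lhomP (f p : lhom X Y)) => fl _; rewrite fl.
  - rewrite R_lact !RhomE; case: (lhomP (f p : lhom X Y)) => _ fa; exact: fa.
  - by rewrite R_ract !RhomE inflate_lact te_pr_in lhom_lactE.
have [x|g gE] := projective_lift (p := Bihom D_mor) X_proj F_mor.
  (* For fixed x the map f(-)(x) is right linear. Composed with [s] it is a primitive, since s d p -
     p is a boundary and [f] is a cocycle. *)
  have [s [sl sr sK]] := right_contraction P n.
  have h_lin : right_linear (fun p : half E (P n) =>
      lhom_fun (f (s p) : lhom X Y) x : inflate_right E Y).
    split=> [c p q|p l]; first by rewrite sl bihom_lin lhom_linE.
    rewrite restr_ractE sr inflate_ract lhom_ractE; exact: erefl.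
  exists (Rhom h_lin); apply: rhom_inj => p /=.
  suff -> : f (s (res_diff P n p)) = f p by [].
  have [|q qE] := (is_cycleP (n := n.+1) (s (res_diff P n p) - p)).1.
    by rewrite /= bihomB sK ?subrr //; exact: is_cycle_diff.
  by apply/eqP; rewrite -subr_eq0 -bihomB -qE fd.
have G_lin p : left_linear (fun x => rhom_fun (g x) p : Y).
  split=> [c x y|a x]; first by rewrite bihom_lin rhom_linE.
  by rewrite bihom_lact ?R_lact.
have G_mor : bimod_morphism (fun p : half E (P n) =>
    Lhom (G_lin p) : inflate_right E (lhom X Y)).
  split=> [c p q|a p|p l]; apply: lhom_inj => x.
  - by rewrite lhom_linE !LhomE; case: (rhomP (g x)) => gl _; rewrite gl.
  - exact: (esym (congr1 (fun h : R n => rhom_fun h p) (bihom_ract g x a))).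
  - by case: (rhomP (g x)) => _ gr; exact: gr.
exists (Bihom G_mor) => p; apply: lhom_inj => x /=.
exact: (esym (congr1 (fun h : R n.+1 => rhom_fun h p) (gE x))).
Qed.
End TrivialExtensionResolution.

(** * Cocycles over L that become coboundaries one-sidedly *)

Section CocycleDecomposition.
Variables (k : fieldType) (A L : algType k) (X : bimodType A A).
Variable E : trivialExtension L X.
Variable P : projResolution (regular_bimod L).
Local Notation io := (te_in E).
Local Notation pr := (te_pr E).
Local Notation j := (te_j E).
Local Notation r := (te_r E).
Variable th : forall n, bihom (P n) (barmod E n).
Hypothesis thP : is_theta th.
Hypothesis X_proj : projective X.

Lemma lact_decomp (U : bimodType L L) l (p : U) :
  lact l p = lact (io (pr l)) p + lact (j (r l)) p.
Proof. by rewrite -lactDl -te_decomp. Qed.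
Lemma te_j_mull x l : j x * l = j (ract x (pr l)).
Proof. by rewrite {1}(te_decomp E l) mulrDr te_jj addr0 te_j_ract. Qed.
Lemma te_j_mulr x l : l * j x = j (lact (pr l) x).
Proof. by rewrite {1}(te_decomp E l) mulrDl te_jj addr0 te_j_lact. Qed.

Lemma half_to_inflate (U : bimodType L L) (Y : bimodType A A)
    (h : bihom (half E U) (inflate_right E Y)) :
  (forall x p, h (lact (j x) (p : U)) = 0) ->
  bimod_morphism (h : U -> inflate E Y).
Proof.
move=> h0; split=> [|l p|p l]; [exact: (bihom_lin h)| |exact: (bihom_ract h)].
rewrite lact_decomp (bihomD h) h0 addr0; exact: (bihom_lact h).
Qed.

Lemma inflate_to_half (U : bimodType L L) (Y : bimodType A A)
    (h : bihom U (inflate E Y)) :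
  bimod_morphism (h : half E U -> inflate_right E Y).
Proof.
split=> [|a p|p l]; [exact: (bihom_lin h)| |exact: (bihom_ract h)].
by rewrite restr_lactE inflate_lact te_pr_in.
Qed.

(** Restriction from Hom_A(L, Y) to Hom_A(X, Y) is onto, a preimage of a map being its composite
    with [te_r]. Projectivity of U lifts [z] to Hom_A(L, Y), and evaluation at 1 gives [h]. *)
Lemma lhom_restriction_surj (U : bimodType L L) (Y : bimodType A A) :
  projective U -> forall z : bihom U (inflate E (lhom X Y)),
  exists h : bihom (half E U) (inflate_right E Y),
    forall x p, h (lact (j x) (p : U)) = lhom_fun (z p : lhom X Y) x.
Proof.
move=> U_proj z.
pose LA : bimodType A L := restr io (@idfun L) (regular_bimod L).
pose C : bimodType L L := lhom LA (inflate_right E Y).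
have q_lin (h : C) : left_linear (fun x : X => lhom_fun h (j x : LA) : Y).
  case: (lhomP h) => hl ha.
  split=> [c x y|a x]; first by rewrite te_j_lin; exact: hl.
  by rewrite te_j_lact; exact: ha.
have q_mor : bimod_morphism (fun h : C => Lhom (q_lin h) : inflate E (lhom X Y)).
  split=> [c h h'|l h|h l]; apply: lhom_inj => x.
  - by rewrite lhom_linE !LhomE lhom_linE.
  - rewrite restr_lactE lhom_lactE !LhomE ?lhom_lactE; congr (lhom_fun h _).
    exact: te_j_mull.
  - by [].
have [|z2 z2E] := projective_lift (p := Bihom q_mor) U_proj (bihomP z).
  move=> p; have h_lin : left_linear (fun l : LA =>
      lhom_fun (z p : lhom X Y) (r (l : L)) : inflate_right E Y).
    case: (lhomP (z p : lhom X Y)) => fl fa.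
    split=> [c l l'|a l]; first by rewrite te_r_lin fl.
    rewrite -[lact a l]/(io a * (l : L)) te_rM te_pr_in te_r_io ract0l addr0.
    exact: fa.
  by exists (Lhom h_lin); apply: lhom_inj => x; rewrite !LhomE te_rj.
have h_mor : bimod_morphism (fun p : half E U =>
    lhom_fun (z2 p : lhom LA (inflate_right E Y)) (1 : L) : inflate_right E Y).
  split=> [c p q|a p|p l].
  - by rewrite (bihom_lin z2) lhom_linE.
  - rewrite restr_lactE (bihom_lact z2) lhom_lactE.
    case: (lhomP (z2 p)) => _ <-; congr (lhom_fun _ _).
    exact: (etrans (mul1r (io a)) (esym (mulr1 (io a)))).
  - by rewrite restr_ractE (bihom_ract z2) lhom_ractE.
exists (Bihom h_mor) => x p /=.
rewrite (bihom_lact z2) lhom_lactE -(z2E p) LhomE; congr (lhom_fun _ _).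
exact: mul1r.
Qed.

(** The slice is linear over L because j x * l depends on l only through [te_pr], X having square
    zero. *)
Lemma cochain_slice n (Y : bimodType A A)
    (g : bihom (half E (P n)) (inflate_right E Y)) :
  exists g1 : bihom (P n) (inflate E (lhom X Y)),
    forall p x, lhom_fun (g1 p : lhom X Y) x = g (lact (j x) p).
Proof.
have g1_lin p : left_linear (fun x : X => g (lact (j x) (p : P n)) : Y).
  split=> [c x y|a x]; first by rewrite te_j_lin lact_linearl; exact: (bihom_lin g).
  by rewrite te_j_lact lactM half_lact.
have g1_mor : bimod_morphism (fun p : P n => Lhom (g1_lin p) : inflate E (lhom X Y)).
  split=> [c p q|l p|p l]; apply: lhom_inj => x.
  - by rewrite lhom_linE !LhomE lact_linearr; exact: (bihom_lin g).
  - by rewrite restr_lactE lhom_lactE !LhomE -lactM te_j_mull.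
  - by rewrite restr_ractE lhom_ractE !LhomE -lractA half_ract.
by exists (Bihom g1_mor).
Qed.

(** Let [phi] be [phi1] uncurried. As theta prepends x on X.P, subtracting [phi] of the second
    component of theta and [g2] from [g] leaves a cochain that kills X.P, that is, an inflated
    one. *)
Lemma slice_decomposition n (Y : bimodType A A)
    (f : bihom (P n.+1) (inflate E Y))
    (g g2 : bihom (half E (P n)) (inflate_right E Y))
    (phi1 : bihom (tens X n) (lhom X Y)) :
  (forall p, f p = g (res_diff P n p)) ->
  (forall x p, g (lact (j x) p) = lhom_fun (phi1 (th n p).1) x + g2 (lact (j x) p)) ->
  (forall p, g2 (res_diff P n p) = 0) ->
  exists (phi : bihom (tens X n.+1) Y) (z : bihom (P n) (inflate E Y)),
    forall p, f p = phi (th n.+1 p).1 + z (res_diff P n p).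
Proof.
move=> fg gE g2_d; have [phi phiE] := tens_uncurry phi1.
have b_mor : bimod_morphism
    (fun p : half E (P n) => phi (th n (p : P n)).2 : inflate_right E Y).
  split=> [c p q|a p|p l]; first by rewrite (theta2_lin th) bihom_lin.
    by rewrite restr_lactE theta2_in bihom_lact.
  by rewrite restr_ractE theta2_ract bihom_ract.
pose z0 : bihom _ _ := g - Bihom b_mor - g2.
have z_kill x p : z0 (lact (j x) (p : P n)) = 0.
  rewrite !bihom_fun_sub gE /= theta2_j phiE.
  by rewrite addrAC addrK subrr.
exists phi, (Bihom (half_to_inflate z_kill)) => p; rewrite fg (thetaS thP).
rewrite -[bihom_fun (Bihom (half_to_inflate _)) _]/(z0 (res_diff P n p)) /z0.
by rewrite !bihom_fun_sub g2_d subr0 /= addrC subrK.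
Qed.

(* Contracting a cochain with [X] on the left lowers the degree and replaces
   [Y] by [lhom X Y]. *)
Lemma cocycle_decomposition n (Y : bimodType A A)
    (f : bihom (P n.+1) (inflate E Y))
    (g : bihom (half E (P n)) (inflate_right E Y)) :
  (forall p, f p = g (res_diff P n p)) ->
  exists (phi : bihom (tens X n.+1) Y) (z : bihom (P n) (inflate E Y)),
    forall p, f p = phi (th n.+1 p).1 + z (res_diff P n p).
Proof.
elim: n Y f g => [|n IH] Y f g fg; have [g1 g1E] := cochain_slice g;
  have g1_d p : g1 (res_diff P _ p) = 0
    by apply: lhom_inj => x; rewrite g1E -bihom_lact -fg inflate_killl.
  (* In degree 0 the cocycle [g1] factors through the augmentation, so it is given by its value f0
     at [u0], an element that commutes with A. *)
  have [u0 u0E] := res_aug_surj P (1 : L).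
  have g1_u (l : L) p : res_aug P p = l -> g1 p = g1 (lact l u0) /\ g1 p = g1 (ract u0 l).
    move=> pl; split; apply/eqP; rewrite -subr_eq0 -bihomB.
      have [|v <-] := (is_cycleP (n := 0) (p - lact l u0)).1; last by rewrite g1_d.
      by rewrite /= bihomB bihom_lact u0E pl -[lact _ _]/(l * 1) mulr1 subrr.
    have [|v <-] := (is_cycleP (n := 0) (p - ract u0 l)).1; last by rewrite g1_d.
    by rewrite /= bihomB bihom_ract u0E pl -[ract _ _]/(1 * l) mul1r subrr.
  pose f0 : lhom X Y := g1 u0.
  have f0C a : lact a f0 = ract f0 a.
    have [] := g1_u (io a) (lact (io a) u0).
      by rewrite bihom_lact u0E; exact: mulr1.
    by rewrite inflate_lact te_pr_in => _ ->; rewrite inflate_ract te_pr_in.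
  have phi_mor : bimod_morphism (fun a : tens X 0 => lact (a : A) f0).
    split=> [c a b|a b|a b]; first exact: lact_linearl.
      exact: lactM.
    by rewrite f0C -[ract a b]/((a : A) * b) f0C ractM.
  apply: (slice_decomposition (g2 := 0) (phi1 := Bihom phi_mor) fg).
    move=> x p; rewrite bihom0E addr0 -g1E (theta_aug thP) /=.
    by have [-> _] := g1_u _ p erefl; rewrite inflate_lact.
  by move=> p; rewrite bihom0E.
(* The slice is a one-sided coboundary, so induction applies to it. Its remainder, the coboundary of
   [z1], is the slice of the cocycle h d once [h] restricts to [z1] on X.P. *)
have [g0 g0E] := lhom_cocycle X_proj g1_d.
have [phi1 [z1 z1E]] := IH _ _ _ g0E.
have [h hE] := lhom_restriction_surj (@res_projective _ _ _ _ P n) z1.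
have g2_mor : bimod_morphism
    (fun p : half E (P n.+1) => h (res_diff P n p) : inflate_right E Y).
  split=> [c p q|a p|p l]; first by rewrite bihom_lin (bihom_lin h).
    by rewrite restr_lactE bihom_lact; exact: (bihom_lact h).
  by rewrite restr_ractE bihom_ract; exact: (bihom_ract h).
apply: (slice_decomposition (g2 := Bihom g2_mor) (phi1 := phi1) fg).
  move=> x p; rewrite -g1E z1E /= bihom_lact hE.
  have := lhom_linE 1 (phi1 (th n.+1 p).1) (z1 (res_diff P n p) : lhom X Y) x.
  by rewrite !scale1r.
by move=> p /=; rewrite res_diffK bihom_at0.
Qed.
End CocycleDecomposition.

(** * From a resolution of L to a resolution of A *)

Section RightReduction.
Variables (k : fieldType) (A L : algType k) (X : bimodType A A).
Variable E : trivialExtension L X.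
Local Notation io := (te_in E).
Local Notation pr := (te_pr E).
Local Notation j := (te_j E).
Local Notation r := (te_r E).
Hypothesis X_proj : projective X.

(** As a left A-module L is A + X, and X is projective on the left; maps out of L are lifted summand
    by summand. *)
Lemma half_projective (U : bimodType L L) : projective U -> projective (half E U).
Proof.
apply: projective_restr => X' Y' p p_surj g.
case: (lhomP g) => gl ga.
have g0_lin : left_linear (fun x : X => lhom_fun g (j x : L)).
  split=> [c x y|a x]; first by rewrite te_j_lin gl.
  by rewrite te_j_lact; exact: ga.
have [h hE] := projective_left X_proj p_surj (Lhom g0_lin).
case: (lhomP h) => hl ha; have [x0 x0E] := p_surj (lhom_fun g (1 : L)).
have h_lin : left_linear (fun l : restr io (@idfun L) (regular_bimod L) =>
    lact (pr (l : L)) x0 + lhom_fun h (r (l : L))).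
  split=> [c l l'|a l].
    by rewrite linearP lact_linearl te_r_lin hl scalerDr addrACA.
  rewrite -[lact a l]/(io a * (l : L)) rmorphM /= te_pr_in lactM te_rM te_pr_in.
  by rewrite te_r_io ract0l addr0 ha lactDr.
exists (Lhom h_lin) => l; rewrite LhomE bihomD bihom_lact x0E hE LhomE -ga.
rewrite -[lact (pr l) _]/(io (pr l) * 1 : L) mulr1.
by have := gl 1 (io (pr l)) (j (r l)); rewrite !scale1r -te_decomp.
Qed.

Variable P : projResolution (regular_bimod L).

Definition right_multiple n (v : P n) : Prop := exists p x, v = ract p (j x).
Local Notation AP n := (restr io io (P n)).
Local Notation PX n := (@in_span k (AP n) (@right_multiple n)).

Lemma right_multiple_lact n a (v : AP n) : v \in PX n -> lact a v \in PX n.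
Proof.
apply: in_span_map; first by move=> c x y; exact: lact_linearr.
move=> _ [p [x ->]]; apply: mem_span; exists (lact (io a) p), x.
by rewrite restr_lactE lractA.
Qed.
Lemma right_multiple_ract n (v : AP n) a : v \in PX n -> ract v a \in PX n.
Proof.
move: v; apply: in_span_map; first by move=> c x y; exact: ract_linearl.
move=> _ [p [x ->]]; apply: mem_span; exists p, (ract x a).
by rewrite restr_ractE te_j_ract ractM.
Qed.

Definition red n : bimodType A A :=
  quotbimod (@right_multiple_lact n) (@right_multiple_ract n).
Definition red_proj n (p : P n) : red n :=
  qbproj (@right_multiple_lact n) (@right_multiple_ract n) (p : AP n).

Lemma red_proj_eq n (p p' : P n) :
  red_proj p = red_proj p' <-> (p - p' : AP n) \in PX n.
Proof. exact: (qbproj_eq (@right_multiple_lact n) (@right_multiple_ract n)). Qed.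
Lemma red_proj_lin n : linear (@red_proj n).
Proof. exact: (qbproj_lin (@right_multiple_lact n) (@right_multiple_ract n)). Qed.
Lemma red_proj_surj n y : exists p, @red_proj n p = y.
Proof. by have [p ->] := qbproj_surj (y : quotbimod (@right_multiple_lact n) (@right_multiple_ract n)); exists p. Qed.
Lemma red_proj0 n (p : P n) : (p : AP n) \in PX n -> red_proj p = 0.
Proof.
move=> pX; rewrite -(linear_at0 (@red_proj_lin n)); apply/red_proj_eq.
by rewrite subr0.
Qed.
Lemma red_proj_ker n (p : P n) : red_proj p = 0 -> (p : AP n) \in PX n.
Proof.
by rewrite -(linear_at0 (@red_proj_lin n)) => /red_proj_eq; rewrite subr0.
Qed.

Lemma red_proj_morphism n :
  bimod_morphism (fun p : half E (P n) => red_proj (p : P n) : inflate_right E (red n)).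
Proof.
have [_ ql qr] := qbproj_mor (@right_multiple_lact n) (@right_multiple_ract n).
split=> [|a p|p l]; [exact: red_proj_lin|exact: ql|].
rewrite -[RHS](qr p (pr l)); apply/red_proj_eq/mem_span; exists p, (r l).
apply/eqP; rewrite subr_eq addrC -[X in _ == X + _]/(ract (p : P n) (io (pr l))).
by rewrite -ractDr -te_decomp.
Qed.

Lemma red_factor n (Y : bimodType A A)
    (f : bihom (half E (P n)) (inflate_right E Y)) :
  exists g : bihom (red n) Y, forall p, g (red_proj p) = f p.
Proof.
apply: (quotbimod_factor (@right_multiple_lact n) (@right_multiple_ract n)
  (f := fun p : AP n => f p : Y)) => [|p].
  split=> [|a p|p a]; [exact: (bihom_lin f)|exact: (bihom_lact f)|].
  by rewrite restr_ractE half_ract te_pr_in.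
move: p; apply: in_span_kill (bihom_lin f) _ => _ [p [x ->]].
exact: half_killr.
Qed.

(** Maps out of [red n] are the maps from [half E (P n)] to inflated bimodules, so the lifting is
    done on [half E (P n)]. *)
Lemma red_projective n : projective (red n).
Proof.
move=> Y Z h f h_surj.
have h_mor : bimod_morphism (h : inflate_right E Y -> inflate_right E Z).
  split=> [|a y|y l]; [exact: (bihom_lin h)|exact: (bihom_lact h)|].
  exact: (bihom_ract h).
have f_mor : bimod_morphism
    (fun p : half E (P n) => f (red_proj (p : P n)) : inflate_right E Z).
  have [ql qa qr] := red_proj_morphism n.
  split=> [c p q|a p|p l]; first by rewrite ql; exact: (bihom_lin f).
    by rewrite qa; exact: (bihom_lact f).
  by rewrite qr; exact: (bihom_ract f).
have [|g0 g0E] := projective_lift (p := Bihom h_mor)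
  (half_projective (@res_projective _ _ _ _ P n)) f_mor.
  by move=> p; exact: h_surj.
have [g gE] := red_factor g0; exists g => x.
by have [p <-] := red_proj_surj x; rewrite gE; exact: g0E.
Qed.

(* [P n] modulo the right multiples of [X] is a resolution of [A]; exactness
   comes from the right-linear contraction of [P]. *)
Lemma right_reduction :
  exists (R : projResolution (regular_bimod A))
         (q : forall n, bihom (half E (P n)) (inflate_right E (R n))),
  [/\ forall p, (res_aug R (q 0%N p) : A) = pr (res_aug P p : L),
      forall n p, res_diff R n (q n.+1 p) = q n (res_diff P n p),
      forall n x, exists p, q n p = x
    & forall n (Y : bimodType A A) (f : bihom (half E (P n)) (inflate_right E Y)),
        exists g : bihom (R n) Y, forall p, g (q n p) = f p].
Proof.
have d_ex n : exists D : bihom (red n.+1) (red n),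
    forall p, D (red_proj p) = red_proj (res_diff P n p).
  have [ql qa qr] := red_proj_morphism n.
  have f_mor : bimod_morphism (fun p : half E (P n.+1) =>
      red_proj (res_diff P n p) : inflate_right E (red n)).
    split=> [c p p'|a p|p l]; first by rewrite bihom_lin; exact: ql.
      by rewrite restr_lactE bihom_lact; exact: qa.
    by rewrite restr_ractE bihom_ract; exact: qr.
  exact: (red_factor (Bihom f_mor)).
have [D DE] : exists D : forall n, bihom (red n.+1) (red n),
    forall n p, D n (red_proj p) = red_proj (res_diff P n p).
  by exists (fun n => sval (cid (d_ex n))) => n; case: cid.
have [e eE] : exists e : bihom (red 0) (regular_bimod A),
    forall p, e (red_proj p) = pr (res_aug P p : L).
  have f_mor : bimod_morphism (fun p : half E (P 0%N) =>
      pr (res_aug P p : L) : inflate_right E (regular_bimod A)).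
    split=> [c p p'|a p|p l]; first by rewrite bihom_lin linearP.
      rewrite restr_lactE bihom_lact -[lact _ _]/(io a * (res_aug P p : L)).
      by rewrite rmorphM /= te_pr_in.
    rewrite restr_ractE bihom_ract -[ract _ _]/((res_aug P p : L) * l).
    by rewrite rmorphM.
  exact: (red_factor (Bihom f_mor)).
have e_surj a : exists x, e x = a.
  have [p pE] := res_aug_surj P (io a : L).
  by exists (red_proj p); rewrite eE pE te_pr_in.
have exact0 x : e x = 0 <-> exists y, D 0%N y = x.
  split=> [|[y <-]]; last first.
    by have [p <-] := red_proj_surj y; rewrite DE eE res_aug_diff raddf0.
  have [p <-] := red_proj_surj x; rewrite eE => pr0.
  (* The augmentation of p projects to 0, so it is j y; subtracting the right multiple u0 j y makes
     p a cycle without changing its class. *)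
  have [u0 u0E] := res_aug_surj P (1 : L).
  pose y := r (res_aug P p : L); have [|v vE] := (is_cycleP (p - ract u0 (j y))).1.
    rewrite /= bihomB bihom_ract u0E -[ract _ _]/(1 * j y) mul1r.
    by rewrite [X in X - _](te_decomp E) pr0 raddf0 add0r subrr.
  exists (red_proj v); rewrite DE vE; apply/red_proj_eq/mem_span.
  by exists (- u0), y; rewrite addrAC subrr add0r ractN.
have exactS n x : D n x = 0 <-> exists y, D n.+1 y = x.
  split=> [|[y <-]]; last first.
    by have [p <-] := red_proj_surj y; rewrite !DE res_diffK red_proj0 ?rpred0.
  have [p <-] := red_proj_surj x; rewrite DE => /red_proj_ker dpX.
  (* Right linearity makes [s] preserve P.X, so s d p is zero in the quotient and p has the class of
     the cycle p - s d p. *)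
  have [s [sl sr sK]] := right_contraction P n.
  have [|v vE] := (is_cycleP (n := n.+1) (p - s (res_diff P n p))).1.
    by rewrite /= bihomB sK ?subrr //; exact: is_cycle_diff.
  exists (red_proj v); rewrite DE vE; apply/red_proj_eq.
  rewrite addrAC subrr add0r -scaleN1r rpredZ //.
  move: dpX; apply: (in_span_map (f := s : AP n -> AP n.+1)) => [//|_ [p' [y ->]]].
  by rewrite sr; apply: mem_span; exists (s p'), y.
pose R := ProjResolution red_projective e_surj exact0 exactS.
exists R, (fun n => Bihom (red_proj_morphism n)); split=> //=.
- by move=> n x; exact: red_proj_surj.
- by move=> n Y f; exact: red_factor.
Qed.
End RightReduction.

(** * Vanishing by a central idempotent *)

Section ParityElement.
Variables (k : fieldType) (A : algType k) (X : bimodType A A) (e : A).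

(* For a product of two algebras and off-diagonal [X], [e] is the unit of one
   of the factors. *)
Definition is_parity : Prop :=
  [/\ forall a, e * a = a * e, e * e = e & forall x : X, lact e x + ract x e = x].

Hypothesis eP : is_parity.

Lemma parity_lact (x : X) : lact e x = x - ract x e.
Proof. by case: eP => _ _ eX; rewrite -{2}(eX x) addrK. Qed.
(** e x e = 0, so the commutator with e is an involution of X. *)
Lemma parity_twice (x : X) : lact e (lact e x - ract x e) - ract (lact e x - ract x e) e = x.
Proof.
case: eP => _ ee eX; have exe : lact e (ract x e) = 0.
  by have := parity_lact (ract x e); rewrite -ractM ee subrr.
by rewrite lactB ractB -lactM -ractM ee lractA exe subr0 sub0r opprK.
Qed.

(** Each factor crossed exchanges e and 1 - e. *)
Lemma parity_tens n (t : tens X n) :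
  lact e t = if odd n then t - ract t e else ract t e.
Proof.
case: eP => eC _ _; elim: n t => [|n IH] t; first exact: eC.
have lin : linear (fun t : tens X n.+1 =>
    if odd n.+1 then t - ract t e else ract t e).
  move=> c s v; case: ifP => _; rewrite ract_linearl //.
  by rewrite opprD scalerBr addrACA.
move: t; apply: (tens_ext (lact_linearr e) lin) => x; rewrite -tcons_pure.
rewrite tcons_lact parity_lact tcons_ract /=.
rewrite tconsBl tcons_balanced IH; case: (odd n) => //=.
by rewrite tconsBr opprB addrC subrK.
Qed.

(** e commutes with an even power, so the commutator of e with f t is zero, while on X it is
    invertible. *)
Lemma tens_even_vanish n (f : bihom (tens X n) X) t : ~~ odd n -> f t = 0.
Proof.
move=> /negPf n_even; rewrite -[LHS]parity_twice -bihom_lact -bihom_ract.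
by rewrite parity_tens n_even subrr lactr0 ract0l subr0.
Qed.

(** On an odd power e passes to 1 - e, but e is central in A: hence e f = (1 - e) f, and multiplying
    by e gives first e f = 0, then f = 0. *)
Lemma tens_odd_vanish n (f : bihom (tens X n) (regular_bimod A)) t :
  odd n -> f t = 0.
Proof.
case: eP => eC ee _ n_odd.
have ft : e * (f t : A) = f t - e * (f t : A).
  have := bihom_lact f e t; rewrite parity_tens n_odd bihomB bihom_ract => h.
  by apply: etrans (esym h) _; congr (_ - _); exact: esym (eC _).
have e0 : e * (f t : A) = 0.
  by have := congr1 (fun y => e * y) ft; rewrite mulrBr mulrA ee subrr.
by move: ft; rewrite e0 subr0.
Qed.

(** The commutator with the central e covers zero on A, so it is null-homotopic on R; on X it is an
    involution. Hence Ext(A, X) vanishes in positive degrees. *)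
Lemma parity_cocycle (R : projResolution (regular_bimod A)) n
    (f : bihom (R n.+1) X) :
  (forall x, f (res_diff R n.+1 x) = 0) ->
  exists g : bihom (R n) X, forall x, f x = g (res_diff R n x).
Proof.
move=> fd; case: (eP) => eC ee eX.
have F_mor m : bimod_morphism (fun x : R m => lact e x - ract x e).
  split=> [c x y|a x|x a].
  - by rewrite lact_linearr ract_linearl scalerBr opprD addrACA.
  - by rewrite lactB -!lactM eC lractA.
  - by rewrite ractB -!ractM eC lractA.
have [||h hE] := chain_map_null (F := fun m => Bihom (F_mor m)) _ _ n.
- by move=> m x /=; rewrite bihomB bihom_lact bihom_ract.
- move=> x /=; rewrite bihomB bihom_lact bihom_ract.
  by rewrite -[lact _ _]/(e * (res_aug R x : A)) eC subrr.
exists (bihom_comp (bihom_comp h (Bihom (F_mor n.+1))) f) => x.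
have fF y : f (lact e y - ract y e) = f (h (res_diff R n y)).
  by have [z /= ->] := hE y; rewrite bihomD fd add0r.
rewrite -[RHS]/(f (lact e (h (res_diff R n x)) - ract (h (res_diff R n x)) e)).
rewrite bihomB bihom_lact bihom_ract -fF !bihomB !bihom_lact !bihom_ract.
by rewrite parity_twice.
Qed.
End ParityElement.

(** * Cohomology classes *)

Section Classes.
Variables (k : fieldType) (A B : algType k) (X Y : bimodType A B).
Variable P : projResolution X.

(** A relation and not a chosen representative: equations between classes become equations between
    bimodule maps up to coboundary. *)
Definition is_class n (x : Ext Y P n) (f : bihom (P n) Y) : Prop :=
  exists z : cocycles (Hom_complex Y P) n,
    qproj (@coboundaries _ (Hom_complex Y P) n) z = x /\ subspace_val z = f.

Lemma class_has_cocycle n (x : Ext Y P n) : exists f, is_class x f.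
Proof. by exists (subspace_val (qrepr x)), (qrepr x); rewrite qreprK. Qed.

Lemma cocycle_has_class n (f : bihom (P n) Y) :
  (forall p, f (res_diff P n p) = 0) -> exists x : Ext Y P n, is_class x f.
Proof.
move=> fd; have fK : f \in in_ker (cobound (Hom_complex Y P) n).
  by apply/eqP/bihom_inj => p; rewrite bihom0E; exact: fd.
by exists (qproj _ (Subspace fK)), (Subspace fK).
Qed.

Lemma class_cocycle n (x : Ext Y P n) f :
  is_class x f -> forall p, f (res_diff P n p) = 0.
Proof.
move=> [z [_ <-]] p; have /eqP zK := subspace_valP z.
by have := congr1 (fun h : bihom (P n.+1) Y => h p) zK; rewrite bihom0E.
Qed.

Lemma class_linear n c (x y : Ext Y P n) f g :
  is_class x f -> is_class y g -> is_class (c *: x + y) (c *: f + g).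
Proof. by move=> [z [<- <-]] [w [<- <-]]; exists (c *: z + w); rewrite linearP. Qed.

Lemma class_eq n (x y : Ext Y P n.+1) f g : is_class x f -> is_class y g ->
  (x = y <-> exists h : bihom (P n) Y, forall p, f p - g p = h (res_diff P n p)).
Proof.
move=> [z [<- <-]] [w [<- <-]].
have E : (z - w \in @coboundaries _ (Hom_complex Y P) n.+1) <->
    exists h : bihom (P n) Y, forall p,
      (subspace_val z : bihom (P n.+1) Y) p - (subspace_val w : bihom (P n.+1) Y) p
      = h (res_diff P n p).
  split=> [/asboolP[h hE]|[h hE]].
    exists h => p; rewrite -bihom_fun_sub; apply: esym.
    exact: (congr1 (fun h : bihom (P n.+1) Y => h p) hE).
  apply/asboolP; exists h; apply: bihom_inj => p; apply: esym.
  by rewrite -[RHS]hE -bihom_fun_sub.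
by rewrite -E -qproj_eq; split=> [->|/eqP].
Qed.

Lemma class0 n : is_class (0 : Ext Y P n) 0.
Proof. by exists 0; rewrite raddf0. Qed.

Lemma class_eq0 n (x : Ext Y P n.+1) f : is_class x f ->
  (x = 0 <-> exists h : bihom (P n) Y, forall p, f p = h (res_diff P n p)).
Proof.
move=> xf; rewrite (class_eq xf (class0 n.+1)).
by split=> -[h hE]; exists h => p; have := hE p; rewrite bihom0E subr0.
Qed.

Lemma class_shift n (x : Ext Y P n.+1) (f g : bihom (P n.+1) Y) (h : bihom (P n) Y) :
  is_class x f -> (forall p, f p - g p = h (res_diff P n p)) -> is_class x g.
Proof.
move=> xf fg; have fd := class_cocycle xf.
have [p|y yg] := cocycle_has_class (f := g).
  have := fg (res_diff P n.+1 p); rewrite fd res_diffK bihom_at0 sub0r.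
  by move/eqP; rewrite oppr_eq0 => /eqP.
by have -> : x = y by apply/(class_eq xf yg); exists h.
Qed.
End Classes.

Lemma isomorphic_of_exact (k : fieldType) (U V W : lmodType k)
    (i : {linear U -> V}) (p : {linear V -> W}) :
  short_exact i p -> isomorphic V (W * U)%type.
Proof.
move=> [i_inj ex p_surj]; have [s sK] := linear_section p_surj.
have [|||f fE] := @linear_of_relation k V (W * U)%type
  (fun v wu => p v = wu.1 /\ v = s wu.1 + i wu.2).
- move=> v; have [u uE] : exists u, i u = v - s (p v).
    by apply/ex; rewrite raddfB /= sK subrr.
  by exists (p v, u); split=> //=; rewrite uE addrC subrK.
- move=> v [w x] [w' x'] /= [<- vE] [<- vE']; congr (_, _); apply: i_inj.
  by apply: (addrI (s (p v))); rewrite -vE -vE'.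
- move=> c v [w x] v' [w' x'] /= [pv vE] [pv' vE']; split.
    by rewrite linearP pv pv'.
  by rewrite !linearP addrACA -scalerDr -vE -vE'.
exists f; apply: bijective_of_inj_surj => [v fv|[w x]].
  by have [_ ->] := fE v; rewrite fv /= !raddf0 addr0.
have pi y : p (i y) = 0 by apply/ex; exists y.
exists (s w + i x); have [pf vf] := fE (s w + i x).
have pw : (f (s w + i x)).1 = w by rewrite -pf raddfD /= sK pi addr0.
rewrite [LHS]surjective_pairing pw; congr (_, _); apply: i_inj.
by apply: (addrI (s w)); rewrite [RHS]vf pw.
Qed.

(** * Hochschild cohomology of a trivial extension in even and odd degrees *)

Section Reduction.
Variables (k : fieldType) (A L : algType k) (X : bimodType A A).
Variable E : trivialExtension L X.
Variable P : projResolution (regular_bimod L).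
Variable Q : projResolution (regular_bimod A).
Local Notation io := (te_in E).
Local Notation pr := (te_pr E).
Local Notation j := (te_j E).
Local Notation r := (te_r E).
Hypothesis X_proj : projective X.
Variable e : A.
Hypothesis eP : is_parity X e.

Variable th : forall n, bihom (P n) (barmod E n).
Hypothesis thP : is_theta th.
Variable u : forall n, ('I_n -> X) -> P n.
Hypothesis uP : is_bar_section E u.

Variable R : projResolution (regular_bimod A).
Variable q : forall n, bihom (half E (P n)) (inflate_right E (R n)).
Hypothesis q_aug : forall p, (res_aug R (q 0%N p) : A) = pr (res_aug P p : L).
Hypothesis q_diff : forall n p, res_diff R n (q n.+1 p) = q n (res_diff P n p).
Hypothesis q_surj : forall n x, exists p, q n p = x.
Hypothesis q_factor :
  forall n (Y : bimodType A A) (f : bihom (half E (P n)) (inflate_right E Y)),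
    exists g : bihom (R n) Y, forall p, g (q n p) = f p.

Variable alpha : forall n, bihom (Q n) (R n).
Hypothesis alpha_diff : is_chain_map alpha.
Hypothesis alpha_aug : forall x, res_aug R (alpha 0%N x) = res_aug Q x.

Lemma pr_morphism : bimod_morphism
  (fun l : regular_bimod L => pr (l : L) : inflate E (regular_bimod A)).
Proof. by split=> [c x y|l x|x l]; [exact: linearP|exact: rmorphM|exact: rmorphM]. Qed.

Lemma inflate_factor n (Y : bimodType A A) (f : bihom (P n) (inflate E Y)) :
  exists g : bihom (R n) Y, forall p, g (q n p) = f p.
Proof. exact: (q_factor (Bihom (inflate_to_half f))). Qed.

(* Composition with [tau] is the inflation of cochains, and [beta] is a homotopy
   inverse of [alpha]. *)
Lemma inflation_exists :
  exists (tau : forall n, bihom (P n) (inflate E (Q n)))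
         (beta : forall n, bihom (R n) (Q n)),
  [/\ forall n p, (tau n p : Q n) = beta n (q n p),
      is_chain_map beta & forall x, res_aug Q (beta 0%N x) = res_aug R x].
Proof.
have infl (Y Z : bimodType A A) (f : bihom Y Z) :
    bimod_morphism (f : inflate E Y -> inflate E Z).
  by case: (bihomP f) => fl fa fb; split=> [|l x|x l]; [|exact: fa|exact: fb].
have [|||tau tau_diff tau_aug] := @chain_map_lift _ _ _ _ _ P
  (fun n => inflate E (Q n)) (fun n => Bihom (infl _ _ (res_diff Q n)))
  (Bihom (infl _ _ (res_aug Q))) (Bihom pr_morphism).
- exact: (res_aug_surj Q).
- exact: (@res_exact0 _ _ _ _ Q).
- exact: (@res_exactS _ _ _ _ Q).
have [beta betaE] : exists beta : forall n, bihom (R n) (Q n),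
    forall n p, beta n (q n p) = tau n p.
  by exists (fun n => sval (cid (inflate_factor (tau n)))) => n; case: cid.
exists tau, beta; split=> // [n x|x]; have [p <-] := q_surj x.
  by rewrite q_diff !betaE; exact: tau_diff.
by rewrite betaE q_aug; exact: tau_aug.
Qed.

(** Pulling [h] back along [q] gives a one-sided primitive of [f]. *)
Lemma decomposition_of_coboundary n (Y : bimodType A A)
    (f : bihom (P n.+1) (inflate E Y)) (g : bihom (R n.+1) Y) (h : bihom (R n) Y) :
  (forall p, g (q n.+1 p) = f p) -> (forall x, g x = h (res_diff R n x)) ->
  exists (phi : bihom (tens X n.+1) Y) (z : bihom (P n) (inflate E Y)),
    forall p, f p = phi (th n.+1 p).1 + z (res_diff P n p).
Proof.
move=> gq gh.
have h_mor : bimod_morphism (fun p : half E (P n) => h (q n p) : inflate_right E Y).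
  split=> [c p p'|a p|p l]; first by rewrite (bihom_lin (q n)); exact: (bihom_lin h).
    by rewrite (bihom_lact (q n)); exact: (bihom_lact h).
  by rewrite (bihom_ract (q n)); exact: (bihom_ract h).
apply: (cocycle_decomposition thP X_proj (g := Bihom h_mor)) => p.
by rewrite -gq gh q_diff.
Qed.

(** Going from R to Q and back is homotopic to the identity, so a primitive over Q yields one of [g]
    over R. *)
Lemma kernel_decomposition n (Y : bimodType A A)
    (f : bihom (P n.+1) (inflate E Y)) (g : bihom (R n.+1) Y) (h : bihom (Q n) Y) :
  (forall p, f (res_diff P n.+1 p) = 0) -> (forall p, g (q n.+1 p) = f p) ->
  (forall x, g (alpha n.+1 x) = h (res_diff Q n x)) ->
  exists (phi : bihom (tens X n.+1) Y) (z : bihom (P n) (inflate E Y)),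
    forall p, f p = phi (th n.+1 p).1 + z (res_diff P n p).
Proof.
move=> fd gq gh; have [tau [beta [_ beta_diff beta_aug]]] := inflation_exists.
have [||h' h'E] := chain_map_null
  (F := fun m => bihom_comp (beta m) (alpha m) - bihom_id (R m)) _ _ n.
- move=> m x; rewrite !bihom_fun_sub bihomB /=.
  by rewrite alpha_diff beta_diff.
- by move=> x; rewrite bihom_fun_sub bihomB /= alpha_aug beta_aug subrr.
apply: (decomposition_of_coboundary (g := g)
  (h := bihom_comp (beta n) h - bihom_comp h' g)) => // x.
have gd y : g (res_diff R n.+1 y) = 0.
  by have [p <-] := q_surj y; rewrite q_diff gq fd.
have [y] := h'E x; rewrite bihom_fun_sub => /(congr1 g).
rewrite bihomB bihomD gd add0r [_ (alpha _ _)]gh => hE.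
rewrite bihom_fun_sub -[bihom_comp h' g _]/(g (h' (res_diff R n x))) -hE.
by rewrite /= beta_diff opprB addrC subrK.
Qed.

(** With coefficients X the part Ext(A, X) vanishes by parity, so every cocycle comes from a power
    of X. *)
Lemma offdiag_cocycle_decomposition n (f : bihom (P n.+1) (inflate E X)) :
  (forall p, f (res_diff P n.+1 p) = 0) ->
  exists (phi : bihom (tens X n.+1) X) (z : bihom (P n) (inflate E X)),
    forall p, f p = phi (th n.+1 p).1 + z (res_diff P n p).
Proof.
move=> fd; have [g gq] := inflate_factor f.
have [x|h gh] := parity_cocycle eP (f := g).
  by have [p <-] := q_surj x; rewrite q_diff gq fd.
exact: (decomposition_of_coboundary gq gh).
Qed.

Lemma inflate_reg_lift n (f : bihom (P n) (inflate E (regular_bimod A))) :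
  exists F : bihom (P n) (regular_bimod L), forall p, pr (F p : L) = f p :> A.
Proof.
have [a|F FE] := projective_lift (p := Bihom pr_morphism)
  (@res_projective _ _ _ _ P n) (bihomP f); last by exists F.
by exists (io (f a : A) : L); exact: te_pr_in.
Qed.

Lemma j_comp_morphism (U : bimodType L L) (f : bihom U (inflate E X)) :
  bimod_morphism (fun p : U => j (f p : X) : regular_bimod L).
Proof.
split=> [c p p'|l p|p l]; first by rewrite bihom_lin te_j_lin.
  by rewrite inflate_lact -te_j_mulr.
by rewrite inflate_ract -te_j_mull.
Qed.

Lemma r_comp_morphism (U : bimodType L L) (f : bihom U (regular_bimod L)) :
  (forall p, pr (f p : L) = 0) ->
  bimod_morphism (fun p : U => r (f p : L) : inflate E X).
Proof.
move=> f0; split=> [c p p'|l p|p l]; first by rewrite bihom_lin te_r_lin.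
  rewrite bihom_lact -[lact l (f p)]/(l * (f p : L)) te_rM f0 ractr0 addr0.
  exact: erefl.
rewrite bihom_ract -[ract (f p) l]/((f p : L) * l) te_rM f0 lact0l add0r.
exact: erefl.
Qed.

Lemma j_r_comp (l : L) : pr l = 0 -> j (r l) = l.
Proof. by move=> l0; rewrite [RHS](te_decomp E) l0 raddf0 add0r. Qed.

(* The obstruction to lifting the cocycle [f] along [pr] is a cocycle with
   values in [X], which is determined by its values on the bar section. *)
Lemma lift_with_obstruction n (f : bihom (P n.+1) (inflate E (regular_bimod A)))
    (N : bihom (tens X n.+2) X) :
  (forall p, f (res_diff P n.+1 p) = 0) ->
  (forall x, N (tens_pure x) = ract (x ord0) (f (u (x \o lift ord0)) : A)
     + (-1) ^+ n.+2 *: lact (f (u (x \o lift ord_max)) : A) (x ord_max)) ->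
  exists F : bihom (P n.+1) (regular_bimod L),
    (forall p, pr (F p : L) = f p :> A) /\
    (forall p, F (res_diff P n.+1 p) = j (N (th n.+2 p).1)).
Proof.
move=> fd NE; have [F FE] := inflate_reg_lift f.
pose Fd : bihom (P n.+2) (regular_bimod L) := bihom_comp (res_diff P n.+1) F.
have prFd p : pr (Fd p : L) = 0 by rewrite /Fd /= FE fd.
pose D := Bihom (r_comp_morphism prFd).
have [p|phi [z DE]] := offdiag_cocycle_decomposition (f := D).
  by rewrite /= res_diffK bihom_at0; exact: (te_r0 E).
(* Both sides are compared at [u x]: there the coboundary of z disappears, and the derivation rule
   for [te_r] turns [bar_boundary] into the two terms of N. *)
have phiN t : phi t = N t.
  move: t; apply: tens_ext; [exact: bihom_lin|exact: bihom_lin|] => x.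
  have := DE (u x); rewrite (inflate_bar uP) addr0 (theta_bar thP uP) => <-.
  rewrite NE -[LHS]/(r (F (res_diff P n.+1 (u x)) : L)) uP.2 /bar_boundary.
  rewrite bihomD bihomZ bihom_lact bihom_ract addrC te_r_lin addrC.
  rewrite -[lact (j _) _]/(j _ * (F _ : L)) -[ract (F _) _]/((F _ : L) * j _).
  by rewrite !te_rM !te_pr_j !te_rj lact0l ractr0 add0r addr0 !FE.
(* Changing the lift by an X-valued cochain does not change its projection and absorbs the
   coboundary of z. *)
exists (F - Bihom (j_comp_morphism z)); split=> p.
  by rewrite bihom_fun_sub raddfB /= te_pr_j subr0 FE.
rewrite bihom_fun_sub /= -[F _](j_r_comp (prFd p)).
rewrite -[r _]/(D p : X) DE te_jD phiN addrK.
by [].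
Qed.

(** Oddness of n makes the sign (-1)^(n+2) of the second term equal to -1, as in nabla. *)
Lemma nabla_lift n (phi : bihom (tens X n.+1) (regular_bimod A)) : odd n ->
  exists F : bihom (P n.+1) (regular_bimod L),
    (forall p, pr (F p : L) = phi (th n.+1 p).1 :> A) /\
    (forall p, F (res_diff P n.+1 p) = j (nabla X n phi (th n.+2 p).1 : X)).
Proof.
move=> n_odd.
pose f := Bihom (theta_cocycle_morphism th phi).
have fE p : f p = phi (th n.+1 p).1 by [].
apply: (lift_with_obstruction (f := f) (N := nabla X n phi)) => [p|x].
  by rewrite fE (theta_diff thP) bihom_at0.
rewrite !fE !(theta_bar thP uP) -signr_odd /= negbK n_odd expr1 scaleN1r.
exact: nabla_pure.
Qed.

(** Provides preimages under HH(L) -> HH(A). The given cocycle is recovered only up to [h], because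
    going from Q to R and back is merely homotopic to the identity. *)
Lemma inflation_lift n (f : bihom (Q n.+1) (regular_bimod A)) :
  (forall x, f (res_diff Q n.+1 x) = 0) ->
  exists (F : bihom (P n.+1) (regular_bimod L)) (g : bihom (R n.+1) (regular_bimod A))
    (h : bihom (Q n) (regular_bimod A)),
  [/\ forall p, F (res_diff P n.+1 p) = 0,
      forall p, (g (q n.+1 p) : A) = pr (F p : L)
    & forall x, g (alpha n.+1 x) - f x = h (res_diff Q n x)].
Proof.
move=> fd; have [tau [beta [tauE beta_diff beta_aug]]] := inflation_exists.
have f_mor : bimod_morphism
    (fun p : P n.+1 => f (tau n.+1 p : Q n.+1) : inflate E (regular_bimod A)).
  split=> [c p p'|l p|p l]; first by rewrite bihom_lin; exact: (bihom_lin f).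
    by rewrite inflate_lact; exact: (bihom_lact f).
  by rewrite inflate_ract; exact: (bihom_ract f).
have tau_diff m p : res_diff Q m (tau m.+1 p : Q m.+1) = tau m (res_diff P m p).
  by rewrite !tauE beta_diff q_diff.
have [||F [FE Fd]] := lift_with_obstruction (f := Bihom f_mor) (N := 0).
- by move=> p; rewrite /= -tau_diff fd.
(* The boundary of [u y] dies under [tau], so [tau] sends [u y] to a cycle, hence to a boundary,
   which [f] kills: there is no obstruction. *)
- have f0 y : f (tau n.+1 (u y) : Q n.+1) = 0.
    have [|v <-] := (res_exactS (tau n.+1 (u y) : Q n.+1)).1; last exact: fd.
    by rewrite tau_diff (inflate_bar uP).
  by move=> x; rewrite bihom0E /= !f0 ractr0 lact0l scaler0 addr0.
have [||h hE] := chain_map_null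
  (F := fun m => bihom_comp (alpha m) (beta m) - bihom_id (Q m)) _ _ n.
- move=> m x; rewrite !bihom_fun_sub bihomB /=.
  by rewrite beta_diff alpha_diff.
- by move=> x; rewrite bihom_fun_sub bihomB /= beta_aug alpha_aug subrr.
exists F, (bihom_comp (beta n.+1) f), (bihom_comp h f); split=> [p|p|x].
- by rewrite Fd bihom0E te_j0.
- by rewrite FE /= tauE.
have [y] := hE x; rewrite bihom_fun_sub => /(congr1 f).
by rewrite bihomB bihomD fd add0r.
Qed.

Definition nablaL n : {linear bihom (tpow X n) (regular_bimod A)
  -> bihom (tpow X n.+1) X} := nabla X n.

Lemma pr_eq_difference n (f f' : bihom (P n) (regular_bimod L)) :
  (forall p, pr (f p : L) = pr (f' p : L)) ->
  exists w : bihom (P n) (inflate E X), forall p, j (w p : X) = f p - f' p :> L.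
Proof.
move=> ff'; pose D : bihom (P n) (regular_bimod L) := f - f'.
have D0 p : pr (D p : L) = 0 by rewrite bihom_fun_sub raddfB /= ff' subrr.
exists (Bihom (r_comp_morphism D0)) => p.
exact: etrans (j_r_comp (D0 p)) (bihom_fun_sub f f' p).
Qed.

Definition pr_comp n (f : bihom (P n) (regular_bimod L)) :
  bihom (P n) (inflate E (regular_bimod A)) := bihom_comp f (Bihom pr_morphism).
Lemma pr_compE n (f : bihom (P n) (regular_bimod L)) p :
  (pr_comp f p : A) = pr (f p : L).
Proof. by []. Qed.

(** HH(L) -> HH(A) on cochains: project the values to A, descend to R, pull back to Q. *)
Definition reduces n (f : bihom (P n) (regular_bimod L))
    (c : bihom (Q n) (regular_bimod A)) : Prop :=
  exists g : bihom (R n) (regular_bimod A),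
    (forall p, (g (q n p) : A) = pr (f p : L)) /\ (forall x, c x = g (alpha n x)).

Lemma reduces_exists n (f : bihom (P n) (regular_bimod L)) :
  exists c, reduces f c.
Proof.
have [g gq] := inflate_factor (pr_comp f).
by exists (bihom_comp (alpha n) g), g.
Qed.

Lemma reduces_cocycle n (f : bihom (P n) (regular_bimod L))
    (c : bihom (Q n) (regular_bimod A)) :
  reduces f c -> (forall p, f (res_diff P n p) = 0) ->
  forall x, c (res_diff Q n x) = 0.
Proof.
move=> [g [gq cE]] fd x; rewrite cE -alpha_diff.
by have [p <-] := q_surj (alpha n.+1 x); rewrite q_diff gq fd raddf0.
Qed.

Lemma reduces_linear n a (f f' : bihom (P n) (regular_bimod L))
    (c c' : bihom (Q n) (regular_bimod A)) :
  reduces f c -> reduces f' c' -> reduces (a *: f + f') (a *: c + c').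
Proof.
move=> [g [gq cE]] [g' [gq' cE']]; exists (a *: g + g'); split=> [p|x].
  by rewrite !bihom_linE linearP /= -gq -gq'.
by rewrite !bihom_linE cE cE'.
Qed.

Lemma reduces_coboundary n (f f' : bihom (P n.+1) (regular_bimod L))
    (c c' : bihom (Q n.+1) (regular_bimod A)) (h : bihom (P n) (regular_bimod L)) :
  reduces f c -> reduces f' c' -> (forall p, f p - f' p = h (res_diff P n p)) ->
  exists h' : bihom (Q n) (regular_bimod A),
    forall x, c x - c' x = h' (res_diff Q n x).
Proof.
move=> [g [gq cE]] [g' [gq' cE']] fh; have [h0 h0E] := inflate_factor (pr_comp h).
exists (bihom_comp (alpha n) h0) => x; rewrite cE cE' /= -alpha_diff.
have [p <-] := q_surj (alpha n.+1 x).
by rewrite q_diff h0E pr_compE -fh raddfB /= gq gq'.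
Qed.

Lemma reduction_map n : exists pm : {linear HH P n.+1 -> HH Q n.+1},
  forall (x : HH P n.+1) f c, is_class x f -> reduces f c -> is_class (pm x) c.
Proof.
pose rel (x : HH P n.+1) (y : HH Q n.+1) :=
  exists f c, [/\ is_class x f, reduces f c & is_class y c].
have relE x y f c : rel x y -> is_class x f -> reduces f c -> is_class y c.
  move=> [f' [c' [xf' fc' yc']]] xf fc; have [h hE] := (class_eq xf' xf).1 erefl.
  have [h' h'E] := reduces_coboundary fc' fc hE.
  exact: class_shift yc' h'E.
have [||a x y x' y' [f [c [xf fc yc]]] [f' [c' [xf' fc' yc']]]|pm pmE] :=
  @linear_of_relation _ _ _ rel.
- move=> x; have [f xf] := class_has_cocycle x; have [c fc] := reduces_exists f.
  have [y yc] := cocycle_has_class (reduces_cocycle fc (class_cocycle xf)).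
  by exists y, f, c.
- move=> x y y' rxy [f [c [xf fc yc']]]; have yc := relE _ _ _ _ rxy xf fc.
  by apply/(class_eq yc yc'); exists 0 => p; rewrite subrr bihom0E.
- exists (a *: f + f'), (a *: c + c'); split; [exact: class_linear| |exact: class_linear].
  exact: reduces_linear.
by exists pm => x f c; exact: relE.
Qed.

Lemma reduction_surj n (pm : HH P n.+1 -> HH Q n.+1) :
  (forall x f c, is_class x f -> reduces f c -> is_class (pm x) c) ->
  forall y, exists x, pm x = y.
Proof.
move=> pmE y; have [c yc] := class_has_cocycle y.
have [F [g [h [Fd gF hE]]]] := inflation_lift (class_cocycle yc).
have [x xF] := cocycle_has_class Fd; exists x.
have xg : is_class (pm x) (bihom_comp (alpha n.+1) g).
  by apply: (pmE _ _ _ xF); exists g.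
by apply/(class_eq xg yc); exists h.
Qed.

(** [kernel_decomposition] gives the projection of a cocycle up to a coboundary; the latter lifts to
    an L-valued coboundary, which is subtracted. *)
Lemma reduction_kernel n (pm : HH P n.+1 -> HH Q n.+1) x :
  (forall x f c, is_class x f -> reduces f c -> is_class (pm x) c) -> pm x = 0 ->
  exists f (phi : bihom (tens X n.+1) (regular_bimod A)), is_class x f /\
    forall p, pr (f p : L) = phi (th n.+1 p).1 :> A.
Proof.
move=> pmE x0; have [f xf] := class_has_cocycle x; have [c fc] := reduces_exists f.
have [h hE] := (class_eq0 (pmE _ _ _ xf fc)).1 x0; case: fc => g [gq cE].
have [|||phi [z fE]] := kernel_decomposition (f := pr_comp f) (g := g) (h := h).
- by move=> p; rewrite pr_compE (class_cocycle xf) raddf0.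
- exact: gq.
- by move=> y; rewrite -cE hE.
have [z' z'E] := inflate_reg_lift z.
exists (f - bihom_comp (res_diff P n) z'), phi; split.
  apply: (class_shift (h := z') xf) => p.
  by rewrite bihom_fun_sub opprB addrC subrK.
move=> p; rewrite bihom_fun_sub raddfB /= z'E -pr_compE fE addrK.
by [].
Qed.

(** The first component of theta is its second component on the boundary, so [phi] of the second
    component is a one-sided primitive; it descends to R. *)
Lemma theta_reduces_to_coboundary n (phi : bihom (tens X n.+1) (regular_bimod A))
    f c : reduces f c -> (forall p, pr (f p : L) = phi (th n.+1 p).1 :> A) ->
  exists h : bihom (Q n) (regular_bimod A), forall x, c x = h (res_diff Q n x).
Proof.
move=> [g [gq cE]] fphi.
have k_mor : bimod_morphism
    (fun p : half E (P n) => phi (th n (p : P n)).2 : inflate_right E (regular_bimod A)).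
  split=> [a p p'|a p|p l]; first by rewrite (theta2_lin th) bihom_lin.
    by rewrite restr_lactE theta2_in bihom_lact.
  by rewrite restr_ractE theta2_ract bihom_ract.
have [h hq] := q_factor (Bihom k_mor).
exists (bihom_comp (alpha n) h) => x; rewrite cE /= -alpha_diff.
have [p <-] := q_surj (alpha n.+1 x).
by rewrite q_diff hq gq fphi /= (thetaS thP).
Qed.

Lemma even_degree n : odd n -> isomorphic (HH P n.+1) (HH Q n.+1 * Ker (nablaL n))%type.
Proof.
move=> n_odd; have [pm pmE] := reduction_map n.
pose rel (phi : Ker (nablaL n)) (x : HH P n.+1) := exists2 f, is_class x f
  & forall p, pr (f p : L) =
    (subspace_val phi : bihom (tens X n.+1) (regular_bimod A)) (th n.+1 p).1 :> A.
have ker_nabla (phi : Ker (nablaL n)) t : nabla X n (subspace_val phi) t = 0.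
  by have /eqP -> := subspace_valP phi; rewrite bihom0E.
have [|||i iE] := @linear_of_relation _ _ _ rel.
- move=> phi; have [F [Fphi Fd]] := nabla_lift (subspace_val phi) n_odd.
  have [|x xF] := cocycle_has_class (f := F); last by exists x, F.
  by move=> p; rewrite Fd ker_nabla te_j0.
(* Two lifts differ by an X-valued cocycle. It comes from a map X^(n+1) -> X up to coboundary, and n
   + 1 is even, so that map is zero. *)
- move=> phi x x' [f xf fE] [f' xf' fE']; apply/(class_eq xf xf').
  have [p|w wE] := pr_eq_difference (f := f) (f' := f'); first by rewrite fE fE'.
  have [p|psi [z zE]] := offdiag_cocycle_decomposition (f := w).
    by apply: (@te_j_inj _ _ _ _ E); rewrite wE !(class_cocycle xf, class_cocycle xf') subrr te_j0.
  exists (Bihom (j_comp_morphism z)) => p /=.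
  by rewrite -wE zE (tens_even_vanish eP) /= ?n_odd // add0r.
- move=> a phi x phi' x' [f xf fE] [f' xf' fE'].
  exists (a *: f + f') => [|p]; first exact: class_linear.
  by rewrite !bihom_linE linearP /= fE fE'.
apply: (isomorphic_of_exact (i := i) (p := pm)); split.
- move=> phi phi' /eqP; rewrite -subr_eq0 -raddfB => /eqP i0.
  apply/eqP; rewrite -subr_eq0; apply/eqP; move: (phi - phi') i0 => psi i0.
  have [f xf fE] := iE psi; have [h hE] := (class_eq0 xf).1 i0.
  apply: val_inj; apply: bihom_inj => t; rewrite bihom0E.
  apply: (theta_coboundary_inj thP uP (z := pr_comp h)) => p.
  by rewrite pr_compE -hE -fE.
- move=> x; split=> [x0|[phi <-]].
    have [f [phi [xf fphi]]] := reduction_kernel pmE x0.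
    (* The lift [F] of the cocycle of [phi] and the cocycle [f] differ by an X-valued w. Its
       coboundary is the cocycle of nabla phi, whence nabla phi = 0. *)
    have [F [Fphi Fd]] := nabla_lift phi n_odd.
    have [p|w wE] := pr_eq_difference (f := F) (f' := f); first by rewrite fphi Fphi.
    have phiK : phi \in in_ker (nablaL n).
      apply/eqP/bihom_inj => t; rewrite bihom0E.
      apply: (theta_coboundary_inj thP uP (z := w)) => p.
      by apply: (@te_j_inj _ _ _ _ E); rewrite wE (class_cocycle xf) subr0 Fd.
    exists (Subspace phiK); have [f' xf' f'E] := iE (Subspace phiK).
    apply/(class_eq xf' xf).
    have [p|v vE] := pr_eq_difference (f := f') (f' := f); first by rewrite fphi f'E.
    have [p|psi [z zE]] := offdiag_cocycle_decomposition (f := v).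
      by apply: (@te_j_inj _ _ _ _ E); rewrite vE !(class_cocycle xf, class_cocycle xf') subrr te_j0.
    exists (Bihom (j_comp_morphism z)) => p /=.
    by rewrite -vE zE (tens_even_vanish eP) /= ?n_odd // add0r.
  have [f xf fE] := iE phi; have [c fc] := reduces_exists f.
  apply/(class_eq0 (pmE _ _ _ xf fc)); exact: theta_reduces_to_coboundary fc fE.
exact: reduction_surj pmE.
Qed.

Lemma odd_degree n : odd n ->
  exists (i : {linear Coker (nablaL n) -> HH P n.+2})
         (p : {linear HH P n.+2 -> HH Q n.+2}), short_exact i p.
Proof.
move=> n_odd; have [pm pmE] := reduction_map n.+1.
pose jth (phi : bihom (tens X n.+2) X) : bihom (P n.+2) (regular_bimod L) :=
  Bihom (j_comp_morphism (Bihom (theta_cocycle_morphism th phi))).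
have jthE (phi : bihom (tens X n.+2) X) p : jth phi p = j (phi (th n.+2 p).1) by [].
have jth_d phi p : jth phi (res_diff P n.+2 p) = 0.
  by rewrite jthE (theta_diff thP) bihom_at0 te_j0.
pose rel (t : Coker (nablaL n)) (x : HH P n.+2) :=
  exists2 phi : bihom (tens X n.+2) X, t = qproj _ phi & is_class x (jth phi).
have im_nabla (phi : bihom (tens X n.+2) X) : phi \in in_im (nablaL n) <->
    exists phi0, forall t, phi t = nabla X n phi0 t.
  split=> [/asboolP[phi0 <-]|[phi0 phiE]]; first by exists phi0.
  by apply/asboolP; exists phi0; apply: bihom_inj => t; rewrite phiE.
have [|||i iE] := @linear_of_relation _ _ _ rel.
- move=> t; have [x xt] := cocycle_has_class (jth_d (qrepr t)).
  by exists x, (qrepr t) => //; rewrite qreprK.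
- move=> t x x' [phi -> xf] [phi' /eqP]; rewrite qproj_eq => /im_nabla[phi0 phi0E] xf'.
  (* [F] has the cocycle of nabla phi0 as its coboundary, so the image of nabla gives zero
     classes. *)
  apply/(class_eq xf xf'); have [F [Fphi Fd]] := nabla_lift phi0 n_odd.
  exists F => p; rewrite Fd -phi0E !jthE bihom_fun_sub.
  by rewrite (linear_sub _ _ (te_j_lin E)).
- move=> a t x t' x' [phi -> xf] [phi' -> xf'].
  exists (a *: phi + phi'); first by rewrite linearP.
  have -> : jth (a *: phi + phi') = a *: jth phi + jth phi'.
    by apply: bihom_inj => p; rewrite !bihom_linE !jthE bihom_linE te_j_lin.
  exact: class_linear.
exists i, pm; split.
- move=> t t' /eqP; rewrite -subr_eq0 -raddfB => /eqP i0.
  apply/eqP; rewrite -subr_eq0; apply/eqP; move: (t - t') i0 => {t t'} t i0.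
  have [phi tE xf] := iE t; have [z0 z0E] := (class_eq0 xf).1 i0.
  rewrite tE -(raddf0 (qproj (in_im (nablaL n)))); apply/eqP; rewrite qproj_eq subr0.
  (* The projection of the primitive [z0] is a cocycle that may have a part in HH(A). Subtracting a
     lift of that part, then a coboundary, leaves the cocycle of some [phi'] as projection, and then
     nabla phi' = phi. *)
  have [c zc] := reduces_exists z0.
  have pz_d p : pr_comp z0 (res_diff P n.+1 p) = 0.
    by rewrite pr_compE -z0E jthE te_pr_j.
  have c_d x : c (res_diff Q n.+1 x) = 0.
    case: zc => g [gq cE]; rewrite cE -alpha_diff.
    by have [p <-] := q_surj (alpha n.+2 x); rewrite q_diff gq -z0E jthE te_pr_j.
  have [F [g1 [h [Fd g1F hE]]]] := inflation_lift c_d.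
  case: zc => g [gq cE].
  pose z1 : bihom (P n.+1) (regular_bimod L) := z0 - F.
  have z1_d p : pr_comp z1 (res_diff P n.+1 p) = 0.
    by rewrite pr_compE bihom_fun_sub Fd subr0 -z0E jthE te_pr_j.
  have [|||phi' [z2 z2E]] := kernel_decomposition (f := pr_comp z1)
      (g := g - g1) (h := - h).
  - exact: z1_d.
  - by move=> p; rewrite bihom_fun_sub gq g1F pr_compE bihom_fun_sub raddfB.
  - by move=> x; rewrite bihom_fun_sub -cE bihom_fun_opp -hE opprB.
  have [z2' z2'E] := inflate_reg_lift z2.
  have [F' [F'phi F'd]] := nabla_lift phi' n_odd.
  pose z3 : bihom (P n.+1) (regular_bimod L) :=
    z1 - bihom_comp (res_diff P n) z2'.
  have [p|w wE] := pr_eq_difference (f := z3) (f' := F').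
    have := z2E p; rewrite pr_compE => z1E.
    by rewrite bihom_fun_sub raddfB /= z2'E z1E addrK F'phi.
  apply/im_nabla; exists phi' => s; apply/eqP; rewrite -subr_eq0 -bihom_fun_sub.
  apply/eqP; move: s; apply: (theta_coboundary_inj thP uP (z := w)) => p.
  apply: (@te_j_inj _ _ _ _ E); rewrite wE F'd.
  have -> : z3 (res_diff P n.+1 p) = j (phi (th n.+2 p).1).
    rewrite !bihom_fun_sub Fd subr0 -z0E jthE /= res_diffK bihom_at0.
    exact: subr0.
  by rewrite bihom_fun_sub (linear_sub _ _ (te_j_lin E)).
- move=> x; split=> [x0|[t <-]].
    have [f [phi [xf fphi]]] := reduction_kernel pmE x0.
    (* The degree n + 2 is odd, so [phi] vanishes by parity and [f] takes its values in X. *)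
    have [p|w wE] := pr_eq_difference (f := f) (f' := 0).
      rewrite fphi bihom0E raddf0; apply: (tens_odd_vanish eP).
      by rewrite /= negbK.
    have [p|psi [z zE]] := offdiag_cocycle_decomposition (f := w).
      by apply: (@te_j_inj _ _ _ _ E); rewrite wE bihom0E subr0 (class_cocycle xf) te_j0.
    exists (qproj _ psi); have [psi' /eqP] := iE (qproj _ psi).
    rewrite qproj_eq => /im_nabla[phi0 phi0E] xf'.
    have [F [Fphi Fd]] := nabla_lift phi0 n_odd.
    apply/(class_eq xf' xf); exists (- F - Bihom (j_comp_morphism z)) => p.
    have fp : f p = j (w p) by rewrite wE bihom0E subr0.
    rewrite bihom_fun_sub bihom_fun_opp Fd -phi0E jthE fp zE te_jD bihom_fun_sub.
    by rewrite (linear_sub _ _ (te_j_lin E)) opprB opprD addrA.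
  have [phi _ xf] := iE t; have [c fc] := reduces_exists (jth phi).
  apply/(class_eq0 (pmE _ _ _ xf fc)); exists 0 => y.
  case: fc => g [gq ->]; have [p <-] := q_surj (alpha n.+2 y).
  by rewrite gq jthE te_pr_j bihom0E.
- exact: reduction_surj pmE.
Qed.
End Reduction.

(** * Null-square algebras *)

(** The inclusions of the factors into A x B do not preserve 1. *)
Record nonunitalMorphism (k : fieldType) (C A : algType k) := NonunitalMorphism {
  num_fun :> C -> A;
  num_linear : linear num_fun;
  num_mul : forall x y, num_fun (x * y) = num_fun x * num_fun y }.

Section Corner.
Variables (k : fieldType) (A B C D : algType k).
Variables (f : nonunitalMorphism C A) (g : nonunitalMorphism D B).
Variable X : bimodType A B.

Definition in_corner : {pred X} := [pred x | ract (lact (f 1) x) (g 1) == x].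
Fact in_corner_submod : submod_closed in_corner.
Proof.
split=> [|c x y]; first by rewrite inE lactr0 ract0l.
by rewrite !inE lact_linearr ract_linearl => /eqP-> /eqP->.
Qed.
HB.instance Definition _ :=
  GRing.isSubmodClosed.Build k X in_corner in_corner_submod.
Definition corner : Type := subspace in_corner.
HB.instance Definition _ := GRing.Lmodule.on corner.
Definition corner_val (u : corner) : X := subspace_val u.
Lemma corner_val_lin : linear corner_val.
Proof. by move=> c u v; exact: (linearP (val : subspace in_corner -> X)). Qed.
Lemma corner_val_inj : injective corner_val. Proof. exact: val_inj. Qed.
Lemma corner_valP u : ract (lact (f 1) (corner_val u)) (g 1) = corner_val u.
Proof. exact: (eqP (subspace_valP u)). Qed.
Lemma num1M c : f 1 * f c = f c. Proof. by rewrite -num_mul mul1r. Qed.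
Lemma numM1 d : g d * g 1 = g d. Proof. by rewrite -num_mul mulr1. Qed.

Lemma corner_val_lact u : lact (f 1) (corner_val u) = corner_val u.
Proof. by rewrite -corner_valP lractA -lactM num1M -lractA corner_valP. Qed.
Lemma corner_val_ract u : ract (corner_val u) (g 1) = corner_val u.
Proof. by rewrite -corner_valP -ractM numM1 corner_valP. Qed.

Fact corner_lact_proof c (u : corner) : lact (f c) (corner_val u) \in in_corner.
Proof.
by apply/eqP; rewrite -lactM num1M lractA corner_val_ract.
Qed.
Fact corner_ract_proof (u : corner) d : ract (corner_val u) (g d) \in in_corner.
Proof. by apply/eqP; rewrite -lractA corner_val_lact -ractM numM1. Qed.
Definition corner_lact c u : corner := Subspace (corner_lact_proof c u).
Definition corner_ract u d : corner := Subspace (corner_ract_proof u d).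

Fact corner_lr a : linear (corner_lact a).
Proof.
by move=> c u v; apply: corner_val_inj; rewrite corner_val_lin /= -lact_linearr -corner_val_lin.
Qed.
Fact corner_ll u : linear (corner_lact^~ u).
Proof.
move=> c a b; apply: corner_val_inj; rewrite corner_val_lin /= -lact_linearl.
by rewrite -num_linear.
Qed.
Fact corner_rl a : linear (corner_ract^~ a).
Proof.
by move=> c u v; apply: corner_val_inj; rewrite corner_val_lin /= -ract_linearl -corner_val_lin.
Qed.
Fact corner_rr u : linear (corner_ract u).
Proof.
move=> c a b; apply: corner_val_inj; rewrite corner_val_lin /= -ract_linearr.
by rewrite -num_linear.
Qed.
Fact corner_l1 u : corner_lact 1 u = u.
Proof. by apply: corner_val_inj; exact: corner_val_lact. Qed.
Fact corner_lM a b u : corner_lact (a * b) u = corner_lact a (corner_lact b u).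
Proof.
by apply: corner_val_inj; rewrite /corner_val /= num_mul lactM.
Qed.
Fact corner_r1 u : corner_ract u 1 = u.
Proof. by apply: corner_val_inj; exact: corner_val_ract. Qed.
Fact corner_rM u a b : corner_ract u (a * b) = corner_ract (corner_ract u a) b.
Proof.
by apply: corner_val_inj; rewrite /corner_val /= num_mul ractM.
Qed.
Fact corner_lrA a u b : corner_ract (corner_lact a u) b = corner_lact a (corner_ract u b).
Proof. by apply: corner_val_inj; exact: lractA. Qed.
HB.instance Definition _ := isBimodule.Build k C D corner corner_lr corner_ll
  corner_l1 corner_lM corner_rl corner_rr corner_r1 corner_rM corner_lrA.
End Corner.
Arguments in_corner {k A B C D} f g X.

(** A map linear along [f] and [g] lands in the corner f(1) Y g(1) and is an ordinary bimodule map
    there; cutting a preimage down by f(1) and g(1) shows that [p] is onto between the parts that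
    matter. *)
Lemma corner_lift (k : fieldType) (A B C D : algType k)
    (f : nonunitalMorphism C A) (g : nonunitalMorphism D B) (U : bimodType C D)
    (X Y : bimodType A B) (p : bihom X Y) (h : U -> Y) :
  projective U -> (forall y, exists x, p x = y) -> linear h ->
  (forall c u, h (lact c u) = lact (f c) (h u)) ->
  (forall u d, h (ract u d) = ract (h u) (g d)) ->
  exists h' : U -> X, [/\ linear h',
    forall c u, h' (lact c u) = lact (f c) (h' u),
    forall u d, h' (ract u d) = ract (h' u) (g d)
    & forall u, p (h' u) = h u].
Proof.
move=> U_proj p_surj hl ha hb.
have p_in (x : corner f g X) : p (corner_val x) \in in_corner f g Y.
  by apply/eqP; rewrite -bihom_lact -bihom_ract corner_valP.
have p_mor : bimod_morphism (fun x => Subspace (p_in x) : corner f g Y).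
  split=> [c x y|c x|x d]; apply: corner_val_inj.
  - rewrite [RHS]corner_val_lin; apply: etrans (congr1 p (corner_val_lin c x y)) _.
    exact: bihom_lin.
  - exact: (bihom_lact p).
  - exact: (bihom_ract p).
have h_in u : h u \in in_corner f g Y by apply/eqP; rewrite -ha -hb lact1 ract1.
have h_mor : bimod_morphism (fun u => Subspace (h_in u) : corner f g Y).
  split=> [c x y|c x|x d]; apply: corner_val_inj.
  - by rewrite [RHS]corner_val_lin; exact: hl.
  - exact: ha.
  - exact: hb.
have [u|h' h'E] := projective_lift (p := Bihom p_mor) U_proj h_mor.
  have [x xE] := p_surj (h u).
  have x_in : ract (lact (f 1) x) (g 1) \in in_corner f g X.
    by apply/eqP; rewrite lractA -ractM numM1 -lractA -lactM num1M.
  exists (Subspace x_in); apply: corner_val_inj.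
  by rewrite /corner_val /= bihom_ract bihom_lact xE -ha -hb lact1 ract1.
exists (fun u => corner_val (h' u)); split=> [c u v|c u|u d|u].
- by rewrite bihom_lin corner_val_lin.
- by rewrite bihom_lact.
- by rewrite bihom_ract.
- exact: (congr1 (@corner_val _ _ _ _ _ f g Y) (h'E u)).
Qed.

Section NullSquareExtension.
Variables (k : fieldType) (A B : algType k).
Variables (M : bimodType B A) (N : bimodType A B).
Local Notation AB := (prod_alg A B).
Local Notation L := (nullsq M N).
Local Notation MN := (offdiag M N).

Definition diag_in (a : AB) : L := ((a.1, 0), (0, a.2)).
Definition diag_pr (l : L) : AB := (l.1.1, l.2.2).
Definition offdiag_in (x : MN) : L := ((0, x.2), (x.1, 0)).
Definition offdiag_pr (l : L) : MN := (l.2.1, l.1.2).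

Fact diag_in_zmod : zmod_morphism diag_in.
Proof. by move=> a b; congr ((_, _), (_, _)); rewrite /= subrr. Qed.
HB.instance Definition _ := GRing.isZmodMorphism.Build AB L diag_in diag_in_zmod.
Fact diag_in_monoid : monoid_morphism diag_in.
Proof.
split=> // a b; congr ((_, _), (_, _)) => /=.
  by rewrite lactr0 ract0l addr0.
by rewrite lactr0 ract0l addr0.
Qed.
HB.instance Definition _ := GRing.isMonoidMorphism.Build AB L diag_in diag_in_monoid.
Fact diag_in_scalable : scalable diag_in.
Proof. by move=> c a; congr ((_, _), (_, _)); rewrite /= scaler0. Qed.
HB.instance Definition _ := GRing.isScalable.Build k AB L *:%R diag_in diag_in_scalable.

Fact diag_pr_zmod : zmod_morphism diag_pr. Proof. by []. Qed.
HB.instance Definition _ := GRing.isZmodMorphism.Build L AB diag_pr diag_pr_zmod.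
Fact diag_pr_monoid : monoid_morphism diag_pr.
Proof. by split=> // -[[a n] [m b]] [[a' n'] [m' b']]. Qed.
HB.instance Definition _ := GRing.isMonoidMorphism.Build L AB diag_pr diag_pr_monoid.
Fact diag_pr_scalable : scalable diag_pr. Proof. by []. Qed.
HB.instance Definition _ := GRing.isScalable.Build k L AB *:%R diag_pr diag_pr_scalable.

Lemma offdiag_in_lin : linear offdiag_in.
Proof. by move=> c x y; congr ((_, _), (_, _)); rewrite /= scaler0 addr0. Qed.
Lemma offdiag_pr_lin : linear offdiag_pr. Proof. by []. Qed.
Lemma offdiag_inK : cancel offdiag_in offdiag_pr. Proof. by case. Qed.
Lemma diag_inK : cancel diag_in diag_pr. Proof. by case. Qed.
Lemma diag_pr_offdiag x : diag_pr (offdiag_in x) = 0. Proof. by []. Qed.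
Lemma nullsq_decomp l : l = diag_in (diag_pr l) + offdiag_in (offdiag_pr l).
Proof.
by case: l => [[a n] [m b]]; congr ((_, _), (_, _)); rewrite /= ?addr0 ?add0r.
Qed.
Lemma offdiag_in_lact a x : offdiag_in (lact a x) = diag_in a * offdiag_in x.
Proof.
case: a x => a b [m n]; congr ((_, _), (_, _)); rewrite /= ?mulr0 //.
  by rewrite ract0l addr0.
by rewrite ract0l add0r.
Qed.
Lemma offdiag_in_ract x a : offdiag_in (ract x a) = offdiag_in x * diag_in a.
Proof.
case: a x => a b [m n]; congr ((_, _), (_, _)); rewrite /= ?mul0r //.
  by rewrite lact0l add0r.
by rewrite lact0l addr0.
Qed.
Lemma offdiag_in_mul x y : offdiag_in x * offdiag_in y = 0.
Proof.
case: x y => m n [m' n']; congr ((_, _), (_, _)); rewrite /= ?mul0r //.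
  by rewrite lact0l ractr0 addr0.
by rewrite lact0l ractr0 addr0.
Qed.

Definition nullsq_extension : trivialExtension L MN :=
  TrivialExtension (te_in := diag_in) (te_pr := diag_pr) diag_inK offdiag_in_lin
    offdiag_pr_lin offdiag_inK diag_pr_offdiag nullsq_decomp offdiag_in_lact
    offdiag_in_ract offdiag_in_mul.

(** e kills M on the left and fixes it on the right, and the other way round for N. *)
Lemma offdiag_parity : is_parity MN ((1, 0) : AB).
Proof.
split=> [[a b]||[m n]]; congr (_, _); rewrite /= ?mul1r ?mulr1 ?mul0r ?mulr0 //.
  by rewrite lact0l ract1 add0r.
by rewrite lact1 ractr0 addr0.
Qed.

Definition left_factor : nonunitalMorphism A AB.
Proof.
apply: (@NonunitalMorphism _ _ _ (fun a => (a, 0))) => [c a a'|a a'].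
  by congr (_, _); rewrite /= scaler0 addr0.
by congr (_, _); rewrite /= mulr0.
Defined.
Definition right_factor : nonunitalMorphism B AB.
Proof.
apply: (@NonunitalMorphism _ _ _ (fun b => (0, b))) => [c a a'|a a'].
  by congr (_, _); rewrite /= scaler0 addr0.
by congr (_, _); rewrite /= mulr0.
Defined.

Lemma offdiag_projective : projective M -> projective N -> projective MN.
Proof.
move=> M_proj N_proj X Y p f p_surj.
have fM_lin : linear (fun m : M => f ((m, 0) : MN)).
  by move=> c m m'; rewrite -bihom_lin; congr (f (_, _)); rewrite /= scaler0 addr0.
have fN_lin : linear (fun n : N => f ((0, n) : MN)).
  by move=> c m m'; rewrite -bihom_lin; congr (f (_, _)); rewrite /= scaler0 addr0.
have [b m|m a|gM [gMl gMa gMb gME]] := corner_lift (f := right_factor)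
    (g := left_factor) (p := p) M_proj p_surj fM_lin.
- by rewrite -bihom_lact; congr (f (_, _)); rewrite /= lactr0.
- by rewrite -bihom_ract; congr (f (_, _)); rewrite /= ract0l.
have [a n|n b|gN [gNl gNa gNb gNE]] := corner_lift (f := left_factor)
    (g := right_factor) (p := p) N_proj p_surj fN_lin.
- by rewrite -bihom_lact; congr (f (_, _)); rewrite /= lactr0.
- by rewrite -bihom_ract; congr (f (_, _)); rewrite /= ract0l.
have gM0 : gM 0 = 0 by exact: linear_at0.
have g_mor : bimod_morphism (fun x : MN => gM x.1 + gN x.2).
  split=> [c x y|[a b] [m n]|[m n] [a b]] /=.
  - by rewrite gMl gNl scalerDr addrACA.
  (* Writing m as 1 m places gM m in its corner, so the other component of (a, b) drops out;
     likewise for n. *)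
  - rewrite lactDr gMa gNa -{2}(lact1 m) gMa -{2}(lact1 n) gNa -!lactM.
    by congr (lact _ _ + lact _ _); congr (_, _); rewrite /= ?mulr0 ?mulr1.
  - rewrite ractDl gMb gNb -{2}(ract1 m) gMb -{2}(ract1 n) gNb -!ractM.
    by congr (ract _ _ + ract _ _); congr (_, _); rewrite /= ?mul0r ?mul1r.
exists (Bihom g_mor) => -[m n] /=; rewrite bihomD gME gNE -bihomD.
by congr (f (_, _)); rewrite /= ?addr0 ?add0r.
Qed.
End NullSquareExtension.

Theorem theorem7p3 (k : fieldType) (A B : algType k)
    (M : bimodType B A) (N : bimodType A B)
    (M_neq0 : exists x : M, x <> 0) (N_neq0 : exists x : N, x <> 0)
    (M_proj : projective M) (N_proj : projective N)
    (P : projResolution (regular_bimod (nullsq M N)))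
    (Q : projResolution (regular_bimod (prod_alg A B)))
    (m : nat) (m_gt0 : (0 < m)%N) :
  isomorphic (HH P (2 * m)%N) (HH Q (2 * m)%N * Ker (nabla_even M N m))%type
  /\ exists (i : {linear Coker (nabla_even M N m) -> HH P (2 * m)%N.+1})
            (p : {linear HH P (2 * m)%N.+1 -> HH Q (2 * m)%N.+1}),
       short_exact i p.
Proof.
have X_proj := offdiag_projective M_proj N_proj.
have eP := offdiag_parity M N.
have [th thP] := theta_exists (nullsq_extension M N) P.
have [u uP] := bar_section_exists (nullsq_extension M N) P.
have [R [q [q_aug q_diff q_surj q_factor]]] :=
  right_reduction (nullsq_extension M N) X_proj P.
have [alpha alpha_diff alpha_aug] := chain_map_lift Q (bihom_id _)
  (res_aug_surj R) (@res_exact0 _ _ _ _ R) (@res_exactS _ _ _ _ R).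
(* n = 2m - 1. Positivity of m makes 2m a successor, so that its coboundaries come from a cochain
   one degree lower. *)
have [n n_odd mE] : exists2 n, odd n & (2 * m = n.+1)%N.
  by exists (2 * m).-1%N; case: m m_gt0 => // m' _; rewrite mul2n doubleS //= odd_double.
rewrite /nabla_even mE; split.
  exact: (even_degree X_proj eP thP uP q_aug q_diff q_surj q_factor
    alpha_diff alpha_aug n_odd).
exact: (odd_degree X_proj eP thP uP q_aug q_diff q_surj q_factor
  alpha_diff alpha_aug n_odd).
Qed.
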